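(* Let $T>1$ and $\gamma\in(1,T)$. Let two pairs of functions $(u_1,m_1),(u_2,m_2)\in B(M_1)$ satisfy the system $$u_t+Lu+F_1\Big(u,\nabla u,m,\nabla m,\int_0^1K_1(x)m(x,t)\,dx_1,\dots,\int_0^1K_n(x)m(x,t)\,dx_n,x,t\Big)=0\ \text{ in }Q_T,$$ $$m_t-Lm+F_2(\nabla m,m,u,\nabla u,Lu,x,t)=0\ \text{ in }Q_T,$$ with the boundary conditions $$u|_{\Gamma_{0,T}}=f_u(x,t),\quad \frac{\partial u}{\partial N}\Big|_{\Gamma_{1,T}}=0,\quad m|_{\Gamma_{0,T}}=f_m(x,t),\quad \frac{\partial m}{\partial N}\Big|_{\Gamma_{1,T}}=0 .$$ Set $\widetilde u=u_1-u_2$, $\widetilde m=m_1-m_2$, $\widetilde u_T(x)=\widetilde u(x,T)$, $\widetilde m_T(x)=\widetilde m(x,T)$, and suppose that $$\|\widetilde u_T\|_{H^1(\Omega)}\le\delta,\qquad\|\widetilde m_T\|_{H^1(\Omega)}\le\delta .$$ Then there exist a sufficiently small number $\delta_0=\delta_0(T,M_1,M,\gamma)\in(0,1)$, a number $\beta=\beta(T,M_1,M,\gamma)\in(0,1/6)$ and a number $C_1=C_1(T,M_1,M,\gamma)>0$, all depending only on the listed parameters, such that $$ \begin{aligned} &\|\widetilde u_t\|_{L_2(Q_{\gamma T})}+\|L\widetilde u\|_{L_2(Q_{\gamma T})}+\|\nabla\widetilde u\|_{L_2(Q_{\gamma T})}+\|\widetilde u\|_{L_2(Q_{\gamma T})}\\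 &\quad+\|\nabla\widetilde m\|_{L_2(Q_{\gamma T})}+\|\widetilde m\|_{L_2(Q_{\gamma T})}\le C_1\delta^\beta,\qquad\forall\delta\in(0,\delta_0). \end{aligned} $$ In addition, the system $$u_t+Lu+F_1\Big(u,\nabla u,m,\nabla m,\int_0^1K_1(x)m(x,t)\,dx_1,\dots,\int_0^1K_n(x)m(x,t)\,dx_n,x,t\Big)=0\ \text{ in }Q_T,$$ $$m_t-Lm+F_2(\nabla m,m,u,\nabla u,Lu,x,t)=0\ \text{ in }Q_T,$$ with the boundary conditions $u|_{\Gamma_{0,T}}=f_u(x,t)$, $\frac{\partial u}{\partial N}\big|_{\Gamma_{1,T}}=0$, $m|_{\Gamma_{0,T}}=f_m(x,t)$, $\frac{\partial m}{\partial N}\big|_{\Gamma_{1,T}}=0$ and with given terminal values $u(x,T)$, $m(x,T)$, $x\in\Omega$, has at most one solution $(u,m)\in B(M_1)$.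
   Context: Let $n\ge1$, $\Omega=\{x\in\mathbb{R}^n:0<x_i<1,\ i=1,\dots,n\}$, $\Gamma_0=\{x_1=1,\ x_i\in(0,1),\ i=2,\dots,n\}$, $\Gamma_1=\partial\Omega\setminus\Gamma_0$, $Q_T=\Omega\times(0,T)$, $\Gamma_{0,T}=\Gamma_0\times(0,T)$, $\Gamma_{1,T}=\Gamma_1\times(0,T)$, and $Q_{\gamma T}=\Omega\times(\gamma,T)$. Let $a_{ij}\in C^1(\overline\Omega)$, $a_{ij}=a_{ji}$, and for numbers $\mu_1,\mu_2>0$ let $\mu_1|\xi|^2\le\sum_{i,j=1}^na_{ij}(x)\xi_i\xi_j\le\mu_2|\xi|^2$ for all $\xi\in\mathbb{R}^n$, $x\in\overline\Omega$. Define $Lu=\sum_{i,j=1}^n(a_{ij}(x)u_{x_j})_{x_i}$. On the side of the cube orthogonal to the $x_i$-axis, $\frac{\partial u}{\partial N}=\sum_{j=1}^na_{ij}(x)u_{x_j}\cos(n,x_i)$, where $n$ in $\cos(n,x_i)$ denotes the outward unit normal. $\nabla$ is the gradient in $x$. Let $F_1\in C^1(\mathbb{R}^{4n+3})$, $F_2\in C^1(\mathbb{R}^{3n+4})$, $K_1,\dots,K_n\in L_\infty(\Omega)$, and let $f_u,f_m$ be certain functions on $\Gamma_{0,T}$. Let $M_1>0$, assume $\|K_i\|_{L_\infty(\Omega)}\le M_1$ for $i=1,\dots,n$, and define $$B(M_1)=\Big\{(u,m)\in C^{2,1}(\overline Q_T):\ \max_{t\in[0,T]}\|u(\cdot,t)\|_{C^2(\overline\Omega)}\le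 M_1,\ \max_{t\in[0,T]}\|m(\cdot,t)\|_{C^1(\overline\Omega)}\le M_1\Big\}.$$ $M=M(M_1,K_1,\dots,K_n,Q_T)>0$ denotes a number such that $$\max_{(u,m,x,t)\in\overline{B(M_1)}\times\overline Q_T}\Big|\widehat\nabla F_1\Big(u,\nabla u,m,\nabla m,\int_0^1K_1m\,dx_1,\dots,\int_0^1K_nm\,dx_n,x,t\Big)\Big|\le M,$$ $$\max_{(u,m,x,t)\in\overline{B(M_1)}\times\overline Q_T}\big|\widehat\nabla F_2(\nabla m,m,u,\nabla u,Lu,x,t)\big|\le M,$$ where $\widehat\nabla$ means that the first derivatives are taken only with respect to those variables which contain $u,\nabla u,m,\nabla m$ (i.e. not with respect to the explicit arguments $x,t$). The number $\delta\in(0,1)$ is the level of the error in the terminal data. *)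

(* Defs.v *)
From HB Require Import structures.
From mathcomp Require Import all_boot all_order all_algebra.
From mathcomp Require Import all_classical all_reals all_analysis.

Set Implicit Arguments.
Unset Strict Implicit.
Unset Printing Implicit Defensive.

Import Order.TTheory GRing.Theory Num.Theory.
Import numFieldNormedType.Exports.

Local Open Scope classical_set_scope.
Local Open Scope ring_scope.

(* Coordinatewise product sigma-algebra on row vectors, as the library has it
   for tuples. *)
Definition rV_display : measure_display. Proof. exact: default_measure_display. Qed.

Section rV_measurable.
Context {R : realType} (n : nat).

Let coor (i : 'I_n) (x : 'rV[R]_n) : measurableTypeR R := x ord0 i.

Let rV_set0 : g_sigma_preimage coor set0.
Proof. exact: sigma_algebra0. Qed.

Let rV_setC A : g_sigma_preimage coor A -> g_sigma_preimage coor (~` A).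
Proof. exact: sigma_algebraC. Qed.

Let rV_bigcup (F : _^nat) : (forall i, g_sigma_preimage coor (F i)) ->
  g_sigma_preimage coor (\bigcup_i (F i)).
Proof. exact: sigma_algebra_bigcup. Qed.

HB.instance Definition _ := @isMeasurable.Build rV_display
  'rV[R]_n (g_sigma_preimage coor) rV_set0 rV_setC rV_bigcup.

End rV_measurable.

Section rV_measurable_fun.
Context {R : realType}.

Lemma measurable_coor n (i : 'I_n) :
  measurable_fun [set: 'rV[R]_n]
    ((fun x : 'rV[R]_n => x ord0 i) : _ -> measurableTypeR R).
Proof.
move=> _ Y mY; rewrite setTI; apply: sub_sigma_algebra => /=.
rewrite -bigcup_seq/=; exists i => /=; first by rewrite mem_index_enum.
by exists Y => //; rewrite setTI.
Qed.

Lemma measurable_fun_rV d (T : measurableType d) n (f : T -> 'rV[R]_n) :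
  (forall i, measurable_fun setT
    ((fun x => f x ord0 i) : T -> measurableTypeR R)) ->
  measurable_fun setT f.
Proof.
move=> mf _ A mA; rewrite setTI.
have : g_sigma_preimage (fun i (x : T) => (f x ord0 i : measurableTypeR R)) `<=`
    measurable.
  apply: smallest_sub; first exact: sigma_algebra_measurable.
  case: n => [|n] in f mf A mA *; first by rewrite big_ord0.
  rewrite -bigcup_mkord_ord; apply: bigcup_sub => i Ii.
  by move=> B [C mC <-]; exact: mf.
apply.
rewrite (g_sigma_preimage_comp
  (fun i (x : 'rV[R]_n) => (x ord0 i : measurableTypeR R)) f).
by exists A => //; rewrite setTI.
Qed.

Definition cons_rV n (p : measurableTypeR R * 'rV[R]_n) : 'rV[R]_n.+1 :=
  \row_(i < n.+1) if unlift ord0 i is Some j then p.2 ord0 j else p.1.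

Lemma measurable_cons_rV n : measurable_fun setT (@cons_rV n).
Proof.
apply: measurable_fun_rV => i; rewrite /cons_rV.
under eq_fun do rewrite mxE.
case: (unlift ord0 i) => [j|]; last exact: measurable_fst.
exact: (measurableT_comp (measurable_coor j) measurable_snd).
Qed.

Definition uncons_rV n (x : 'rV[R]_n.+1) : measurableTypeR R * 'rV[R]_n :=
  (x ord0 ord0, \row_(i < n) x ord0 (lift ord0 i)).

Lemma measurable_uncons_rV n : measurable_fun setT (@uncons_rV n).
Proof.
apply: measurable_fun_pair => /=; first exact: measurable_coor.
apply: measurable_fun_rV => i; under eq_fun do rewrite mxE.
exact: measurable_coor.
Qed.

Lemma cons_rVK n : cancel (@cons_rV n) (@uncons_rV n).
Proof.
move=> [r x]; rewrite /cons_rV /uncons_rV; congr pair.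
  by rewrite mxE unlift_none.
by apply/rowP => i; rewrite !mxE liftK.
Qed.

Variables (n : nat) (mu : {sigma_finite_measure set 'rV[R]_n -> \bar R}).

Definition lebesgue_cons : set 'rV[R]_n.+1 -> \bar R :=
  pushforward (lebesgue_measure \x mu)%E (@cons_rV n).

Let lebesgue_cons0 : lebesgue_cons set0 = 0%E.
Proof. by rewrite /lebesgue_cons /pushforward preimage_set0 measure0. Qed.

Let lebesgue_cons_ge0 A : (0 <= lebesgue_cons A)%E.
Proof. by rewrite /lebesgue_cons /pushforward; exact: measure_ge0. Qed.

Let lebesgue_cons_sigma_additive : semi_sigma_additive lebesgue_cons.
Proof.
move=> F mF tF mUF; rewrite /lebesgue_cons /pushforward preimage_bigcup.
apply: measure_semi_sigma_additive.
- by move=> i; rewrite -[X in measurable X]setTI; exact: measurable_cons_rV.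
- apply/trivIsetP => /= i j _ _ ij; rewrite -preimage_setI.
  by move/trivIsetP : tF => /(_ _ _ _ _ ij) ->//; rewrite preimage_set0.
- rewrite -preimage_bigcup -[X in measurable X]setTI.
  exact: measurable_cons_rV.
Qed.

HB.instance Definition _ := isMeasure.Build _ _ _ lebesgue_cons
  lebesgue_cons0 lebesgue_cons_ge0 lebesgue_cons_sigma_additive.

Let lebesgue_cons_sigma_finite : sigma_finite setT lebesgue_cons.
Proof.
have /sigma_finiteP[F [TF ndF Foo]] :=
  sigma_finiteT (@lebesgue_measure R : {sigma_finite_measure set _ -> \bar R}).
have /sigma_finiteP[G [TG ndG Goo]] := sigma_finiteT mu.
exists (fun i => @uncons_rV n @^-1` (F i `*` G i)).
  rewrite -preimage_bigcup -(preimage_setT (@uncons_rV n)); congr (_ @^-1` _).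
  rewrite -setXTT TF TG predeqE => -[x y]; split.
    move=> [/= [i _ Fix_] [k _ Gky]]; exists (maxn i k) => //; split.
    - by move: x Fix_; exact/subsetPset/ndF/leq_maxl.
    - by move: y Gky; exact/subsetPset/ndG/leq_maxr.
  by move=> [i _ []/= ? ?]; split; exists i.
move=> k; have [? ?] := Foo k; have [? ?] := Goo k; split.
  rewrite -[X in measurable X]setTI; apply: measurable_uncons_rV => //.
  exact: measurableX.
rewrite /lebesgue_cons /pushforward -comp_preimage.
rewrite (_ : _ \o _ = id) ?preimage_id; last first.
  by apply/funext => x; exact: cons_rVK.
by rewrite product_measure1E// lte_mul_pinfty// ge0_fin_numE.
Qed.

HB.instance Definition _ := Measure_isSigmaFinite.Build _ _ _ lebesgue_cons
  lebesgue_cons_sigma_finite.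

End rV_measurable_fun.

Fixpoint lebesgue_rV (R : realType) (n : nat) :
    {sigma_finite_measure set 'rV[R]_n -> \bar R} :=
  match n with
  | 0 => \d_(0 : 'rV[R]_0)
  | m.+1 => lebesgue_cons (lebesgue_rV R m)
  end.

Section geometry.
Context {R : realType}.

Definition cube n : set 'rV[R]_n := [set x | forall i, 0 < x ord0 i < 1].
Arguments cube n _ : clear implicits.

(* The coordinate $x_1$ has index 0. *)
Definition Gamma0 n : set 'rV[R]_n :=
  [set x | forall i : 'I_n,
    if i == 0 :> nat then x ord0 i = 1 else 0 < x ord0 i < 1].
Arguments Gamma0 n _ : clear implicits.

Definition Gamma1 n : set 'rV[R]_n :=
  (closure (cube n) `\` interior (cube n)) `\` Gamma0 n.
Arguments Gamma1 n _ : clear implicits.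

(* Relatively open sides of the cube orthogonal to the i-th axis: the boundary
   points at which the unit normal exists and is parallel to that axis. *)
Definition side n (i : 'I_n) : set 'rV[R]_n :=
  [set x | (x ord0 i = 0 \/ x ord0 i = 1) /\
           forall j, j != i -> 0 < x ord0 j < 1].

(* cos(n, x_i) for the outward unit normal n at a point of [side i]. *)
Definition cos_normal n (i : 'I_n) (x : 'rV[R]_n) : R :=
  if x ord0 i == 1 then 1 else -1.

Definition cylinder n (s t : R) : set ('rV[R]_n * R) := cube n `*` `]s, t[.
Arguments cylinder n s t _ : clear implicits.

Definition evec n (i : 'I_n) : 'rV[R]_n := delta_mx ord0 i.

Definition enorm n (v : 'rV[R]_n) : R := Num.sqrt (\sum_i v ord0 i ^+ 2).

(* x with its i-th coordinate replaced by s. *)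
Definition subst_coor n (x : 'rV[R]_n) (i : 'I_n) (s : R) : 'rV[R]_n :=
  \row_j (if j == i then s else x ord0 j).

End geometry.
Arguments cube {R} n _.
Arguments Gamma0 {R} n _.
Arguments Gamma1 {R} n _.
Arguments cylinder {R} n s t _.

Section derivatives.
Context {R : realType}.

(* Partial derivative on the open set D, extended to the closure of D by
   continuity; it is meaningful at boundary points only under [has_pd]. *)
Definition pd (V : normedModType R) (D : set V) (v : V) (f : V -> R) : V -> R :=
  fun x => lim ('D_v f y @[y --> within D (nbhs x)]).

Definition has_pd (V : normedModType R) (D : set V) (v : V) (f : V -> R) :=
  [/\ forall x, D x -> derivable f x v,
      forall x, D x -> pd D v f x = 'D_v f x
    & {within closure D, continuous (pd D v f)}].

Definition C1_cube n (f : 'rV[R]_n -> R) :=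
  {within closure (cube n), continuous f} /\
  forall i, has_pd (cube n) (evec i) f.

(* C^k norms are maxima of the suprema of all derivatives of order <= k. *)
Definition norm_C0 n (f : 'rV[R]_n -> R) : R :=
  sup [set `|f x| | x in closure (cube n)].

Definition norm_C1 n (f : 'rV[R]_n -> R) : R :=
  Num.max (norm_C0 f) (\big[Num.max/0]_i norm_C0 (pd (cube n) (evec i) f)).

Definition norm_C2 n (f : 'rV[R]_n -> R) : R :=
  Num.max (norm_C1 f)
    (\big[Num.max/0]_i \big[Num.max/0]_j
       norm_C0 (pd (cube n) (evec j) (pd (cube n) (evec i) f))).

Definition C1_whole N (F : 'rV[R]_N -> R) :=
  forall i, (forall z, derivable F z (evec i)) /\ continuous ('D_(evec i) F).

(* The variables of F1 and F2 are ordered so that the last l ones are the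
   explicit (x, t); only the first k ones are differentiated. *)
Definition hat_grad k l (F : 'rV[R]_(k + l) -> R) (z : 'rV[R]_(k + l)) :
  'rV[R]_k := \row_i 'D_(evec (lshift l i)) F z.

Section space_time.
Context (n : nat) (T : R).
Implicit Types u m : 'rV[R]_n * R -> R.

Definition dx (i : 'I_n) u := pd (cylinder n 0 T) (evec i, 0) u.

Definition dt u := pd (cylinder n 0 T) (0, 1) u.

Definition C21 u :=
  [/\ {within closure (cylinder n 0 T), continuous u},
      forall i, has_pd (cylinder n 0 T) (evec i, 0) u,
      forall i j, has_pd (cylinder n 0 T) (evec j, 0) (dx i u)
    & has_pd (cylinder n 0 T) (0, 1) u].

Definition in_B (M1 : R) u m :=
  [/\ C21 u, C21 m,
      forall t, 0 <= t <= T -> norm_C2 (fun x => u (x, t)) <= M1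
    & forall t, 0 <= t <= T -> norm_C1 (fun x => m (x, t)) <= M1].

Definition grad u (p : 'rV[R]_n * R) : 'rV[R]_n := \row_i dx i u p.

Definition Lop (a : 'I_n -> 'I_n -> 'rV[R]_n -> R) u (p : 'rV[R]_n * R) : R :=
  \sum_i \sum_j dx i (fun q => a i j q.1 * dx j u q) p.

(* du/dN on the side of the cube orthogonal to the i-th axis. *)
Definition conormal (a : 'I_n -> 'I_n -> 'rV[R]_n -> R) (i : 'I_n) u
    (p : 'rV[R]_n * R) : R :=
  \sum_j a i j p.1 * dx j u p * cos_normal i p.1.

End space_time.
End derivatives.

Section norms.
Context {R : realType}.

Definition L2_norm d (X : measurableType d) (mu : {measure set X -> \bar R})
    (D : set X) (f : X -> R) : \bar R :=
  ('N[mu]_2%:E[EFin \o (f \* \1_D)%R])%E.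

Definition L2_cyl n (s t : R) (f : 'rV[R]_n * R -> R) : \bar R :=
  @L2_norm _ ('rV[R]_n * measurableTypeR R)%type
    (lebesgue_rV R n \x lebesgue_measure)%E (cylinder n s t) f.

Definition H1_norm n (g : 'rV[R]_n -> R) : \bar R :=
  L2_norm (lebesgue_rV R n) (cube n) (fun x =>
    Num.sqrt (g x ^+ 2 + \sum_i pd (cube n) (evec i) g x ^+ 2)).

Definition Linfty_norm n (K : 'rV[R]_n -> R) : \bar R :=
  ('N[lebesgue_rV R n]_+oo[EFin \o (K \* \1_(cube n))%R])%E.

End norms.

Section system.
Context {R : realType} (n : nat) (T : R).
Implicit Types (a : 'I_n -> 'I_n -> 'rV[R]_n -> R) (K : 'I_n -> 'rV[R]_n -> R).
Implicit Types (u m : 'rV[R]_n * R -> R) (p : 'rV[R]_n * R).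

(* The i-th entry is the integral of K_i m over x_i, a function of the other
   coordinates and t.  As K_i is only in L_infty, it is relevant only for
   almost every point. *)
Definition nonlocal K m p : 'rV[R]_n :=
  \row_i (\int[lebesgue_measure]_(s in `]0, 1[)
    (K i (subst_coor p.1 i s) * m (subst_coor p.1 i s, p.2))).

(* F1 has 3n+2 arguments depending on the unknowns, followed by (x, t);
   F2 has 2n+3 of them. *)
Definition dim1 (k : nat) : nat := (1 + k + 1 + k + k)%N.
Definition dim2 (k : nat) : nat := (k + 1 + 1 + k + 1)%N.

Definition arg1 K u m p : 'rV[R]_(dim1 n + (n + 1)) :=
  row_mx
    (row_mx (row_mx (row_mx (row_mx (u p)%:M (grad T u p)) (m p)%:M)
                    (grad T m p))
            (nonlocal K m p))
    (row_mx p.1 p.2%:M).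

Definition arg2 a u m p : 'rV[R]_(dim2 n + (n + 1)) :=
  row_mx
    (row_mx (row_mx (row_mx (row_mx (grad T m p) (m p)%:M) (u p)%:M)
                    (grad T u p))
            (Lop T a u p)%:M)
    (row_mx p.1 p.2%:M).

Definition ae_cyl (P : 'rV[R]_n * R -> Prop) : Prop :=
  {ae (lebesgue_rV R n \x lebesgue_measure)%E, forall p, P p}.

Definition coefficients a (mu1 mu2 : R) :=
  [/\ forall i j, C1_cube (a i j),
      forall i j x, closure (cube n) x -> a i j x = a j i x
    & forall x (xi : 'rV[R]_n), closure (cube n) x ->
        mu1 * enorm xi ^+ 2
          <= \sum_i \sum_j a i j x * xi ord0 i * xi ord0 j
          <= mu2 * enorm xi ^+ 2].

Definition kernels K (M1 : R) :=
  forall i, measurable_fun (cube n) (K i : _ -> measurableTypeR R) /\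
            (Linfty_norm (K i) <= M1%:E)%E.

Definition nonlinearities a K (F1 : 'rV[R]_(dim1 n + (n + 1)) -> R)
    (F2 : 'rV[R]_(dim2 n + (n + 1)) -> R) (M1 M : R) :=
  [/\ C1_whole F1, C1_whole F2,
      forall u m, in_B T M1 u m -> ae_cyl (fun p =>
        closure (cylinder n 0 T) p ->
        enorm (hat_grad F1 (arg1 K u m p)) <= M)
    & forall u m, in_B T M1 u m -> forall p,
        closure (cylinder n 0 T) p ->
        enorm (hat_grad F2 (arg2 a u m p)) <= M].

Definition boundary_conditions a (f : 'rV[R]_n * R -> R) u :=
  (forall x t, Gamma0 n x -> 0 < t < T -> u (x, t) = f (x, t)) /\
  (forall i x t, Gamma1 n x -> side i x -> 0 < t < T ->
     conormal T a i u (x, t) = 0).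

Definition solution a K F1 F2 (fu fm : 'rV[R]_n * R -> R) u m :=
  [/\ ae_cyl (fun p => cylinder n 0 T p ->
        dt T u p + Lop T a u p + F1 (arg1 K u m p) = 0),
      forall p, cylinder n 0 T p ->
        dt T m p - Lop T a m p + F2 (arg2 a u m p) = 0,
      boundary_conditions a fu u
    & boundary_conditions a fm m].

End system.

(* Main.v *)
(* Test the difference of the two solutions against the Carleman weight
   w(t) = exp(2 tau e^{l t}), which depends on time only.  Energy identities for
   Eu = int a grad u . grad u, Em and the L2 norms yu, ym give, pointwise in t,
   w (|u_t|^2 + |Lu|^2 + Eu + yu + Em + ym) <= d/dt [w Phi] with
   Phi = k (Eu + yu) - Em + (p - s/2) ym, p = tau l e^{l t}: the term |Lu|^2 which F2
   brings into the equation for m is absorbed by k times the equation for u, because k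
   is chosen larger than its coefficient.  Integrating over (0, T), the terminal term is
   O(delta^2) times a power of w(T) and the initial one is bounded by M1; dividing by
   w(g) and taking tau proportional to log(1/delta) gives a Hoelder rate on (g, T)
   for every g > 0.  Letting delta tend to 0 and then varying g gives uniqueness. *)

Require Import Defs.
From HB Require Import structures.
From mathcomp Require Import all_boot all_order all_algebra.
From mathcomp Require Import ring lra.
From mathcomp Require Import all_classical all_reals all_analysis.
From mathcomp Require Import measurable_realfun ess_sup_inf hoelder.

Set Implicit Arguments.
Unset Strict Implicit.
Unset Printing Implicit Defensive.

Import Order.TTheory GRing.Theory Num.Theory.
Import numFieldNormedType.Exports.

Local Open Scope classical_set_scope.
Local Open Scope ring_scope.

(** * Fubini and averages over the cube *)

(** With data at the final time the equation for u runs in its well-posed direction and the one for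
    m does not; this is why the rate is Hoelder and why the weight must be balanced against
    log(1/delta). Two gaps in regularity shape the details. The kernels K_i are only in L_infty, so
    the equation for u and the bound on the gradient of F1 hold almost everywhere; the resulting
    inequality is used only after averaging over the cube, where both sides are continuous in t,
    which restores every t. And C^{2,1} contains no u_{xt}, so Green's formula is proved with its
    two factors at different times, and the energy is differentiated through the symmetry of L. The
    shift - (s/2) ym in Phi is the source of control on the gradient of m: its derivative is - s
    (m_t, m), and the square of m_t - Lm - (s/2) m converts this into s Em, while the large term -
    2p Em is absorbed by the square of Lm + pm. All constants are fixed before K, F1, F2, the
    boundary data and the solutions, which is how their dependence on M1 and M alone among these
    data is expressed. *)

Lemma ge0_integral_setX d1 d2 (T1 : measurableType d1) (T2 : measurableType d2)
    (R : realType) (m1 : {sigma_finite_measure set T1 -> \bar R})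
    (m2 : {sigma_finite_measure set T2 -> \bar R}) (A : set T1) (B : set T2)
    (f : T1 * T2 -> \bar R) :
  measurable A -> measurable B -> measurable_fun (A `*` B) f ->
  (forall z, (A `*` B) z -> 0 <= f z)%E ->
  (\int[m1 \x m2]_(z in A `*` B) f z =
   \int[m1]_(x in A) \int[m2]_(y in B) f (x, y))%E /\
  (\int[m1 \x m2]_(z in A `*` B) f z =
   \int[m2]_(y in B) \int[m1]_(x in A) f (x, y))%E.
Proof.
move=> mA mB mf f0.
have mAB : measurable (A `*` B) by exact: measurableX.
(* Extending [f] by zero off the rectangle turns both claims into Tonelli on the whole product. *)
have mg : measurable_fun setT (f \_ (A `*` B)) by apply/(measurable_restrictT _ mAB).
have g0 z : (0 <= (f \_ (A `*` B)) z)%E.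
  by rewrite patchE; case: ifPn => // /set_mem /f0.
split.
- rewrite [LHS]integral_mkcond [LHS](fubini_tonelli1 _ mg g0) [RHS]integral_mkcond.
  apply: eq_integral => x _; rewrite patchE /fubini_F; case: ifPn => xA.
    rewrite [RHS]integral_mkcond; apply: eq_integral => y _.
    by rewrite !patchE in_setX xA.
  by apply: integral0_eq => y _; rewrite patchE in_setX (negbTE xA).
- rewrite [LHS]integral_mkcond [LHS](fubini_tonelli2 _ mg g0) [RHS]integral_mkcond.
  apply: eq_integral => y _; rewrite patchE /fubini_G; case: ifPn => yB.
    rewrite [RHS]integral_mkcond; apply: eq_integral => x _.
    by rewrite !patchE in_setX yB andbT.
  by apply: integral0_eq => x _; rewrite patchE in_setX (negbTE yB) andbF.
Qed.

Section cube_measure.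
Context {R : realType}.

Lemma measurable_cube n : measurable (cube n : set 'rV[R]_n).
Proof.
have -> : cube n = \bigcap_(i in [set: 'I_n])
   ((fun x : 'rV[R]_n => x ord0 i : measurableTypeR R) @^-1` `]0, 1[).
  apply/seteqP; split => x /= H i; first by move=> _ /=; rewrite in_itv /= H.
  by have := H i I; rewrite /= in_itv.
apply: fin_bigcap_measurable => // i _.
rewrite -[X in measurable X]setTI; apply: measurable_coor => //.
Qed.

Lemma cube_cons n : @cons_rV R n @^-1` cube n.+1 = `]0, 1[ `*` cube n.
Proof.
apply/seteqP; split => -[s x] /=.
  move=> H; split; first by have := H ord0; rewrite mxE unlift_none in_itv.
  by move=> i; have := H (lift ord0 i); rewrite mxE liftK.
move=> [+ H] i; rewrite in_itv /= => s01; rewrite mxE.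
by case: (unliftP ord0 i) => [j|] _.
Qed.

(** The measure in dimension n+1 is by definition the image of a product under [cons_rV], so Tonelli
    applies after pulling back. Both orders are kept because [ge0_integral_subst_coor] needs one or
    the other according to the coordinate. *)
Lemma ge0_integral_cube_cons n (f : 'rV[R]_n.+1 -> \bar R) :
  measurable_fun setT f -> (forall x, 0 <= f x)%E ->
  (\int[lebesgue_rV R n.+1]_(x in cube n.+1) f x =
   \int[lebesgue_measure]_(s in `]0%R, 1%R[) \int[lebesgue_rV R n]_(x in cube n)
      f (cons_rV (s, x)))%E /\
  (\int[lebesgue_rV R n.+1]_(x in cube n.+1) f x =
   \int[lebesgue_rV R n]_(x in cube n) \int[lebesgue_measure]_(s in `]0%R, 1%R[)
      f (cons_rV (s, x)))%E.
Proof.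
move=> mf f0.
have mc := @measurable_cons_rV R n.
have E : (\int[lebesgue_rV R n.+1]_(x in cube n.+1) f x =
  \int[lebesgue_measure \x lebesgue_rV R n]_(z in `]0%R, 1%R[ `*` cube n)
    (f \o @cons_rV R n) z)%E.
  rewrite -cube_cons.
  transitivity (\int[pushforward (lebesgue_measure \x lebesgue_rV R n)%E
      (@cons_rV R n)]_(x in cube n.+1) f x)%E; first by [].
  rewrite ge0_integral_pushforward//.
  - exact: measurable_cube.
  - exact: measurable_funTS.
rewrite E; apply: ge0_integral_setX => //.
- exact: measurable_cube.
- exact/measurable_funTS/measurableT_comp.
- by move=> z _; exact: f0.
Qed.

Lemma measurable_subst_coor n (i : 'I_n) :
  measurable_fun setT (fun z : 'rV[R]_n * measurableTypeR R =>
    subst_coor z.1 i z.2).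
Proof.
apply: measurable_fun_rV => j.
apply: (eq_measurable_fun (fun z : 'rV[R]_n * measurableTypeR R =>
  if j == i then z.2 else z.1 ord0 j)) => [z _|]; first by rewrite mxE.
case: (j == i); first exact: measurable_snd.
exact: (measurableT_comp (measurable_coor j) measurable_fst).
Qed.

Lemma subst_coor_cons0 n (s t : R) (x : 'rV[R]_n) :
  subst_coor (cons_rV (s, x)) ord0 t = cons_rV (t, x).
Proof.
apply/rowP => j; rewrite /subst_coor /cons_rV !mxE; case: (unliftP ord0 j) => [k ->|->].
  by rewrite eq_sym (negbTE (neq_lift _ _)).
by rewrite eqxx.
Qed.

Lemma subst_coor_cons n (s t : R) (x : 'rV[R]_n) i :
  subst_coor (cons_rV (s, x)) (lift ord0 i) t = cons_rV (s, subst_coor x i t).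
Proof.
apply/rowP => j; rewrite /subst_coor /cons_rV !mxE; case: (unliftP ord0 j) => [k ->|->].
  by rewrite (inj_eq lift_inj) mxE.
by rewrite (negbTE (neq_lift _ _)).
Qed.

Lemma measurable_integral_subst_coor n (i : 'I_n) (f : 'rV[R]_n -> \bar R) :
  measurable_fun setT f -> (forall x, 0 <= f x)%E ->
  measurable_fun setT (fun x => \int[lebesgue_measure]_(s in `]0%R, 1%R[)
    f (subst_coor x i s))%E.
Proof.
move=> mf f0.
under eq_fun do rewrite integral_mkcond.
set h := fun z : 'rV[R]_n * measurableTypeR R =>
  ((fun s => f (subst_coor z.1 i s)) \_ `]0, 1[ z.2).
apply: (@measurable_fun_fubini_tonelli_F _ _ _ _ _ lebesgue_measure h).
  rewrite /h; under eq_fun do rewrite patchE.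
  apply: measurable_fun_ifT => //=.
  - apply: (measurable_fun_bool true) => /=.
    rewrite setTI (_ : _ @^-1` _ = setT `*` `]0, 1[).
      exact: measurableX.
    apply/seteqP; split => -[x s] /= => [/set_mem xs|[_ xs]]; first by split.
    exact: mem_set.
  - exact: (measurableT_comp mf (@measurable_subst_coor n i)).
by move=> z; rewrite /h patchE; case: ifP.
Qed.

(** Induction on [n]. For the first coordinate, integrate it innermost: the line integral does not
    depend on it, and the interval has length 1. Any other coordinate belongs to the tail, where the
    induction hypothesis applies slice by slice. This serves as Fubini in an arbitrary coordinate
    direction. *)
Lemma ge0_integral_subst_coor n (i : 'I_n) (f : 'rV[R]_n -> \bar R) :
  measurable_fun setT f -> (forall x, 0 <= f x)%E ->
  (\int[lebesgue_rV R n]_(x in cube n)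
     \int[lebesgue_measure]_(s in `]0%R, 1%R[) f (subst_coor x i s) =
   \int[lebesgue_rV R n]_(x in cube n) f x)%E.
Proof.
elim: n => [|n IH] in i f *; first by case: i.
move=> mf f0.
have mg := measurable_integral_subst_coor i mf f0.
have g0 x : (0 <= \int[lebesgue_measure]_(s in `]0%R, 1%R[)
    f (subst_coor x i s))%E by exact: integral_ge0.
have vol1 : lebesgue_measure (`]0, 1[ : set (measurableTypeR R)) = 1%E.
  by rewrite lebesgue_measure_itv /= lte01 oppr0 adde0.
have [E1 E2] := ge0_integral_cube_cons mf f0.
have [G1 G2] := ge0_integral_cube_cons mg g0.
case: (unliftP ord0 i) => [j ij|i0].
- rewrite G1 E1; apply: eq_integral => s _.
  have mfs : measurable_fun setT (fun x : 'rV[R]_n => f (cons_rV (s, x))).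
    apply: (measurableT_comp mf).
    apply: (measurableT_comp (@measurable_cons_rV R n)).
    exact: (measurable_fun_pair (measurable_cst _) (@measurable_id _ _ _)).
  apply: (etrans _ (IH j _ mfs (fun x => f0 _))).
  apply: eq_integral => x _; apply: eq_integral => t _.
  by rewrite ij subst_coor_cons.
- rewrite G2 E2; apply: eq_integral => x _.
  transitivity (\int[lebesgue_measure]_(s in `]0%R, 1%R[) cst
     (\int[lebesgue_measure]_(t in `]0%R, 1%R[) f (cons_rV (t, x))) s)%E.
    apply: eq_integral => s _ /=; apply: eq_integral => t _.
    by rewrite i0 subst_coor_cons0.
  by rewrite integral_cst//= [X in (_ * X)%E]vol1 mule1.
Qed.

Lemma lebesgue_rV_cube n : lebesgue_rV R n (cube n) = 1%E.
Proof.
elim: n => [|n IH].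
  rewrite /= diracE (_ : 0 \in cube 0 = true) //.
  by apply: mem_set => -[].
transitivity ((\int[lebesgue_rV R n.+1]_(x in cube n.+1) (cst 1%E x))%E).
  by rewrite integral_cst ?mul1e//; exact: measurable_cube.
have [-> _] := @ge0_integral_cube_cons n (cst 1%E) (measurable_cst _)
  (fun _ => lee01).
transitivity (\int[lebesgue_measure]_(s in `]0%R, 1%R[ : set (measurableTypeR R))
    cst 1%E s)%E.
  apply: eq_integral => s _ /=.
  apply: (etrans (integral_cst _ (@measurable_cube n) 1%E)).
  by rewrite mul1e; exact: IH.
rewrite integral_cst//= mul1e.
by rewrite lebesgue_measure_itv /= lte_fin ltr01 oppr0 adde0.
Qed.

End cube_measure.

(** * Measurability of continuous functions *)

Section continuous_functions.
Context {R : realType}.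

(** The sigma-algebra is generated by the coordinates, not by the open sets, so countability has to
    enter: [U] is the union of the boxes inside it with rational centre [q.1] and rational radius
    [q.2]. *)
Lemma open_measurable_rV n (U : set ('rV[R]_n * R)) :
  open U -> measurable (U : set ('rV[R]_n * measurableTypeR R)).
Proof.
move=> oU.
pose box (q : 'rV[rat]_n * rat * rat) : set ('rV[R]_n * measurableTypeR R) :=
  (\bigcap_(i in [set: 'I_n]) [set x : 'rV[R]_n |
     x ord0 i \in `](ratr (q.1.1 ord0 i) - ratr q.2), (ratr (q.1.1 ord0 i) + ratr q.2)[ ])
  `*` `](ratr q.1.2 - ratr q.2), (ratr q.1.2 + ratr q.2)[.
have mbox q : measurable (box q).
  apply: (@measurableX _ _ 'rV[R]_n (measurableTypeR R)); last exact: measurable_itv.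
  apply: fin_bigcap_measurable => // i _.
  rewrite (_ : [set _ | _] = (fun x : 'rV[R]_n => x ord0 i : measurableTypeR R)
    @^-1` `](ratr (q.1.1 ord0 i) - ratr q.2), (ratr (q.1.1 ord0 i) + ratr q.2)[)//.
  rewrite -[X in measurable X]setTI; apply: measurable_coor => //.
pose F q := if `[< box q `<=` U >] then box q else set0.
have -> : U = \bigcup_q F q.
  apply/seteqP; split => [[x t] Uxt|p [q _]]; last first.
    by rewrite /F; case: ifPn => // /asboolP + qp; apply.
  have /nbhs_ballP[e /= e0 eU] : nbhs (x, t) U by exact: open_nbhs_nbhs.
  (* Two points of one box differ by less than [2 r] in each coordinate, hence the bound
     [r < e / 2]. *)
  have /rat_in_itvoo[r] : (0 : R) < e / 2 by rewrite divr_gt0.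
  rewrite in_itv /= => /andP[r0 re].
  have key (y : R) : exists q : rat, y \in `](ratr q - ratr r), (ratr q + ratr r)[.
    have /rat_in_itvoo[q] : y - ratr r < y + ratr r by lra.
    rewrite in_itv /= => /andP[h1 h2]; exists q; rewrite in_itv /=.
    by apply/andP; split; lra.
  pose q := \row_i projT1 (cid (key (x ord0 i))).
  exists (q, projT1 (cid (key t)), r) => //.
  rewrite /F; case: ifPn => [_|/asboolP[]].
    split => /=; last exact: (projT2 (cid (key t))).
    by move=> i _ /=; rewrite mxE; exact: (projT2 (cid (key (x ord0 i)))).
  move=> [y s] [/= yq sq]; apply: eU.
  have cl (a b : R) c : a \in `](c - ratr r), (c + ratr r)[ ->
      b \in `](c - ratr r), (c + ratr r)[ -> `|a - b| < e.
    rewrite !in_itv /= => /andP[? ?] /andP[? ?]; rewrite ltr_norml.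
    by apply/andP; split; lra.
  split => /=.
    split=> // i j; rewrite ord1; apply: (@cl _ _ (ratr (q ord0 j))).
      by rewrite /q mxE; exact: (projT2 (cid (key (x ord0 j)))).
    exact: yq.
  by apply: (@cl _ _ (ratr (projT1 (cid (key t))))) => //;
    exact: (projT2 (cid (key t))).
apply: countable_bigcupT_measurable => // q.
by rewrite /F; case: ifP.
Qed.

Lemma continuous_measurable_rV n (f : 'rV[R]_n * R -> R) : continuous f ->
  measurable_fun [set: 'rV[R]_n * measurableTypeR R] f.
Proof.
move=> cf; apply: (measurability (@RGenOpens.G R)).
  exact: RGenOpens.measurableE.
move=> _ [_ [a [b ->]] <-]; rewrite setTI; apply: open_measurable_rV.
by apply: open_comp => // p _; exact: cf.
Qed.

End continuous_functions.

Section cube_average.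
Context {R : realType}.

(** The cube has measure 1 ([lebesgue_rV_cube]), so this is a mean, and constants are their own
    average. *)
Definition avg n (f : 'rV[R]_n -> R) : R :=
  \int[lebesgue_rV R n]_(x in cube n) f x.

(** The class in which averages are computed: it is closed under ring operations and contained in
    the integrable functions, so integrability is settled once for all. *)
Definition bmf n (f : 'rV[R]_n -> R) :=
  measurable_fun (cube n) f /\ exists M, forall x, cube n x -> `|f x| <= M.

Section bmf_avg.
Variable n : nat.
Implicit Types f g : 'rV[R]_n -> R.

Lemma bmf_integrable f : bmf f ->
  (lebesgue_rV R n).-integrable (cube n) (EFin \o f).
Proof.
move=> [mf [M fM]]; apply: measurable_bounded_integrable => //.
- exact: measurable_cube.
- exact: (eq_ind_r (fun z => z < +oo)%E (ltry 1) (lebesgue_rV_cube n)).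
- exists M; split; first exact: num_real.
  by move=> x Mx y /= cy; rewrite (le_trans (fM _ cy))// ltW.
Qed.

Lemma bmf_cst c : bmf (fun _ : 'rV[R]_n => c).
Proof. by split; [exact: measurable_cst|exists `|c|]. Qed.

Lemma bmfD f g : bmf f -> bmf g -> bmf (fun x => f x + g x).
Proof.
move=> [mf [M fM]] [mg [N gN]]; split; first exact: measurable_funD.
exists (M + N) => x cx.
by rewrite (le_trans (ler_normD _ _))// lerD ?fM ?gN.
Qed.

Lemma bmfM f g : bmf f -> bmf g -> bmf (fun x => f x * g x).
Proof.
move=> [mf [M fM]] [mg [N gN]]; split; first exact: measurable_funM.
by exists (M * N) => x cx; rewrite normrM ler_pM ?fM ?gN.
Qed.

Lemma bmfZ c f : bmf f -> bmf (fun x => c * f x).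
Proof. exact/bmfM/bmf_cst. Qed.

Lemma bmfN f : bmf f -> bmf (fun x => - f x).
Proof.
by move=> /(bmfZ (-1)); under eq_fun do rewrite mulN1r.
Qed.

Lemma bmfB f g : bmf f -> bmf g -> bmf (fun x => f x - g x).
Proof. by move=> bf /bmfN; exact: bmfD. Qed.

Lemma bmfX2 f : bmf f -> bmf (fun x => f x ^+ 2).
Proof. by move=> bf; under eq_fun do rewrite expr2; exact: bmfM. Qed.

Lemma bmf_sum (I : Type) (r : seq I) (F : I -> 'rV[R]_n -> R) :
  (forall i, bmf (F i)) -> bmf (fun x => \sum_(i <- r) F i x).
Proof.
move=> bF; elim: r => [|i r IH].
  by under eq_fun do rewrite big_nil; exact: bmf_cst.
by under eq_fun do rewrite big_cons; exact: bmfD.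
Qed.

Lemma eq_avg f g : (forall x, cube n x -> f x = g x) -> avg f = avg g.
Proof. by move=> fg; apply: eq_Rintegral => x /set_mem /fg. Qed.

Lemma avg_cst c : avg (fun _ : 'rV[R]_n => c) = c.
Proof.
rewrite /avg (Rintegral_cst _ (@measurable_cube _ n)).
transitivity (c * 1); last exact: mulr1.
congr (_ * _).
exact: (congr1 fine (lebesgue_rV_cube n)).
Qed.

Lemma avgD f g : bmf f -> bmf g -> avg (fun x => f x + g x) = avg f + avg g.
Proof.
by move=> bf bg; apply: RintegralD;
  [exact: measurable_cube|exact: bmf_integrable|exact: bmf_integrable].
Qed.

Lemma avgZ c f : bmf f -> avg (fun x => c * f x) = c * avg f.
Proof.
by move=> bf; apply: RintegralZl; [exact: measurable_cube|exact: bmf_integrable].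
Qed.

Lemma avgN f : bmf f -> avg (fun x => - f x) = - avg f.
Proof. by move=> bf; rewrite -mulN1r -avgZ//; apply: eq_avg => x _; rewrite mulN1r. Qed.

Lemma avgB f g : bmf f -> bmf g -> avg (fun x => f x - g x) = avg f - avg g.
Proof. by move=> bf bg; rewrite avgD ?avgN//; exact: bmfN. Qed.

Lemma avg_sum (I : Type) (r : seq I) (F : I -> 'rV[R]_n -> R) :
  (forall i, bmf (F i)) ->
  avg (fun x => \sum_(i <- r) F i x) = \sum_(i <- r) avg (F i).
Proof.
move=> bF; elim: r => [|i r IH].
  by rewrite big_nil -[RHS](avg_cst 0); apply: eq_avg => x _; rewrite big_nil.
rewrite big_cons -IH -avgD//; last exact: bmf_sum.
by apply: eq_avg => x _; rewrite big_cons.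
Qed.

Lemma avg_ge0 f : (forall x, cube n x -> 0 <= f x) -> 0 <= avg f.
Proof. exact: Rintegral_ge0. Qed.

Lemma le_avg f g : bmf f -> bmf g -> (forall x, cube n x -> f x <= g x) ->
  avg f <= avg g.
Proof.
by move=> bf bg; apply: le_Rintegral;
  [exact: measurable_cube|exact: bmf_integrable|exact: bmf_integrable].
Qed.

(** Used for the equation of u, which holds only almost everywhere; removing the null set from the
    domain changes neither integral. *)
Lemma ae_le_avg f g : bmf f -> bmf g ->
  {ae lebesgue_rV R n, forall x, cube n x -> f x <= g x} -> avg f <= avg g.
Proof.
move=> bf bg [N [mN N0 NP]].
have mD : measurable (cube n `\` N) by apply: measurableD => //; exact: measurable_cube.
have E h : bmf h -> avg h = \int[lebesgue_rV R n]_(x in cube n `\` N) h x.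
  move=> bh; rewrite /avg /Rintegral (negligible_integral mN)//.
  - exact: measurable_cube.
  - exact: bmf_integrable.
have S : cube n `\` N `<=` cube n by exact: subDsetl.
rewrite !E//; apply: le_Rintegral => //.
- by apply: integrableS (bmf_integrable bf) => //; exact: measurable_cube.
- by apply: integrableS (bmf_integrable bg) => //; exact: measurable_cube.
- move=> x [cx Nx]; have : ~ ~ (cube n x -> f x <= g x) by move=> H; exact/Nx/NP.
  by move/contrapT; apply.
Qed.

Lemma EFin_avg f : bmf f ->
  (\int[lebesgue_rV R n]_(x in cube n) (f x)%:E = (avg f)%:E)%E.
Proof.
move=> bf; rewrite /avg /Rintegral fineK//.
exact: (integrable_fin_num (@measurable_cube _ n) (bmf_integrable bf)).
Qed.

End bmf_avg.
End cube_average.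

Lemma cvg_nbhs_pair (T : Type) (U V : topologicalType) (F : set_system T)
    {FF : Filter F} (f : T -> U) (g : T -> V) (a : U) (b : V) :
  f @ F --> a -> g @ F --> b -> (f x, g x) @[x --> F] --> (a, b).
Proof. exact: (@cvg_pair _ _ _ F (nbhs a) (nbhs b)). Qed.

(** * Averages as functions of time *)

Section space_time_functions.
Context {R : realType}.

(** Global continuity and boundedness, as clamped extensions enjoy them: every time slice is then in
    [bmf], and dominated convergence applies with a constant bound. *)
Definition cb n (f : 'rV[R]_n * R -> R) :=
  continuous f /\ exists M, forall p, `|f p| <= M.

Lemma derive_bound_lipschitz (f df : R -> R) (a b M s t : R) :
  (forall r, a < r < b -> is_derive r 1 f (df r)) ->
  (forall r, a < r < b -> `|df r| <= M) ->
  a < s < b -> a < t < b -> `|f t - f s| <= M * `|t - s|.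
Proof.
move=> dd dM; wlog st : s t / s <= t => [H sab tab|].
  have [/H|/ltW ts] := leP s t; first exact.
  by rewrite distrC [`|t - s|]distrC; exact: H.
move=> /andP[as_ sb] /andP[at_ tb].
have inab r : r \in `[s, t] -> a < r < b.
  rewrite in_itv /= => /andP[sr rt].
  by rewrite (lt_le_trans as_ sr) (le_lt_trans rt tb).
have [r||c cst ->] := @MVT_segment _ f df s t st.
- by move=> /subset_itv_oo_cc rst; exact/dd/inab.
- apply: derivable_within_continuous => r /inab rab.
  by have [] := dd _ rab.
- by rewrite normrM ler_wpM2r// dM// inab.
Qed.

Section cb_avg.
Variable n : nat.
Implicit Types f g : 'rV[R]_n * R -> R.

Lemma cb_cst c : cb (fun _ : 'rV[R]_n * R => c).
Proof. by split; [exact: cst_continuous|exists `|c|]. Qed.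

Lemma cbD f g : cb f -> cb g -> cb (fun p => f p + g p).
Proof.
move=> [cf [M fM]] [cg [N gN]]; split.
  by move=> p; apply: cvgD; [exact: cf|exact: cg].
exists (M + N) => p.
by rewrite (le_trans (ler_normD _ _))// lerD ?fM ?gN.
Qed.

Lemma cbM f g : cb f -> cb g -> cb (fun p => f p * g p).
Proof.
move=> [cf [M fM]] [cg [N gN]]; split.
  by move=> p; apply: cvgM; [exact: cf|exact: cg].
by exists (M * N) => p; rewrite normrM ler_pM ?fM ?gN.
Qed.

Lemma cbN f : cb f -> cb (fun p => - f p).
Proof.
by move=> /(cbM (cb_cst (-1))); under eq_fun do rewrite mulN1r.
Qed.

Lemma cbB f g : cb f -> cb g -> cb (fun p => f p - g p).
Proof. by move=> bf /cbN; exact: cbD. Qed.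

Lemma cbX2 f : cb f -> cb (fun p => f p ^+ 2).
Proof. by move=> bf; under eq_fun do rewrite expr2; exact: cbM. Qed.

Lemma cb_sum (I : Type) (r : seq I) (F : I -> 'rV[R]_n * R -> R) :
  (forall i, cb (F i)) -> cb (fun p => \sum_(i <- r) F i p).
Proof.
move=> bF; elim: r => [|i r IH].
  by under eq_fun do rewrite big_nil; exact: cb_cst.
by under eq_fun do rewrite big_cons; exact: cbD.
Qed.

Lemma cb_bmf f t : cb f -> bmf (fun x => f (x, t)).
Proof.
move=> [cf [M fM]]; split; last by exists M.
apply: measurable_funTS.
exact: (measurableT_comp (continuous_measurable_rV cf)
  (measurable_fun_pair (@measurable_id _ _ _) (measurable_cst (t : measurableTypeR R)))).
Qed.

Lemma cvg_pair_l (x : 'rV[R]_n) (t : R) : (x, s) @[s --> t] --> (x, t).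
Proof. by apply: cvg_nbhs_pair; [exact: cvg_cst|exact: cvg_id]. Qed.

Lemma avg_continuous f : cb f -> continuous (fun t => avg (fun x => f (x, t))).
Proof.
move=> bf t; have [cf [M fM]] := bf.
apply: (@continuity_under_integral _ _ _ _ (fun t x => f (x, t)) _
  (@measurable_cube _ n) (t - 1) (t + 1) _ _ (fun _ => M)).
- by move=> s _; exact/bmf_integrable/cb_bmf.
- by apply: aeW => x _ s _; apply: continuous_comp; [exact: cvg_pair_l|exact: cf].
- exact/bmf_integrable/bmf_cst.
- by move=> s _; apply: aeW.
- by rewrite inE /= in_itv /=; apply/andP; split; lra.
Qed.

(** The weight [P] is taken at the moving time [s + h] on purpose: a difference of squares, or of
    energies, factors into a sum over the two times and the increment of [u], and that sum plays the
    role of [P]. *)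
Lemma avg_difference_quotient (P u v : 'rV[R]_n * R -> R) (T s : R) :
  cb P -> cb u -> cb v -> 0 < s < T ->
  (forall x t, cube n x -> 0 < t < T ->
     is_derive t 1 (fun t' => u (x, t')) (v (x, t))) ->
  h^-1 * avg (fun x => P (x, s + h) * (u (x, s + h) - u (x, s))) @[h --> 0^']
    --> avg (fun x => P (x, s) * v (x, s)).
Proof.
move=> bP bu bv /andP[s0 sT] du.
have [cP [MP hP]] := bP; have [cu _] := bu; have [cv [Mv hv]] := bv.
(* Filling in the derivative at [h = 0] reduces the claim to continuity at 0 of an integral with a
   parameter; by the mean value theorem [MP * Mv] dominates the integrand. *)
pose D h x := P (x, s + h) * (if h == 0 then v (x, s) else
  h^-1 * (u (x, s + h) - u (x, s))).
pose r := Num.min s (T - s).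
have r0 : 0 < r by rewrite lt_min s0 subr_gt0.
have rI h : h \in `]- r, r[ -> 0 < s + h < T.
  rewrite in_itv /= => /andP[h1 h2].
  have := ge_min s s (T - s); have := ge_min (T - s) s (T - s).
  rewrite -/r !lexx orbT /= => h3 h4.
  by apply/andP; split; lra.
have bD h : bmf (D h).
  apply: (@bmfM _ n (fun x => P (x, s + h))
    (fun x => if h == 0 then v (x, s) else h^-1 * (u (x, s + h) - u (x, s)))); first exact: cb_bmf.
  case: (h == 0); first exact: cb_bmf.
  by apply: bmfZ; apply: bmfB; exact: cb_bmf.
have cD : continuous_at 0 (fun h => \int[lebesgue_rV R n]_(x in cube n) D h x).
  apply: (@continuity_under_integral _ _ _ _ D _
    (@measurable_cube _ n) (- r) r _ _ (fun _ => MP * Mv)).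
  - by move=> h _; exact/bmf_integrable.
  - apply: aeW => x cx h /set_mem /= hI.
    have cPx : P (x, s + h') @[h' --> h] --> P (x, s + h).
      apply: (@continuous_comp _ _ _ (fun h' => (x, s + h')) P); last exact: cP.
      by apply: cvg_nbhs_pair; [exact: cvg_cst|apply: cvgD; [exact: cvg_cst|exact: cvg_id]].
    have cux : u (x, s + h') @[h' --> h] --> u (x, s + h).
      apply: (@continuous_comp _ _ _ (fun h' => (x, s + h')) u); last exact: cu.
      by apply: cvg_nbhs_pair; [exact: cvg_cst|apply: cvgD; [exact: cvg_cst|exact: cvg_id]].
    apply: (cvgM cPx).
    have [->|h0] := eqVneq h 0.
      suff : {for 0, continuous (fun k : R => if k == 0 then v (x, s) else
        k^-1 * (u (x, s + k) - u (x, s)))} by rewrite /prop_for /continuous_at eqxx.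
      apply/continuous_withinNx; rewrite eqxx.
      have [d1 d2] := du x s cx (introT andP (conj s0 sT)).
      have dq : h^-1 * (u (x, s + h) - u (x, s)) @[h --> 0^'] --> v (x, s).
        rewrite -d2; move: d1; rewrite /derivable /derive /=.
        by under eq_fun do rewrite scaler1 [in u (x, _)]addrC.
      apply: cvg_trans dq; apply: near_eq_cvg.
      by near=> k; rewrite (negbTE (_ : k != 0))//; near: k; exact: nbhs_dnbhs_neq.
    have kn0 : \forall k \near h, k != 0.
      exists `|h|; first by rewrite /= normr_gt0.
      by move=> k /=; apply: contraTneq => ->; rewrite subr0 ltxx.
    have dq : k^-1 * (u (x, s + k) - u (x, s)) @[k --> h] -->
        h^-1 * (u (x, s + h) - u (x, s)).
      by apply: cvgM; [exact: cvgV|apply: cvgB => //; exact: cvg_cst].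
    apply: cvg_trans dq; apply: near_eq_cvg.
    by near=> k; rewrite (negbTE (_ : k != 0))//; near: k.
  - exact/bmf_integrable/bmf_cst.
  - move=> h hI; apply: aeW => x cx.
    rewrite /D normrM ler_pM//; case: ifPn => // h0.
    rewrite normrM normfV ler_pdivrMl ?normr_gt0// mulrC.
    rewrite -[h in _ * `|h|](addKr s h) [- s + _]addrC.
    apply: (@derive_bound_lipschitz (fun t => u (x, t)) (fun t => v (x, t)) 0 T).
    - by move=> t tT; exact: du.
    - by move=> t _; exact: hv.
    - by rewrite s0.
    - exact: rI.
  - by rewrite inE /= in_itv /= oppr_lt0 r0.
move/continuous_withinNx : cD.
rewrite (_ : Rintegral _ _ (D 0) = avg (fun x => P (x, s) * v (x, s))); last first.
  by apply: eq_avg => x _; rewrite /D eqxx addr0.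
apply: cvg_trans; apply: near_eq_cvg; near=> h.
have h0 : h != 0 by near: h; exact: nbhs_dnbhs_neq.
rewrite -avgZ; last by apply: bmfM; [|apply: bmfB]; exact: cb_bmf.
by apply: eq_avg => x _; rewrite /D (negbTE h0) mulrCA.
Unshelve. all: by end_near.
Qed.

End cb_avg.
End space_time_functions.

(** * Integrals along coordinate lines *)

Section line_integrals.
Context {R : realType}.

Lemma continuous_subst_coor n (x : 'rV[R]_n) i : continuous (subst_coor x i).
Proof.
move=> s; apply/cvg_ballP => e e0; near=> t; split => // k j.
rewrite !mxE; case: ifP => _; last exact: ballxx.
by near: t; apply/nbhs_ballP; exists e.
Unshelve. all: by end_near. Qed.

Lemma lebesgue_measure01 :
  lebesgue_measure (`]0, 1[ : set (measurableTypeR R)) = 1%E.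
Proof. by rewrite lebesgue_measure_itv /= lte_fin ltr01 oppr0 adde0. Qed.

Lemma integrable01 (f : R -> R) : measurable_fun (`]0, 1[ : set (measurableTypeR R)) f ->
  (exists M, forall s, s \in `]0, 1[ -> `|f s| <= M) ->
  lebesgue_measure.-integrable `]0, 1[ (EFin \o f).
Proof.
move=> mf [M fM]; apply: measurable_bounded_integrable => //.
- exact: (eq_ind_r (fun z => z < +oo)%E (ltry 1) lebesgue_measure01).
- exists M; split; first exact: num_real.
  by move=> y My s /= cs; rewrite (le_trans (fM _ cs))// ltW.
Qed.

Lemma integral01_cst (c : R) : \int[lebesgue_measure]_(s in `]0, 1[) c = c.
Proof.
rewrite Rintegral_cst//; transitivity (c * 1); last exact: mulr1.
congr (_ * _); exact: (congr1 fine lebesgue_measure01).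
Qed.

Lemma integral01_FTC (g dg : R -> R) : continuous g -> continuous dg ->
  (forall s : R, 0 < s < 1 -> is_derive s 1 g (dg s)) ->
  \int[lebesgue_measure]_(s in `]0, 1[) dg s = g 1 - g 0.
Proof.
move=> cg cdg hdg.
have mdg (A : set (measurableTypeR R)) : measurable A -> measurable_fun (A : set (measurableTypeR R)) (EFin \o dg).
  move=> mA; apply/measurable_EFinP/measurable_funTS.
  exact: continuous_measurable_fun.
rewrite /Rintegral integral_itv_obnd_cbnd; last exact: mdg.
rewrite integral_itv_bndo_bndc; last exact: mdg.
rewrite (@continuous_FTC2 _ dg g)//.
- exact: continuous_subspaceT.
- split => [s s01||].
  + by have [] := hdg s; rewrite in_itv in s01.
  + exact/cvg_at_right_filter/cg.
  + exact/cvg_at_left_filter/cg.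
- move=> s s01; rewrite derive1E.
  by have [] := hdg s; rewrite in_itv in s01.
Qed.

Lemma measurable_subst_coor_r n (h : 'rV[R]_n -> R) x i : measurable_fun setT h ->
  measurable_fun setT ((fun s => h (subst_coor x i s)) : measurableTypeR R -> _).
Proof.
move=> mh; apply: (measurableT_comp mh).
exact: (measurableT_comp (measurable_subst_coor i)
  (measurable_fun_pair (measurable_cst x) (@measurable_id _ _ _))).
Qed.

Lemma avg_integral_subst_coor n (i : 'I_n) (h : 'rV[R]_n -> R) :
  measurable_fun setT h -> (exists M, forall x, `|h x| <= M) ->
  bmf (fun x => \int[lebesgue_measure]_(s in `]0, 1[) h (subst_coor x i s)) /\
  avg (fun x => \int[lebesgue_measure]_(s in `]0, 1[) h (subst_coor x i s)) = avg h.
Proof.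
move=> mh [M hM].
have inth x : lebesgue_measure.-integrable `]0, 1[
    (EFin \o (fun s => h (subst_coor x i s))).
  apply: integrable01; last by exists M => s _.
  by apply: measurable_funTS; exact: measurable_subst_coor_r.
pose L x := \int[lebesgue_measure]_(s in `]0, 1[) h (subst_coor x i s).
(* Adding [M] makes the integrand nonnegative, as Tonelli requires; it is subtracted again at the
   end. *)
pose f x : \bar R := (h x + M)%:E.
have mf : measurable_fun setT f.
  by apply/measurable_EFinP/measurable_funD => //; exact: measurable_cst.
have f0 x : (0 <= f x)%E.
  by rewrite lee_fin; have := hM x; rewrite ler_norml => /andP[]; lra.
have Lf x : (\int[lebesgue_measure]_(s in `]0%R, 1%R[) f (subst_coor x i s) =
    (L x + M)%:E)%E.
  rewrite -[M in RHS]integral01_cst -RintegralD//; last first.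
    by apply: integrable01; [exact: measurable_cst|exists `|M|].
  rewrite /Rintegral fineK//; apply: integrable_fin_num => //.
  apply: integrable01.
    apply: measurable_funD; last exact: measurable_cst.
    by apply: measurable_funTS; exact: measurable_subst_coor_r.
  exists (M + `|M|) => s _; apply: (le_trans (ler_normD _ _)).
  by rewrite lerD.
have bL : bmf L.
  split.
    apply: (eq_measurable_fun (fun x => fine (\int[lebesgue_measure]_(s in `]0%R, 1%R[)
      f (subst_coor x i s))%E - M)) => [x _|]; first by rewrite Lf /= addrK.
    apply: measurable_funB; last exact: measurable_cst.
    apply: (measurableT_comp (@fine_measurable R setT measurableT)) => //.
    by apply: measurable_funTS; exact: measurable_integral_subst_coor.
  exists M => x _; rewrite -[leRHS]integral01_cst.
  apply: (le_trans (le_normr_Rintegral _ (inth x))) => //.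
  apply: le_Rintegral => //.
  - apply: integrable01; last by exists M => s _; rewrite normr_id.
    apply: measurableT_comp => //.
    by apply: measurable_funTS; exact: measurable_subst_coor_r.
  - by apply: integrable01; [exact: measurable_cst|exists `|M|].
split=> //; have bh : bmf h by split; [exact: measurable_funTS|exists M].
have := ge0_integral_subst_coor i mf f0.
under eq_integral do rewrite Lf.
rewrite !EFin_avg; [|exact/bmfD/bmf_cst..].
move=> [] E; rewrite !avgD// in E; try exact: bmf_cst.
exact: (addIr _ E).
Qed.

(** Jensen on an interval of length 1, from the nonnegativity of the integral of [(f s - c) ^+ 2]
    with [c] the mean of [f]. *)
Lemma sqr_integral01_le (f : R -> R) : measurable_fun (`]0, 1[ : set (measurableTypeR R)) f ->
  (exists M, forall s, s \in `]0, 1[ -> `|f s| <= M) ->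
  (\int[lebesgue_measure]_(s in `]0, 1[) f s) ^+ 2 <=
  \int[lebesgue_measure]_(s in `]0, 1[) (f s ^+ 2).
Proof.
move=> mf [M fM]; set c := Rintegral _ _ _.
have i1 : lebesgue_measure.-integrable `]0, 1[ (EFin \o f).
  by apply: integrable01 => //; exists M.
have i2 : lebesgue_measure.-integrable `]0, 1[ (EFin \o (fun s => f s ^+ 2)).
  apply: integrable01; first exact: (measurable_funX 2 mf).
  by exists (M ^+ 2) => s /fM h; rewrite normrX lerXn2r// nnegrE (le_trans _ h).
have i3 : lebesgue_measure.-integrable `]0, 1[ (EFin \o (fun s => 2 * c * f s)).
  apply: integrable01; first by apply: measurable_funM => //; exact: measurable_cst.
  by exists (`|2 * c| * M) => s /fM h; rewrite normrM ler_wpM2l.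
have i4 : lebesgue_measure.-integrable `]0, 1[ (EFin \o (fun=> c ^+ 2)).
  by apply: integrable01; [exact: measurable_cst|exists `|c ^+ 2|].
have : 0 <= \int[lebesgue_measure]_(s in `]0, 1[) (f s ^+ 2 - 2 * c * f s + c ^+ 2).
  apply: Rintegral_ge0 => s _.
  by rewrite (_ : _ + _ = (f s - c) ^+ 2) ?sqr_ge0//; ring.
rewrite RintegralD//; last exact: (integrableB _ i2 i3).
rewrite RintegralB// RintegralZl// integral01_cst -/c.
lra.
Qed.

End line_integrals.

(** * The Carleman estimate as a differential inequality *)

Section carleman.
Context {R : realType}.

Lemma integral_FTC (a b : R) (g dg : R -> R) : a < b ->
  continuous g -> continuous dg ->
  (forall s : R, a < s < b -> is_derive s 1 g (dg s)) ->
  lebesgue_measure.-integrable (`]a, b[ : set (measurableTypeR R)) (EFin \o dg) /\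
  \int[lebesgue_measure]_(s in `]a, b[) dg s = g b - g a.
Proof.
move=> ab cg cdg hdg.
have mdg (A : set (measurableTypeR R)) : measurable A ->
    measurable_fun (A : set (measurableTypeR R)) (EFin \o dg).
  move=> mA; apply/measurable_EFinP/measurable_funTS.
  exact: continuous_measurable_fun.
split.
  have i : lebesgue_measure.-integrable (`[a, b] : set (measurableTypeR R)) (EFin \o dg).
    apply: continuous_compact_integrable; first exact: segment_compact.
    exact: continuous_subspaceT.
  by apply: integrableS i => //; exact: subset_itv_oo_cc.
rewrite /Rintegral integral_itv_obnd_cbnd; last exact: mdg.
rewrite integral_itv_bndo_bndc; last exact: mdg.
rewrite (@continuous_FTC2 _ dg g)//.
- exact: continuous_subspaceT.
- split => [s s01||].
  + by have [] := hdg s; rewrite in_itv in s01.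
  + exact/cvg_at_right_filter/cg.
  + exact/cvg_at_left_filter/cg.
- move=> s s01; rewrite derive1E.
  by have [] := hdg s; rewrite in_itv in s01.
Qed.

(* [Tu], [Lu2], [Ru], [Pu] stand for |u_t|^2, |Lu|^2, (Lu, u_t), (u, u_t), and
   [Eu], [yu] for the Dirichlet energy of u and |u|^2; the index m is similar.
   Since [Em] = - (Lm, m), the last four hypotheses say that |u_t + 2u|^2, |m_t + pm|^2,
   |Lm + pm|^2 and |m_t - Lm - (s/2) m|^2 are nonnegative. *)
Lemma carleman_pointwise (C k s l p Tu Lu2 Ru Pu Eu yu Tm Lm2 Rm Pm Em ym : R) :
  0 <= C -> k = 2 * C + 2 -> s = k * C + 2 * C + 1 ->
  s + s ^+ 2 + k * C + 3 * C + 4 <= l -> l <= p ->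
  0 <= Tu -> 0 <= Lu2 -> 0 <= Eu -> 0 <= yu -> 0 <= Em -> 0 <= ym ->
  Tu + 2 * Ru + Lu2 <= C * (yu + Eu + ym + Em) ->
  Tm - 2 * Rm + Lm2 <= C * (yu + Eu + Lu2 + ym + Em) ->
  0 <= Tu + 4 * Pu + 4 * yu ->
  0 <= Tm + 2 * p * Pm + p ^+ 2 * ym ->
  0 <= Lm2 - 2 * p * Em + p ^+ 2 * ym ->
  0 <= Tm - 2 * Rm + Lm2 - s * (Pm + Em) + s ^+ 2 / 4 * ym ->
  Tu + Lu2 + Eu + yu + Em + ym <=
  2 * p * (k * (Eu + yu) - Em + (p - s / 2) * ym) +
  (k * (- 2 * Ru + 2 * Pu) + 2 * Rm + l * p * ym + (p - s / 2) * (2 * Pm)).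
Proof.
move=> C0 kE sE hl lp Tu0 Lu0 Eu0 yu0 Em0 ym0 h1 h2 h3 h4 h5 h6.
have k0 : 2 <= k by rewrite kE; lra.
have kC0 : 0 <= k * C by rewrite mulr_ge0//; lra.
have s1 : 1 <= s by rewrite sE; lra.
have p4 : 4 <= p by have := sqr_ge0 s; lra.
have a1 : k * (Tu + 2 * Ru + Lu2) <= k * (C * (yu + Eu + ym + Em)).
  by apply: ler_wpM2l => //; lra.
have a3 : 0 <= k * (Tu + 4 * Pu + 4 * yu) by rewrite mulr_ge0//; lra.
(* The claim is the sum of [a1], half of [a3], twice [h2], and [h4], [h5], [h6], up to nonnegative
   remainders: half of [b1], then [b2] to [b6], are what is left of the coefficients of [Tu], [Lu2],
   [Eu], [yu], [Em], [ym]. The choice of [k] is read off from [b1] and [b2], that of [s] from [b5],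
   that of [l] from [b6]. *)
have b1 : 0 <= (k - 2) * Tu by rewrite mulr_ge0//; lra.
have b2 : 0 <= (k - 2 * C - 1) * Lu2 by rewrite mulr_ge0// kE; lra.
have s20 := sqr_ge0 s.
have ls : 0 <= l - s by lra.
have b3 : 0 <= (k * (2 * p - C) - 2 * C - 1) * Eu.
  rewrite mulr_ge0//.
  have : 0 <= (k - 2) * (2 * p - C) by rewrite mulr_ge0//; lra.
  by rewrite mulrBl; lra.
have b4 : 0 <= (k * (2 * p - 2 - C) - 2 * C - 1) * yu.
  rewrite mulr_ge0//.
  have : 0 <= (k - 2) * (2 * p - 2 - C) by rewrite mulr_ge0//; lra.
  by rewrite mulrBl; lra.
have b5 : 0 <= (s - k * C - 2 * C - 1) * Em by rewrite mulr_ge0//; lra.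
have b6 : 0 <= (l * p - s * p - s ^+ 2 / 4 - k * C - 2 * C - 1) * ym.
  rewrite mulr_ge0//.
  have : 0 <= (l - s) * (p - 1) by rewrite mulr_ge0//; lra.
  by rewrite mulrBl !mulrBr; lra.
nra.
Qed.

Lemma is_derive_expRM (c l t : R) :
  is_derive t 1 (fun t => c * expR (l * t)) (c * l * expR (l * t)).
Proof.
have d1 : is_derive t 1 (fun t : R => l * t) l.
  by apply: is_derive_eq; rewrite /GRing.scale /= mulr1.
have d2 : is_derive t 1 (fun t : R => expR (l * t)) (expR (l * t) * l).
  exact: is_derive1_comp.
by apply: is_derive_eq; rewrite /GRing.scale /=; ring.
Qed.

Lemma continuous_expRM (c l : R) : continuous (fun t => c * expR (l * t)).
Proof.
move=> t; apply: cvgM; first exact: cvg_cst.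
apply: continuous_comp; last exact: continuous_expR.
by apply: cvgM; [exact: cvg_cst|exact: cvg_id].
Qed.

(** The value of [psi] at [g] is unknown, so it is traded for the one at 0, where an a priori bound
    is at hand. After division by [wg], the bound [1 <= wg] removes the denominator from the
    terminal term. *)
Lemma weighted_difference_le (wg wT w0 A psiT psig psi0 BT B0 : R) :
  1 <= wg -> 0 <= wT -> 0 <= w0 -> 0 <= BT ->
  wg * A <= wT * psiT - wg * psig -> w0 * psi0 <= wg * psig ->
  psiT <= BT -> - psi0 <= B0 -> A <= wT * BT + w0 / wg * B0.
Proof.
move=> wg1 wT0 w00 BT0 hA h0 hT hB.
have wg0 : 0 < wg by lra.
have a1 := ler_wpM2l wT0 hT; have a2 := ler_wpM2l w00 hB.
have a3 : wT * BT <= wg * (wT * BT).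
  by rewrite -[leLHS]mul1r ler_wpM2r// mulr_ge0.
rewrite -(ler_pM2l wg0) mulrDr.
have -> : wg * (w0 / wg * B0) = w0 * B0 by field; rewrite gt_eqF.
by rewrite mulrN in a2; lra.
Qed.

(** Twelve scalar functions of time carry all that is needed of the PDE. The derivative of [w psi]
    is at least [w Q], and since [w] increases it may be replaced by the constant [w g] on (g,
    T). *)
Lemma carleman_integral (T g tau C k s l : R)
    (Tu Lu2 Ru Pu Eu yu Tm Lm2 Rm Pm Em ym : R -> R) :
  0 < g < T -> 1 <= tau ->
  0 <= C -> k = 2 * C + 2 -> s = k * C + 2 * C + 1 ->
  s + s ^+ 2 + k * C + 3 * C + 4 <= l ->
  [/\ continuous Tu, continuous Lu2, continuous Ru & continuous Pu] ->
  [/\ continuous Eu, continuous yu, continuous Rm & continuous Pm] ->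
  continuous Em /\ continuous ym ->
  (forall t, [/\ 0 <= Tu t, 0 <= Lu2 t, 0 <= Eu t & 0 <= yu t] /\
             (0 <= Em t /\ 0 <= ym t)) ->
  (forall t, 0 < t < T ->
     [/\ is_derive t 1 yu (2 * Pu t), is_derive t 1 Eu (- 2 * Ru t),
         is_derive t 1 ym (2 * Pm t) & is_derive t 1 Em (- 2 * Rm t)]) ->
  (forall t, 0 < t < T ->
     [/\ Tu t + 2 * Ru t + Lu2 t <= C * (yu t + Eu t + ym t + Em t),
         Tm t - 2 * Rm t + Lm2 t <= C * (yu t + Eu t + Lu2 t + ym t + Em t)
       & 0 <= Tu t + 4 * Pu t + 4 * yu t]) ->
  (forall t p s, 0 < t < T ->
     [/\ 0 <= Tm t + 2 * p * Pm t + p ^+ 2 * ym t,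
         0 <= Lm2 t - 2 * p * Em t + p ^+ 2 * ym t
       & 0 <= Tm t - 2 * Rm t + Lm2 t - s * (Pm t + Em t) + s ^+ 2 / 4 * ym t]) ->
  \int[lebesgue_measure]_(t in `]g, T[) (Tu t + Lu2 t + Eu t + yu t + Em t + ym t) <=
  expR (2 * tau * expR (l * T)) *
    ((k + tau * l * expR (l * T)) * (Eu T + yu T + ym T)) +
  expR (- (2 * tau * (expR (l * g) - 1))) * (Em 0 + s / 2 * ym 0).
Proof.
move=> /andP[g0 gT] tau1 C0 kE sE hl [cTu cLu cRu cPu] [cEu cyu cRm cPm] [cEm cym].
move=> pos der ineq1 ineq2.
have k0 : 0 <= k * C by rewrite mulr_ge0 // kE; lra.
have k2 : 0 <= k by rewrite kE; lra.
have s1 : 1 <= s by rewrite sE; lra.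
have l1 : 1 <= l by have := sqr_ge0 s; lra.
pose w t := expR (2 * tau * expR (l * t)).
pose p t := tau * l * expR (l * t).
pose Q t := Tu t + Lu2 t + Eu t + yu t + Em t + ym t.
pose psi t := k * (Eu t + yu t) - Em t + (p t - s / 2) * ym t.
pose dpsi t := k * (- 2 * Ru t + 2 * Pu t) + 2 * Rm t + l * p t * ym t +
  (p t - s / 2) * (2 * Pm t).
pose dphi t := w t * (2 * p t * psi t + dpsi t).
have cw : continuous w.
  move=> t; apply: (@continuous_comp _ _ _ (fun t => 2 * tau * expR (l * t)) expR);
    [exact: continuous_expRM|exact: continuous_expR].
have cp : continuous p by exact: continuous_expRM.
have cpsi : continuous psi.
  move=> t; apply: cvgD; first apply: cvgB.
  - by apply: cvgM; [exact: cvg_cst|apply: cvgD; [exact: cEu|exact: cyu]].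
  - exact: cEm.
  - by apply: cvgM; [apply: cvgB; [exact: cp|exact: cvg_cst]|exact: cym].
have cdpsi : continuous dpsi.
  move=> t; apply: cvgD; first apply: cvgD; first apply: cvgD.
  - apply: cvgM; first exact: cvg_cst.
    by apply: cvgD; apply: cvgM; [exact: cvg_cst|exact: cRu|exact: cvg_cst|exact: cPu].
  - by apply: cvgM; [exact: cvg_cst|exact: cRm].
  - by apply: cvgM; [apply: cvgM; [exact: cvg_cst|exact: cp]|exact: cym].
  - apply: cvgM; first by apply: cvgB; [exact: cp|exact: cvg_cst].
    by apply: cvgM; [exact: cvg_cst|exact: cPm].
have cdphi : continuous dphi.
  move=> t; apply: cvgM; first exact: cw.
  apply: cvgD; last exact: cdpsi.
  by apply: cvgM; [apply: cvgM; [exact: cvg_cst|exact: cp]|exact: cpsi].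
have cphi : continuous (fun t => w t * psi t).
  by move=> t; apply: cvgM; [exact: cw|exact: cpsi].
have cQ : continuous Q.
  by move=> t; repeat apply: cvgD;
    [exact: cTu|exact: cLu|exact: cEu|exact: cyu|exact: cEm|exact: cym].
have hder t : 0 < t < T -> is_derive t 1 (fun t => w t * psi t) (dphi t).
  move=> /der[d1 d2 d3 d4].
  have dw : is_derive t 1 w (w t * (2 * tau * l * expR (l * t))).
    apply: (@is_derive1_comp _ expR (fun t => 2 * tau * expR (l * t))).
    exact: is_derive_expRM.
  have dp : is_derive t 1 p (l * p t).
    have -> : l * p t = tau * l * l * expR (l * t) by rewrite /p; ring.
    exact: is_derive_expRM.
  have dps : is_derive t 1 psi (dpsi t).
    by apply: is_derive_eq; rewrite /GRing.scale /= /dpsi; ring.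
  by apply: is_derive_eq; rewrite /GRing.scale /= /dphi /p; ring.
have p_ge t : 0 <= t -> l <= p t.
  move=> t0; rewrite /p -[leLHS]mul1r -[leLHS]mulr1 ler_pM//; try lra.
  - by rewrite ler_wpM2r//; lra.
  - by rewrite -expR0 ler_expR mulr_ge0//; lra.
have BT : 0 < T -> psi T <= (k + p T) * (Eu T + yu T + ym T).
  move=> T0; have := p_ge T (ltW T0); have [[_ _ ET yT] [EmT ymT]] := pos T.
  rewrite /psi; clear - kE C0 s1 l1 ET yT EmT ymT; move: (p T) => pT lpT.
  have a1 : 0 <= s / 2 * ym T by rewrite mulr_ge0//; lra.
  have a2 : 0 <= k * ym T by rewrite mulr_ge0// kE; lra.
  have a3 : 0 <= pT * (Eu T + yu T) by rewrite mulr_ge0 ?addr_ge0//; lra.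
  by lra.
have B0 : - psi 0 <= Em 0 + s / 2 * ym 0.
  have := p_ge 0 (lexx 0); have [[_ _ E0 y0] [Em0 ym0]] := pos 0.
  rewrite /psi; clear - kE C0 l1 E0 y0 Em0 ym0; move: (p 0) => p0 lp0.
  have a1 : 0 <= k * (Eu 0 + yu 0) by rewrite mulr_ge0 ?addr_ge0// kE; lra.
  have a2 : 0 <= p0 * ym 0 by rewrite mulr_ge0//; lra.
  by lra.
have main t : 0 < t < T -> Q t <= 2 * p t * psi t + dpsi t.
  move=> tT; have [[? ? ? ?] [? ?]] := pos t; have [? ? ?] := ineq1 t tT.
  have [? ? _] := ineq2 t (p t) s tT; have [_ _ ?] := ineq2 t (p t) s tT.
  apply: (@carleman_pointwise C k s l (p t) _ _ _ _ _ _ (Tm t) (Lm2 t)) => //.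
  by apply: p_ge; have /andP[/ltW] := tT.
have Q0 t : 0 <= Q t.
  by have [[? ? ? ?] [? ?]] := pos t; rewrite /Q !addr_ge0.
have wmono a b : a <= b -> w a <= w b.
  move=> ab; rewrite /w ler_expR ler_wpM2l//; first lra.
  by rewrite ler_expR ler_wpM2l//; lra.
have [intd FTCd] := @integral_FTC g T (fun t => w t * psi t) dphi gT cphi cdphi
  (fun t gt => hder t (introT andP (conj (lt_trans g0 (andP gt).1) (andP gt).2))).
(* The derivative of [w psi] is at least [w Q], hence nonnegative, so [w psi] does not decrease
   between 0 and [g]. *)
have low : w 0 * psi 0 <= w g * psi g.
  have [t||c cg E] := @MVT _ (fun t => w t * psi t) dphi 0 g g0.
  - rewrite in_itv /= => /andP[t0 tg]; apply: hder.
    by rewrite t0 (lt_trans tg).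
  - exact: continuous_subspaceT.
  rewrite -subr_ge0 E subr0 mulr_ge0 ?(ltW g0)// mulr_ge0 ?expR_ge0//.
  apply: le_trans (Q0 c) (main _ _).
  by move: cg; rewrite in_itv /= => /andP[-> /lt_trans->].
have intQ : lebesgue_measure.-integrable (`]g, T[ : set (measurableTypeR R)) (EFin \o Q).
  have i : lebesgue_measure.-integrable (`[g, T] : set (measurableTypeR R)) (EFin \o Q).
    apply: continuous_compact_integrable; first exact: segment_compact.
    exact: continuous_subspaceT.
  by apply: integrableS i => //; exact: subset_itv_oo_cc.
have up : w g * \int[lebesgue_measure]_(t in `]g, T[) Q t <=
    \int[lebesgue_measure]_(t in `]g, T[) dphi t.
  rewrite -RintegralZl//; apply: le_Rintegral => //.
    by have := integrableZl _ (w g) intQ; exact.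
  move=> t /=; rewrite in_itv /= => /andP[gt tT].
  apply: (@le_trans _ _ (w t * Q t)).
    by rewrite ler_wpM2r// wmono// ltW.
  by rewrite ler_wpM2l ?expR_ge0// main// tT (lt_trans g0).
rewrite FTCd in up.
have -> : expR (- (2 * tau * (expR (l * g) - 1))) = w 0 / w g.
  rewrite /w -expRN -expRD; congr expR; rewrite mulr0 expR0; ring.
apply: (weighted_difference_le _ (expR_ge0 _) (expR_ge0 _) _ up low (BT _) B0).
- by rewrite /w -[leLHS]expR0 ler_expR !mulr_ge0 ?expR_ge0// (le_trans _ tau1).
- have [[_ _ ET yT] [EmT ymT]] := pos T.
  by rewrite mulr_ge0 ?addr_ge0// (le_trans _ (p_ge T _))// ?ltW// ?(lt_trans g0 gT)// (lt_le_trans ltr01).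
- exact: lt_trans gT.
Qed.

(* tau = log(1/delta) / (4 e^{l T}). *)
Lemma holder_choice (T g l k A B : R) :
  0 < g < T -> 1 <= l -> 0 <= k -> 0 <= A -> 0 <= B ->
  exists kappa delta0 C : R,
  [/\ 0 < kappa < 1 / 2, 0 < delta0 < 1, 0 < C &
   forall delta, 0 < delta < delta0 -> exists2 tau : R, 1 <= tau &
   expR (2 * tau * expR (l * T)) *
     ((k + tau * l * expR (l * T)) * (A * delta ^+ 2)) +
   expR (- (2 * tau * (expR (l * g) - 1))) * B <= C * delta `^ kappa].
Proof.
move=> /andP[g0 gT] l1 k0 A0 B0.
have l0 : 0 < l by rewrite (lt_le_trans ltr01).
set L := expR (l * T); have L0 : 0 < L by exact: expR_gt0.
have lg1 : 1 < expR (l * g) by rewrite -expR0 ltr_expR mulr_gt0.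
have lgT : expR (l * g) < L by rewrite ltr_expR ltr_pM2l.
(* With [X = log(1/delta)] and the chosen [tau], the factor of [B] becomes [exp(-kappa X)]. The
   value stays below 1/2 because [expR (l * g) - 1 < L]. *)
pose kappa := (expR (l * g) - 1) / (2 * L).
have k_gt0 : 0 < kappa by rewrite divr_gt0 ?subr_gt0// mulr_gt0.
have k_lt : kappa < 1 / 2.
  by rewrite /kappa ltr_pdivrMr ?mulr_gt0// mulrA mul1r mulVf ?mul1r// ltrBlDr ltr_wpDr.
(* The condition [delta < expR (- (4 * L))] says exactly that [tau = X / (4 * L)] exceeds 1. *)
exists kappa, (expR (- (4 * L))), ((k + l) * A + B + 1); split.
- by rewrite k_gt0.
- by rewrite expR_gt0 -expR0 ltr_expR oppr_lt0 mulr_gt0.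
- by rewrite ltr_wpDl// addr_ge0// mulr_ge0// addr_ge0// ltW.
move=> d /andP[d0 dd0].
pose X := - ln d.
have dE : d = expR (- X) by rewrite /X opprK lnK.
have XL : 4 * L < X.
  by rewrite /X -ltrN2 opprK -[X in _ < X]opprK opprK -[_ < _]ltr_expR lnK.
have X0 : 0 < X by rewrite (lt_trans _ XL)// mulr_gt0.
exists (X / (4 * L)).
  by rewrite ler_pdivlMr ?mulr_gt0// mul1r ltW.
have -> : 2 * (X / (4 * L)) * L = X / 2 by field; rewrite gt_eqF.
have -> : X / (4 * L) * l * L = X / 4 * l by field; rewrite gt_eqF.
have -> : 2 * (X / (4 * L)) * (expR (l * g) - 1) = kappa * X.
  by rewrite /kappa; field; rewrite gt_eqF.
have -> : d `^ kappa = expR (- (kappa * X)).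
  by rewrite /powR gt_eqF// /X mulrN opprK.
have -> : d ^+ 2 = expR (- (2 * X)).
  by rewrite dE expr2 -expRD; congr expR; ring.
(* The terminal term consists of [exp(X/2)] from the weight, a factor linear in [X] that a second
   [exp(X/2)] absorbs, and [delta^2 = exp(-2X)]: altogether [exp(-X)], which is below
   [exp(-kappa X)]. *)
have hX : 1 + X / 2 <= expR (X / 2) by exact: expR_ge1Dx.
have e1 : k + X / 4 * l <= (k + l) * expR (X / 2).
  have a1 : k * 1 <= k * expR (X / 2) by rewrite ler_wpM2l//; lra.
  have a2 : l * (X / 4) <= l * expR (X / 2) by rewrite ler_wpM2l//; lra.
  by rewrite mulrDl; lra.
have e2 : expR (X / 2) * ((k + X / 4 * l) * (A * expR (- (2 * X)))) <=
    (k + l) * A * expR (- X).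
  have -> : (k + l) * A * expR (- X) =
     expR (X / 2) * ((k + l) * expR (X / 2) * (A * expR (- (2 * X)))).
    have -> : expR (- X) = expR (X / 2) * expR (X / 2) * expR (- (2 * X)).
      by rewrite -!expRD; congr expR; field.
    ring.
  by rewrite ler_wpM2l ?expR_ge0// ler_wpM2r// mulr_ge0// expR_ge0.
have e3 : (k + l) * A * expR (- X) <= (k + l) * A * expR (- (kappa * X)).
  apply: ler_wpM2l; first by rewrite mulr_ge0// addr_ge0// ltW.
  rewrite ler_expR lerN2 -[leRHS]mul1r.
  by rewrite ler_wpM2r ?ltW// (lt_trans k_lt)//; lra.
have e4 := expR_ge0 (- (kappa * X)).
rewrite (le_trans (lerD (le_trans e2 e3) (lexx _)))//.
by clear - e4; lra.
Qed.

End carleman.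

(** * Extension from the closed cylinder by clamping *)

Section closed_cylinder.
Context {R : realType}.

Lemma cvg_row n (T : Type) (F : set_system T) {FF : Filter F}
    (f : T -> 'rV[R]_n) (l : 'rV[R]_n) :
  (forall i, f x ord0 i @[x --> F] --> l ord0 i) -> f @ F --> l.
Proof.
move=> cf; apply/cvg_ballP => e e0.
have H : \forall x \near F, forall i, ball (l ord0 i) e (f x ord0 i).
  apply: filter_forall => i; move/cvg_ballP : (cf i); exact.
by apply: filterS H => x Hx; split => // k j; rewrite ord1.
Qed.

Definition ccube n : set 'rV[R]_n := [set x | forall i, 0 <= x ord0 i <= 1].
Definition ccyl n (T : R) : set ('rV[R]_n * R) := ccube (n := n) `*` `[0, T].

Lemma closed_ccube n : closed (@ccube n).
Proof.
have -> : @ccube n = \bigcap_(i in [set: 'I_n])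
    ((fun x : 'rV[R]_n => x ord0 i) @^-1` `[0, 1]).
  apply/seteqP; split => y H i.
    by move=> _; have := H i; rewrite /= in_itv.
  by have := H i I; rewrite /= in_itv.
apply: closed_bigI => i _; apply: preimage_closed; last exact: itv_closed.
by move=> y _; exact: coord_continuous.
Qed.

Lemma closed_ccyl n T : closed (@ccyl n T).
Proof.
have -> : @ccyl n T = (fst @^-1` @ccube n) `&` (snd @^-1` `[0, T]) by [].
apply: closedI; apply: preimage_closed.
- by move=> p _; exact: cvg_fst.
- exact: closed_ccube.
- by move=> p _; exact: cvg_snd.
- exact: itv_closed.
Qed.

Lemma itv_dense (T a e : R) : 0 < T -> 0 < e -> 0 <= a <= T ->
  exists2 b, 0 < b < T & `|a - b| < e.
Proof.
move=> T0 e0 /andP[a0 aT].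
(* Move [a] towards the midpoint by the fraction [th] of the distance: [th > 0] brings it inside,
   and [th * T <= e / 2] keeps it close. *)
pose th := Num.min (1 / 2) (e / (2 * T)).
have th0 : 0 < th by rewrite lt_min !divr_gt0// mulr_gt0.
have th1 : th <= 1 / 2 by rewrite ge_min lexx.
have th2 : th * T <= e / 2.
  apply: (@le_trans _ _ (e / (2 * T) * T)).
    by apply: ler_wpM2r; [exact: ltW|rewrite ge_min lexx orbT].
  by rewrite le_eqVlt; apply/orP; left; apply/eqP; field; rewrite gt_eqF.
have p1 : 0 < th * T by rewrite mulr_gt0.
have p2 : 0 <= th * a by rewrite mulr_ge0// ltW.
have p3 : th * a <= th * T by apply: ler_wpM2l; [exact: ltW|].
have p4 : 0 <= (1 / 2 - th) * a by rewrite mulr_ge0//; lra.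
have p5 : 0 <= (1 / 2 - th) * (T - a) by rewrite mulr_ge0//; lra.
exists (a + th * (T / 2 - a)).
  by apply/andP; split; nra.
by rewrite ltr_norml; apply/andP; split; lra.
Qed.

Lemma cube_dense n (x : 'rV[R]_n) e : 0 < e -> ccube x ->
  exists2 y, cube n y & ball x e y.
Proof.
move=> e0 cx.
have H i : exists b, 0 < b < 1 /\ `|x ord0 i - b| < e.
  by have [b ? ?] := itv_dense ltr01 e0 (cx i); exists b.
exists (\row_i projT1 (cid (H i))) => [i|].
  by rewrite mxE; have [] := projT2 (cid (H i)).
split=> // k i; rewrite ord1 mxE.
by have [_] := projT2 (cid (H i)).
Qed.

Lemma closure_cube n : closure (cube n) = @ccube n.
Proof.
apply/seteqP; split => x cx.
  apply: closed_ccube; apply: closureS cx => y cy i.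
  by have /andP[/ltW -> /ltW ->] := cy i.
move=> B /nbhs_ballP[e /= e0 eB].
by have [y cy xy] := cube_dense e0 cx; exists y; split => //; exact: eB.
Qed.

Lemma closure_cylinder n T : 0 < T -> closure (cylinder n 0 T) = @ccyl n T.
Proof.
move=> T0; apply/seteqP; split => [p cp|[x t] [/= cx ct]].
  apply: closed_ccyl; apply: closureS cp => -[x t] [/= cx ct]; split => /=.
    by move=> i; have /andP[/ltW -> /ltW ->] := cx i.
  by move: ct; rewrite !in_itv /= => /andP[/ltW -> /ltW ->].
move=> B /nbhs_ballP[e /= e0 eB].
have [y cy xy] := cube_dense e0 cx.
rewrite in_itv /= in ct; have [s sT ts] := itv_dense T0 e0 ct.
by exists (y, s); split; [split => //=; rewrite in_itv|exact: eB].
Qed.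

Lemma compact_ccyl n T : compact (@ccyl n T).
Proof.
apply: compact_setX; last exact: segment_compact.
have -> : @ccube n = [set v | forall i, `[0, 1]%classic (v ord0 i)].
  by apply/seteqP; split => x H i; have := H i; rewrite /= in_itv.
apply: (@rV_compact R n (fun=> `[0 : R, 1]%classic)) => i.
exact: segment_compact.
Qed.

Definition clamp (a b x : R) : R := Num.max a (Num.min b x).

Lemma clamp_itv a b x : a <= b -> a <= clamp a b x <= b.
Proof. by move=> ab; rewrite /clamp le_max lexx /= ge_max ab ge_min lexx. Qed.

Lemma clamp_id a b x : a <= x <= b -> clamp a b x = x.
Proof. by move=> /andP[ax xb]; rewrite /clamp (min_idPr xb) (max_idPr ax). Qed.

Lemma continuous_clamp a b : continuous (clamp a b).
Proof.
move=> x; apply: (@continuous_max _ _ (cst a) (fun x => Num.min b x)).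
  exact: cst_continuous.
apply: (@continuous_min _ _ (cst b) id); first exact: cst_continuous.
by move=> y; exact: cvg_id.
Qed.

Definition cyl_clamp n (T : R) (p : 'rV[R]_n * R) : 'rV[R]_n * R :=
  (\row_i clamp 0 1 (p.1 ord0 i), clamp 0 T p.2).

Lemma cyl_clamp_in n T p : 0 < T -> ccyl T (@cyl_clamp n T p).
Proof.
move=> T0; split => [i|] /=; first by rewrite mxE; exact: clamp_itv.
by rewrite in_itv; exact/clamp_itv/ltW.
Qed.

Lemma cyl_clamp_id n T p : ccyl T p -> @cyl_clamp n T p = p.
Proof.
case: p => x t [/= cx]; rewrite in_itv /= => ct; congr pair => /=.
  by apply/rowP => i; rewrite mxE clamp_id.
exact: clamp_id.
Qed.

Lemma continuous_cyl_clamp n T : continuous (@cyl_clamp n T).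
Proof.
move=> p; apply: cvg_nbhs_pair.
  apply: cvg_row => i.
  rewrite mxE; under eq_fun do rewrite mxE.
  apply: (@continuous_comp _ _ _ (fun p : 'rV[R]_n * R => p.1 ord0 i)).
    apply: (@continuous_comp _ _ _ fst (fun x : 'rV[R]_n => x ord0 i)).
      exact: cvg_fst.
    exact: coord_continuous.
  exact: continuous_clamp.
apply: (@continuous_comp _ _ _ snd); first exact: cvg_snd.
exact: continuous_clamp.
Qed.

(** [cyl_clamp] is a continuous retraction onto the closed cylinder, so continuity there becomes
    continuity everywhere; the bound comes from compactness. *)
Lemma cb_cyl_clamp n T (f : 'rV[R]_n * R -> R) : 0 < T ->
  {within closure (cylinder n 0 T), continuous f} ->
  cb (f \o @cyl_clamp n T).
Proof.
move=> T0; rewrite closure_cylinder// => cf; split.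
  move=> p; have /subspace_continuousP/(_ _ (cyl_clamp_in p T0)) := cf.
  apply: cvg_trans; move=> A; rewrite /within /= => fA.
  have H : nbhs p (fun q => ccyl T (cyl_clamp T q) -> A (f (cyl_clamp T q))).
    exact: (@continuous_cyl_clamp n T p _ fA).
  by apply: filterS H => q /= Aq; exact: (Aq (cyl_clamp_in _ T0)).
have := compact_bounded (continuous_compact cf (@compact_ccyl n T)).
move=> [M [_ hM]]; exists (M + 1) => p.
have M1 : M < M + 1 by rewrite ltrDl.
by apply: (hM _ M1); exists (cyl_clamp T p) => //; exact/cyl_clamp_in.
Qed.

End closed_cylinder.

(** * Partial derivatives up to the boundary *)

Section partial_derivatives.
Context {R : realType}.

Section general.
Context (V : normedModType R) (D : set V).
Implicit Types (v : V) (f g h : V -> R).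

Lemma within_subset (A B : set V) h (x : V) (l : R) : A `<=` B ->
  h @ within B (nbhs x) --> l -> h @ within A (nbhs x) --> l.
Proof.
move=> AB; apply: cvg_trans => P H.
have {}H : nbhs x (fun y => B y -> P (h y)) := H.
suff : nbhs x (fun y => A y -> P (h y)) by [].
by apply: filterS H => y BP /AB.
Qed.

Lemma pd_cvg v f h (x : V) : closure D x -> (forall y, D y -> 'D_v f y = h y) ->
  h @ within (closure D) (nbhs x) --> h x ->
  pd D v f x = h x.
Proof.
move=> cx fh ch.
have PF : ProperFilter (within D (nbhs x)) by exact: within_nbhs_proper.
apply: cvg_lim; first exact: norm_hausdorff.
apply: (@cvg_trans _ (h @ within D (nbhs x))); last first.
  exact: within_subset (@subset_closure _ D) ch.
apply: near_eq_cvg.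
suff : nbhs x (fun y => D y -> h y = 'D_v f y) by [].
by apply: nearW => y Dy; rewrite fh.
Qed.

(** The way to compute [pd] on the boundary: a function that is the derivative inside and continuous
    on the closure must be the limit that defines [pd], since limits within [D] at points of its
    closure are unique. *)
Lemma has_pdI v f h : (forall x, D x -> is_derive x v f (h x)) ->
  {within closure D, continuous h} ->
  has_pd D v f /\ forall x, closure D x -> pd D v f x = h x.
Proof.
move=> fh ch.
have E x : closure D x -> pd D v f x = h x.
  move=> cx; apply: pd_cvg => // [y /fh []//|].
  exact: (iffLR (subspace_continuousP _ _) ch).
split=> //; split.
- by move=> x /fh [].
- by move=> x Dx; have [_ ->] := fh x Dx; rewrite E//; exact: subset_closure.
- by apply: subspace_eq_continuous ch => x /set_mem cx; exact/esym/E.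
Qed.

Lemma has_pd_is_derive v f x : has_pd D v f -> D x ->
  is_derive x v f (pd D v f x).
Proof. by move=> [df pdE _] Dx; split; [exact: df|rewrite pdE]. Qed.

Lemma has_pd_lin v f g (c d : R) : has_pd D v f -> has_pd D v g ->
  has_pd D v (fun x => c * f x + d * g x) /\
  forall x, closure D x ->
    pd D v (fun x => c * f x + d * g x) x = c * pd D v f x + d * pd D v g x.
Proof.
move=> hf hg; apply: has_pdI => [x Dx|].
  have df := has_pd_is_derive hf Dx; have dg := has_pd_is_derive hg Dx.
  exact: (is_deriveD (is_deriveZ c df) (is_deriveZ d dg)).
have [_ _ cf] := hf; have [_ _ cg] := hg.
move=> x; apply: cvgD; apply: cvgM; [exact: cvg_cst|exact: cf|exact: cvg_cst|exact: cg].
Qed.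

(** As [D] is open, [f] and [g] agree near each of its points and have the same derivatives there,
    hence the same limits at the boundary. *)
Lemma pd_ext v f g : open D -> (forall x, D x -> f x = g x) -> pd D v f = pd D v g.
Proof.
move=> oD fg; apply/funext => x; rewrite /pd.
have E y : D y -> 'D_v f y = 'D_v g y.
  move=> Dy; apply: near_eq_derive; near=> z; apply: fg; near: z.
  exact: open_nbhs_nbhs.
have S (F G : V -> R) : (forall y, D y -> F y = G y) ->
    F @ within D (nbhs x) `<=` G @ within D (nbhs x).
  move=> FG P H; have {}H : nbhs x (fun y => D y -> P (F y)) := H.
  suff : nbhs x (fun y => D y -> P (G y)) by [].
  by apply: filterS H => y PF Dy; rewrite -FG//; exact: PF.
congr (lim _); apply/seteqP; split; apply: S => y Dy; first exact: E.
exact/esym/E.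
Unshelve. all: by end_near. Qed.

Lemma has_pd_ext v f g : open D -> (forall x, D x -> f x = g x) ->
  has_pd D v f -> has_pd D v g.
Proof.
move=> oD fg [df pdE cf].
have E y : D y -> {near y, f =1 g}.
  by move=> Dy; near=> z; apply: fg; near: z; exact: open_nbhs_nbhs.
split.
- by move=> x Dx; apply: near_eq_derivable (df _ Dx); exact: E.
- move=> x Dx; rewrite -(pd_ext v oD fg) pdE//; apply: near_eq_derive; exact: E.
- by rewrite -(pd_ext v oD fg).
Unshelve. all: by end_near. Qed.

End general.
End partial_derivatives.

(** * Restriction to lines and time slices *)

Section slices.
Context {R : realType}.

Lemma open_cube n : open (cube n : set 'rV[R]_n).
Proof.
rewrite openE => x cx; rewrite /interior.
have H i : nbhs x (fun y : 'rV[R]_n => is_true (0 < y ord0 i < 1)).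
  apply: (@coord_continuous R 1 n ord0 i x (fun z => is_true (0 < z < 1))).
  have xi : x ord0 i \in `]0, 1[ by rewrite in_itv /= cx.
  by apply: filterS (near_in_itvoo xi) => z; rewrite in_itv.
exact: (filter_forall _ H).
Qed.

Lemma open_cylinder n T : open (cylinder n 0 T : set ('rV[R]_n * R)).
Proof.
rewrite /cylinder; have -> : cube n `*` `]0, T[ =
    fst @^-1` cube n `&` snd @^-1` `]0, T[ by [].
apply: openI; apply: open_comp => //.
- by move=> p _; exact: cvg_fst.
- exact: open_cube.
- by move=> p _; exact: cvg_snd.
Qed.

(** A directional derivative sees only the increments along its direction; lines, slices at fixed
    time and fixed points in space are all instances. *)
Lemma is_derive_quotient (V V' : normedModType R) (f : V -> R) (g : V' -> R)
    a v b w d :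
  (forall h : R, f (h *: v + a) - f a = g (h *: w + b) - g b) ->
  is_derive a v f d -> is_derive b w g d.
Proof.
move=> fg [df fd].
have E : (fun h : R => h^-1 *: ((f \o shift a) (h *: v) - f a)) =
    (fun h : R => h^-1 *: ((g \o shift b) (h *: w) - g b)).
  by apply/funext => h /=; rewrite fg.
by split; [rewrite /derivable -E|rewrite /derive -E].
Qed.

Lemma is_derive_line (V : normedModType R) (f : V -> R) x v (s d : R) :
  is_derive (x + s *: v) v f d -> is_derive s 1 (fun r : R => f (x + r *: v)) d.
Proof.
apply: is_derive_quotient => h; congr (f _ - _).
have -> : h *: (1 : R) = h by exact: mulr1.
by rewrite scalerDl addrCA.
Qed.

Lemma is_derive_slice n (f : 'rV[R]_n * R -> R) x t v d :
  is_derive (x, t) (v, 0) f d -> is_derive x v (fun y => f (y, t)) d.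
Proof.
apply: is_derive_quotient => h; congr (f _ - _).
by congr pair; rewrite /= scaler0 add0r.
Qed.

Lemma is_derive_time n (f : 'rV[R]_n * R -> R) (x : 'rV[R]_n) (t d : R) :
  is_derive (x, t) ((0, 1) : 'rV[R]_n * R) f d -> is_derive t 1 (fun s => f (x, s)) d.
Proof.
apply: is_derive_quotient => h; congr (f _ - _).
by congr pair; rewrite /= ?scaler0 ?add0r //; exact: scaler0.
Qed.

Lemma ball_evec n (x : 'rV[R]_n) i (s e : R) : `|s| < e ->
  ball x e (x + s *: evec i).
Proof.
move=> se; split; first exact: le_lt_trans se.
move=> k j; rewrite /evec !mxE /ball /= opprD addNKr normrN.
rewrite ord1 eqxx /=; case: eqP => _; first by rewrite mulr1.
by rewrite mulr0 normr0 (le_lt_trans _ se).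
Qed.

Lemma is_derive_cvg (V : normedModType R) (f : V -> R) x v d :
  (forall e, 0 < e -> \forall h \near 0^',
     `|f (h *: v + x) - f x - h * d| <= e * `|h|) ->
  is_derive x v f d.
Proof.
move=> H.
have C : (fun h : R => h^-1 *: ((f \o shift x) (h *: v) - f x)) @ 0^' --> d.
  apply/cvgrPdist_le => e e0; near=> h.
  have h0 : h != 0 by near: h; exact: nbhs_dnbhs_neq.
  rewrite distrC -(ler_pM2r (_ : 0 < `|h|)) ?normr_gt0// -normrM mulrBl.
  rewrite /= /GRing.scale /= mulrAC mulVf// mul1r [d * h]mulrC.
  by near: h; exact: (H e e0).
by split; [apply/cvg_ex; exists d|apply: cvg_lim => //; exact: norm_hausdorff].
Unshelve. all: by end_near. Qed.

Lemma continuous_slice n (f : 'rV[R]_n * R -> R) t : continuous f ->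
  continuous (fun x => f (x, t)).
Proof.
move=> cf x; apply: (@continuous_comp _ _ _ (fun x => (x, t)) f); last exact: cf.
by apply: (@cvg_nbhs_pair _ _ _ (nbhs x) (nbhs_filter x)); [exact: cvg_id|exact: cvg_cst].
Qed.

Lemma continuous_time n (f : 'rV[R]_n * R -> R) x : continuous f ->
  continuous (fun t => f (x, t)).
Proof.
move=> cf t; apply: (@continuous_comp _ _ _ (fun t => (x, t)) f); last exact: cf.
exact: cvg_pair_l.
Qed.

(** For [t = 0] and [t = T] the slice lies in the boundary of the cylinder, where only the limit
    [pd] is given and not a derivative. Differentiability of the slice is drawn from nearby interior
    times, the error being uniformly small by continuity of [pd] on the closure. *)
Lemma has_pd_slice n T (f : 'rV[R]_n * R -> R) i : 0 < T ->
  {within closure (cylinder n 0 T), continuous f} ->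
  has_pd (cylinder n 0 T) (evec i, 0) f -> forall t, 0 <= t <= T ->
  has_pd (cube n) (evec i) (fun x => f (x, t)) /\
  forall x, closure (cube n) x ->
    pd (cube n) (evec i) (fun y => f (y, t)) x =
    pd (cylinder n 0 T) (evec i, 0) f (x, t).
Proof.
move=> T0 cf hf t0 t0T; have [_ _ cpf] := hf.
have [cG _] := cb_cyl_clamp T0 cf; have [cH _] := cb_cyl_clamp T0 cpf.
set G := f \o _ in cG; set H := pd _ _ f \o _ in cH.
have clE x t : ccube x -> 0 <= t <= T -> cyl_clamp T (x, t) = (x, t) :> 'rV[R]_n * R.
  by move=> cx ct; rewrite cyl_clamp_id//; split => //=; rewrite in_itv.
have cubeW x : cube n x -> ccube x.
  by move=> cx; rewrite -closure_cube; exact: subset_closure.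
apply: has_pdI => [x cx|]; last first.
  apply: (@subspace_eq_continuous _ _ _ (fun x => H (x, t0))); last first.
    exact/continuous_subspaceT/continuous_slice.
  by move=> x /set_mem; rewrite closure_cube => cx; rewrite /H /= clE.
apply: is_derive_cvg => e e0.
have [e1 /= e10 e1H] : nbhs_ball (x, t0) (fun q => `|H (x, t0) - H q| < e).
  by apply/nbhs_ballP; move/cvgrPdist_lt : (cH (x, t0)); exact.
have [e2 /= e20 e2c] : nbhs_ball x (cube n).
  by apply/nbhs_ballP; exact/open_nbhs_nbhs/(conj (open_cube (n := n))).
pose e3 := Num.min e1 e2.
have e30 : 0 < e3 by rewrite lt_min e10.
near=> h.
have he3 : `|h| < e3.
  by near: h; apply/nbhs_dnbhs; exists e3 => //= z /=; rewrite sub0r normrN.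
(* A strict failure at [t0] persists, by continuity in time, at some [t] inside (0, T), where the
   mean value theorem along the direction [evec i] excludes it. *)
rewrite leNgt; apply/negP => contra.
have xs s : `|s| < e3 -> cube n (x + s *: evec i).
  move=> se; apply: e2c; apply: ball_evec.
  by rewrite (lt_le_trans se)// ge_min lexx orbT.
have hx : h *: evec i + x = x + h *: evec i by rewrite addrC.
pose phi t := `|G (x + h *: evec i, t) - G (x, t) - h * H (x, t0)|.
have cphi : continuous phi.
  move=> t; apply: cvg_norm; apply: cvgB; last exact: cvg_cst.
  by apply: cvgB; exact: continuous_time.
have phi0 : e * `|h| < phi t0.
  rewrite /phi /G /H /= !clE//; first by rewrite -hx.
  - exact: cubeW.
  - by apply: cubeW; exact: xs.
have [e4 /= e40 e4phi] : nbhs_ball t0 (fun t => e * `|h| < phi t).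
  apply/nbhs_ballP; move/cvgrPdist_lt : (cphi t0) => /(_ (phi t0 - e * `|h|)).
  rewrite subr_gt0 => /(_ phi0); apply: filterS => t /=.
  by rewrite ltr_norml => /andP[_]; lra.
have e340 : 0 < Num.min e3 e4 by rewrite lt_min e30.
have [t tT] := itv_dense T0 e340 t0T.
rewrite lt_min => /andP[te3 te4].
have := e4phi t te4; apply/negP; rewrite -leNgt /phi.
have [tc1 tc2] : 0 <= t <= T /\ `]0, T[%classic t.
  by move/andP : (tT) => [/ltW -> /ltW ->]; rewrite /= in_itv.
have Hx s : `|s| < e3 -> `|H (x + s *: evec i, t) - H (x, t0)| <= e.
  move=> se; rewrite distrC ltW//; apply: e1H; split => /=.
    by apply: ball_evec; rewrite (lt_le_trans se)// ge_min lexx.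
  by apply: (lt_le_trans te3); rewrite ge_min lexx.
have e3n s : - e3 < s < e3 -> `|s| < e3 by rewrite ltr_norml.
pose F s := G (x + s *: evec i, t) - s * H (x, t0).
have -> : G (x + h *: evec i, t) - G (x, t) - h * H (x, t0) = F h - F 0.
  by rewrite /F scale0r addr0 mul0r subr0; ring.
rewrite -[h in leRHS]subr0.
apply: (@derive_bound_lipschitz _ F (fun s => H (x + s *: evec i, t) - H (x, t0))
  (- e3) e3); last 2 first.
- by rewrite oppr_lt0 e30.
- by rewrite -ltr_norml.
- move=> s /e3n se.
  have dG : is_derive s 1 (fun s => G (x + s *: evec i, t)) (H (x + s *: evec i, t)).
    have cxs := xs _ se.
    have d1 : is_derive (x + s *: evec i) (evec i) (fun y => f (y, t))
        (H (x + s *: evec i, t)).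
      apply: is_derive_slice; rewrite /H /= clE//; last exact: cubeW.
      by apply: has_pd_is_derive => //; split.
    have d2 := is_derive_line d1.
    have [dd dv] := d2.
    have nE : {near s, (fun r => f (x + r *: evec i, t)) =1
        (fun r => G (x + r *: evec i, t))}.
      near=> r; rewrite /G /= clE//; apply: cubeW; apply: xs.
      near: r; apply/nbhs_ballP; exists (e3 - `|s|); first by rewrite /= subr_gt0.
      move=> r /=; rewrite /ball /= distrC => rs.
      by rewrite -[r](subrK s) (le_lt_trans (ler_normD _ _))// -ltrBrDr.
    split; first exact: near_eq_derivable nE dd.
    by rewrite -dv; apply/esym/near_eq_derive.
  have dl : is_derive s 1 (fun s : R => s * H (x, t0)) (H (x, t0)).
    by apply: is_derive_eq; rewrite /GRing.scale /= mulr0 mulr1 add0r.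
  exact: (is_deriveB dG dl).
- by move=> s /e3n; exact: Hx.
Unshelve. all: by end_near. Qed.

End slices.

(** * Functions of class C^{2,1} and the operator L *)

Section regular_functions.
Context {R : realType} (n : nat) (T : R).
Hypothesis T0 : 0 < T.
Implicit Types (u v f : 'rV[R]_n * R -> R) (b : 'rV[R]_n -> R).

Let Q := cylinder n 0 T : set ('rV[R]_n * R).

Let oQ : open Q. Proof. exact: open_cylinder. Qed.

Let QW p : Q p -> closure Q p. Proof. exact: subset_closure. Qed.

Lemma within_lin (V : normedModType R) (A : set V) (f g : V -> R) c d :
  {within A, continuous f} -> {within A, continuous g} ->
  {within A, continuous (fun p => c * f p + d * g p)}.
Proof.
move=> cf cg x; apply: cvgD; apply: cvgM;
  [exact: cvg_cst|exact: cf|exact: cvg_cst|exact: cg].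
Qed.

Lemma C21_lin u v c d : C21 T u -> C21 T v ->
  let w := fun p => c * u p + d * v p in
  [/\ C21 T w,
      forall i p, closure Q p -> dx T i w p = c * dx T i u p + d * dx T i v p,
      forall i j p, closure Q p -> dx T j (dx T i w) p =
        c * dx T j (dx T i u) p + d * dx T j (dx T i v) p
    & forall p, closure Q p -> dt T w p = c * dt T u p + d * dt T v p].
Proof.
move=> [cu u1 u2 ut] [cv v1 v2 vt] w.
have D1 i := has_pd_lin c d (u1 i) (v1 i).
have D2 i j := has_pd_lin c d (u2 i j) (v2 i j).
have [T1 T2] := has_pd_lin c d ut vt.
have E i p : Q p -> c * dx T i u p + d * dx T i v p = dx T i w p.
  by move=> Qp; exact/esym/(proj2 (D1 i))/QW.
split.
- split.
  + exact: within_lin.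
  + by move=> i; have [] := D1 i.
  + by move=> i j; have [h _] := D2 i j; apply: has_pd_ext oQ (E i) h.
  + exact: T1.
- by move=> i p cp; exact: (proj2 (D1 i)).
- move=> i j p cp; apply: etrans (proj2 (D2 i j) p cp).
  exact: (congr1 (fun h => h p) (esym (pd_ext _ oQ (E i)))).
- exact: T2.
Qed.

Lemma continuous_within_fst b : {within closure (cube n), continuous b} ->
  {within closure Q, continuous (fun q => b q.1)}.
Proof.
move=> /subspace_continuousP cb; apply/subspace_continuousP => -[x t].
rewrite /Q closure_cylinder// => -[/= cx ct] A Ab.
have := cb x; rewrite closure_cube => /(_ cx A Ab) H.
have {}H : nbhs x (fun y => ccube y -> A (b y)) := H.
suff : nbhs (x, t) (fun q => ccyl T q -> A (b q.1)) by [].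
have H2 : nbhs (x, t) (fun q : 'rV[R]_n * R => ccube q.1 -> A (b q.1)).
  exact: (@cvg_fst _ _ (nbhs x) (nbhs t) _ _ H).
by apply: filterS H2 => q qA [/qA].
Qed.

Lemma within_mul (V : normedModType R) (A : set V) (f g : V -> R) :
  {within A, continuous f} -> {within A, continuous g} ->
  {within A, continuous (fun p => f p * g p)}.
Proof. by move=> cf cg x; apply: cvgM; [exact: cf|exact: cg]. Qed.

Lemma within_add (V : normedModType R) (A : set V) (f g : V -> R) :
  {within A, continuous f} -> {within A, continuous g} ->
  {within A, continuous (fun p => f p + g p)}.
Proof. by move=> cf cg x; apply: cvgD; [exact: cf|exact: cg]. Qed.

Lemma within_sum (V : normedModType R) (A : set V) (I : Type) (r : seq I)
    (F : I -> V -> R) :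
  (forall i, {within A, continuous (F i)}) ->
  {within A, continuous (fun p => \sum_(i <- r) F i p)}.
Proof.
move=> cF; elim: r => [|i r IH].
  by under eq_fun do rewrite big_nil; exact: cst_continuous.
by under eq_fun do rewrite big_cons; exact: within_add.
Qed.

Lemma has_pd_mul b f i : C1_cube b -> {within closure Q, continuous f} ->
  has_pd Q (evec i, 0) f ->
  has_pd Q (evec i, 0) (fun q => b q.1 * f q) /\
  forall p, closure Q p -> dx T i (fun q => b q.1 * f q) p =
    pd (cube n) (evec i) b p.1 * f p + b p.1 * dx T i f p.
Proof.
move=> [cb hb] cf hf; have [_ _ cpb] := hb i; have [_ _ cpf] := hf.
apply: has_pdI => [[x t] [/= cx ct]|]; last first.
  exact: (within_add (within_mul (continuous_within_fst cpb) cf)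
    (within_mul (continuous_within_fst cb) cpf)).
have db : is_derive (x, t) ((evec i, 0) : 'rV[R]_n * R)
    (fun q : 'rV[R]_n * R => b q.1) (pd (cube n) (evec i) b x).
  by apply: is_derive_quotient (has_pd_is_derive (hb i) cx).
have df := @has_pd_is_derive _ _ _ _ _ (x, t) hf (conj cx ct).
have D := is_deriveM db df.
by apply: (is_derive_eq D); rewrite /GRing.scale /= addrC [in LHS]mulrC.
Qed.

Section elliptic_operator.
Variables (a : 'I_n -> 'I_n -> 'rV[R]_n -> R).
Hypothesis ha : forall i j, C1_cube (a i j).

Lemma LopE u p : C21 T u -> closure Q p ->
  Lop T a u p = \sum_i \sum_j (pd (cube n) (evec i) (a i j) p.1 * dx T j u p +
    a i j p.1 * dx T i (dx T j u) p).
Proof.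
move=> [cu u1 u2 ut] cp; apply: eq_bigr => i _; apply: eq_bigr => j _.
have [_ _ c1] := u1 j.
by have [_ ->] := has_pd_mul (ha i j) c1 (u2 j i).
Qed.

Lemma continuous_Lop u : C21 T u -> {within closure Q, continuous (Lop T a u)}.
Proof.
move=> [cu u1 u2 ut]; apply: within_sum => i; apply: within_sum => j.
have [_ _ c1] := u1 j.
by have [[]] := has_pd_mul (ha i j) c1 (u2 j i).
Qed.

Lemma Lop_lin u v c d p : C21 T u -> C21 T v -> closure Q p ->
  Lop T a (fun p => c * u p + d * v p) p = c * Lop T a u p + d * Lop T a v p.
Proof.
move=> hu hv cp; have [hw w1 w2 _] := C21_lin c d hu hv.
rewrite !LopE// !mulr_sumr -big_split; apply: eq_bigr => i _.
rewrite !mulr_sumr -big_split; apply: eq_bigr => j _ /=.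
apply: etrans (congr2 (fun x y => pd (cube n) (evec i) (a i j) p.1 * x + a i j p.1 * y)
  (w1 j p cp) (w2 j i p cp)) _.
have X (P A x y x' y' : R) : P * (c * x + d * x') + A * (c * y + d * y') =
    c * (P * x + A * y) + d * (P * x' + A * y') by ring.
exact: X.
Qed.

(** On a side orthogonal to the axis [i] this is the conormal derivative up to sign, so the boundary
    condition speaks of it; the sum over [i] of [div_flux] is L. *)
Definition flux u i (q : 'rV[R]_n * R) : R := \sum_j a i j q.1 * dx T j u q.

Definition div_flux u i (q : 'rV[R]_n * R) : R :=
  \sum_j dx T i (fun q => a i j q.1 * dx T j u q) q.

Lemma continuous_flux u i : C21 T u ->
  {within closure Q, continuous (flux u i)} /\
  {within closure Q, continuous (div_flux u i)}.
Proof.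
move=> [cu u1 u2 ut]; split; apply: within_sum => j; have [_ _ c1] := u1 j.
  by apply: within_mul => //; apply: continuous_within_fst; case: (ha i j).
by have [[]] := has_pd_mul (ha i j) c1 (u2 j i).
Qed.

Lemma is_derive_flux u i p : C21 T u -> Q p ->
  is_derive p ((evec i, 0) : 'rV[R]_n * R) (flux u i) (div_flux u i p).
Proof.
move=> [cu u1 u2 ut] Qp.
have H j : is_derive p ((evec i, 0) : 'rV[R]_n * R)
    (fun q => a i j q.1 * dx T j u q) (dx T i (fun q => a i j q.1 * dx T j u q) p).
  have [_ _ c1] := u1 j; have [h _] := has_pd_mul (ha i j) c1 (u2 j i).
  exact: has_pd_is_derive.
have := is_derive_sum H.
by rewrite (_ : \sum_i0 _ = flux u i)//; apply/funext => q; rewrite fct_sumE.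
Qed.

End elliptic_operator.
End regular_functions.

(** * The ball B(M1) *)

Section ball_of_solutions.
Context {R : realType} (n : nat) (T : R).
Hypothesis T0 : 0 < T.
Implicit Types (u v m : 'rV[R]_n * R -> R) (f : 'rV[R]_n -> R).

Let Q := cylinder n 0 T : set ('rV[R]_n * R).

(** A supremum is governed by its elements only for a nonempty bounded set: the centre of the cube
    and compactness of its closure provide both. *)
Lemma norm_C0_le f M : {within closure (cube n), continuous f} ->
  norm_C0 f <= M <-> forall x, closure (cube n) x -> `|f x| <= M.
Proof.
move=> cf.
have ne : [set `|f x| | x in closure (cube n)] !=set0.
  exists `|f (\row_i 2^-1)|, (\row_i 2^-1) => //; apply: subset_closure => i.
  by rewrite mxE invr_gt0 ltr0n invf_lt1 ?ltr1n.
have cc : compact (closure (cube n) : set 'rV[R]_n).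
  rewrite closure_cube.
  have -> : @ccube R n = [set v | forall i, `[0, 1]%classic (v ord0 i)].
    by apply/seteqP; split => x H i; have := H i; rewrite /= in_itv.
  apply: (@rV_compact R n (fun=> `[0 : R, 1]%classic)) => i.
  exact: segment_compact.
have [B [_ hB]] := compact_bounded (continuous_compact cf cc).
have hub : has_ubound [set `|f x| | x in closure (cube n)].
  exists (B + 1) => _ [x cx <-].
  have B1 : B < B + 1 by rewrite ltrDl.
  by apply: (hB _ B1); exists x.
split=> [h x cx|h].
  by apply: le_trans h; apply: ub_le_sup => //; exists x.
by apply: ge_sup => // _ [x cx <-]; exact: h.
Qed.

Lemma closure_slice x t : closure (cube n) x -> 0 <= t <= T -> closure Q (x, t).
Proof.
by rewrite closure_cube => cx tT; rewrite /Q closure_cylinder.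
Qed.

Lemma within_slice u t : 0 <= t <= T -> {within closure Q, continuous u} ->
  {within closure (cube n), continuous (fun x => u (x, t))}.
Proof.
move=> tT cu; have [cU _] := cb_cyl_clamp T0 cu.
apply: (@subspace_eq_continuous _ _ _ (fun x => (u \o @cyl_clamp _ _ T) (x, t))).
  move=> x /set_mem cx /=; rewrite cyl_clamp_id//.
  by rewrite -closure_cylinder//; exact: closure_slice.
exact/continuous_subspaceT/continuous_slice.
Qed.

(** By [has_pd_slice] the derivatives of a slice are slices of [dx], at the two end times as well.
    The norm thus amounts to pointwise bounds, for which convexity is immediate. *)
Lemma norm_C1_le u t M : 0 <= M -> 0 <= t <= T ->
  {within closure Q, continuous u} -> (forall i, has_pd Q (evec i, 0) u) ->
  norm_C1 (fun x => u (x, t)) <= M <->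
  forall x, closure (cube n) x ->
    `|u (x, t)| <= M /\ forall i, `|dx T i u (x, t)| <= M.
Proof.
move=> M0 tT cu hu.
have cs := within_slice tT cu.
have S i := has_pd_slice T0 cu (hu i) tT.
have cpd i : {within closure (cube n),
    continuous (pd (cube n) (evec i) (fun x => u (x, t)))} by case: (S i) => -[].
split.
  rewrite /norm_C1 ge_max => /andP[/(norm_C0_le _ cs) h0].
  move=> /bigmax_leP[_ h1] x cx; split; first exact: h0.
  move=> i; have /(norm_C0_le _ (cpd i))/(_ x cx) := h1 i isT.
  by rewrite (proj2 (S i) x cx).
move=> H; rewrite /norm_C1 ge_max; apply/andP; split.
  by apply/(norm_C0_le _ cs) => x cx; have [] := H x cx.
apply/bigmax_leP; split => // i _; apply/(norm_C0_le _ (cpd i)) => x cx.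
by rewrite (proj2 (S i) x cx); exact: (proj2 (H x cx)).
Qed.

Lemma norm_C2_le u t M : 0 <= M -> 0 <= t <= T -> C21 T u ->
  norm_C2 (fun x => u (x, t)) <= M <->
  forall x, closure (cube n) x ->
    [/\ `|u (x, t)| <= M, forall i, `|dx T i u (x, t)| <= M
      & forall i j, `|dx T j (dx T i u) (x, t)| <= M].
Proof.
move=> M0 tT [cu u1 u2 _].
have S i := has_pd_slice T0 cu (u1 i) tT.
have c1 i : {within closure Q, continuous (dx T i u)} by case: (u1 i).
have S2 i j := has_pd_slice T0 (c1 i) (u2 i j) tT.
(* The inner derivatives are compared on the open cube, and this determines the outer [pd]
   everywhere. *)
have E i j : pd (cube n) (evec j) (pd (cube n) (evec i) (fun x => u (x, t))) =
    pd (cube n) (evec j) (fun x => dx T i u (x, t)).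
  apply: pd_ext; first exact: open_cube.
  by move=> x cx; apply: (proj2 (S i)); exact: subset_closure.
have cpd i j : {within closure (cube n),
    continuous (pd (cube n) (evec j) (fun x => dx T i u (x, t)))}.
  by case: (S2 i j) => -[].
have N1 := norm_C1_le M0 tT cu u1.
split.
  rewrite /norm_C2 ge_max => /andP[/N1 h1 /bigmax_leP[_ h2]] x cx.
  have [h3 h4] := h1 x cx; split; [exact: h3|exact: h4|move=> i j].
  have /bigmax_leP[_ /(_ j isT)] := h2 i isT.
  rewrite E => /(norm_C0_le _ (cpd i j))/(_ x cx).
  by rewrite (proj2 (S2 i j) x cx).
move=> H; rewrite /norm_C2 ge_max; apply/andP; split.
  by apply/N1 => x cx; have [] := H x cx.
apply/bigmax_leP; split => // i _; apply/bigmax_leP; split => // j _.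
rewrite E; apply/(norm_C0_le _ (cpd i j)) => x cx.
by rewrite (proj2 (S2 i j) x cx); case: (H x cx) => _ _; exact.
Qed.

Lemma convex_norm_le (s A B M : R) : 0 <= s <= 1 -> `|A| <= M -> `|B| <= M ->
  `|s * A + (1 - s) * B| <= M.
Proof.
move=> /andP[s0 s1]; rewrite !ler_norml => /andP[A1 A2] /andP[B1 B2].
have h1 := ler_wpM2l s0 A1; have h2 := ler_wpM2l s0 A2.
have s1' : 0 <= 1 - s by lra.
have h3 := ler_wpM2l s1' B1; have h4 := ler_wpM2l s1' B2.
by apply/andP; split; lra.
Qed.

(** The gradients of F1 and F2 are bounded only at arguments coming from [in_B]; convexity puts the
    whole segment between two solutions there. *)
Lemma in_B_convex M1 u1 m1 u2 m2 s : 0 < M1 -> 0 <= s <= 1 ->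
  in_B T M1 u1 m1 -> in_B T M1 u2 m2 ->
  in_B T M1 (fun p => s * u1 p + (1 - s) * u2 p)
            (fun p => s * m1 p + (1 - s) * m2 p).
Proof.
move=> /ltW M0 s01 [hu1 hm1 bu1 bm1] [hu2 hm2 bu2 bm2].
have [hu du ddu _] := C21_lin s (1 - s) hu1 hu2.
have [hm dm _ _] := C21_lin s (1 - s) hm1 hm2.
split; [exact: hu|exact: hm|move=> t tT|move=> t tT].
- apply/(norm_C2_le M0 tT hu) => x cx.
  have /(norm_C2_le M0 tT hu1)/(_ x cx)[a1 a2 a3] := bu1 t tT.
  have /(norm_C2_le M0 tT hu2)/(_ x cx)[b1 b2 b3] := bu2 t tT.
  have cxt := closure_slice cx tT.
  split => [|i|i j]; first exact: convex_norm_le.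
    by rewrite du//; exact: convex_norm_le.
  by rewrite ddu//; exact: convex_norm_le.
- have [c0 c1 _ _] := hm; have [d0 d1 _ _] := hm1; have [e0 e1 _ _] := hm2.
  apply/(norm_C1_le M0 tT c0 c1) => x cx.
  have /(norm_C1_le M0 tT d0 d1)/(_ x cx)[a1 a2] := bm1 t tT.
  have /(norm_C1_le M0 tT e0 e1)/(_ x cx)[b1 b2] := bm2 t tT.
  have cxt := closure_slice cx tT.
  split => [|i]; first exact: convex_norm_le.
  by rewrite dm//; exact: convex_norm_le.
Qed.

End ball_of_solutions.

(** * Energy identities *)

Section energy.
Context {R : realType} (n : nat) (T : R).
Hypothesis T0 : 0 < T.
Implicit Types (u f g : 'rV[R]_n * R -> R).

Let Q := cylinder n 0 T : set ('rV[R]_n * R).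

(* Clamping makes continuity global, so that no one-sided limits are needed at the
   boundary of the cylinder. *)
Definition ext f : 'rV[R]_n * R -> R := f \o @cyl_clamp R n T.

(** Formed with the clamped extensions so as to be continuous in [t] on the whole line. *)
Definition ip f g t : R := avg (fun x => ext f (x, t) * ext g (x, t)).

Lemma ext_id f p : ccyl T p -> ext f p = f p.
Proof. by move=> cp; rewrite /ext /= cyl_clamp_id. Qed.

Lemma cyl_in x t : cube n x -> 0 < t < T -> Q (x, t).
Proof. by move=> cx tT; split => //=; rewrite in_itv. Qed.

Lemma cyl_ccyl p : Q p -> ccyl T p.
Proof. by move=> Qp; rewrite -closure_cylinder//; exact: subset_closure. Qed.

Lemma ext_cyl f x t : cube n x -> 0 < t < T -> ext f (x, t) = f (x, t).
Proof. by move=> cx tT; apply: ext_id; apply: cyl_ccyl; exact: cyl_in. Qed.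

Lemma is_derive_near_eq (V : normedModType R) (f g : V -> R) x v d :
  {near x, f =1 g} -> is_derive x v f d -> is_derive x v g d.
Proof.
move=> fg [df dv]; split; first exact: near_eq_derivable fg df.
by rewrite -dv; apply/esym/near_eq_derive.
Qed.

Lemma is_derive_difference (f : R -> R) (t d : R) :
  h^-1 * (f (t + h) - f t) @[h --> 0^'] --> d -> is_derive t 1 f d.
Proof.
move=> H.
have C : (fun h : R => h^-1 *: ((f \o shift t) (h *: (1 : R)) - f t)) @ 0^' --> d.
  apply: cvg_trans H; apply: near_eq_cvg; apply: nearW => h /=.
  by rewrite /GRing.scale /= mulr1 [h + t]addrC.
by split; [apply/cvg_ex; exists d|apply: cvg_lim => //; exact: norm_hausdorff].
Qed.

Lemma continuous_ip f g : cb (ext f) -> cb (ext g) -> continuous (ip f g).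
Proof. by move=> cf cg; exact: (avg_continuous (cbM cf cg)). Qed.

Lemma is_derive_ext_time u x t : C21 T u -> cube n x -> 0 < t < T ->
  is_derive t 1 (fun s => ext u (x, s)) (ext (dt T u) (x, t)).
Proof.
move=> [_ _ _ hu] cx tT.
rewrite (ext_cyl _ cx tT).
have d := is_derive_time (has_pd_is_derive hu (cyl_in cx tT)).
apply: is_derive_near_eq d.
have tI : t \in `]0, T[ by rewrite in_itv.
by apply: filterS (near_in_itvoo tI) => s; rewrite in_itv => sT; rewrite ext_cyl.
Qed.

Lemma C21_cb u : C21 T u ->
  [/\ cb (ext u), forall i, cb (ext (dx T i u)) & cb (ext (dt T u))].
Proof.
move=> [cu u1 _ ut]; split => [|i|]; apply: cb_cyl_clamp => //.
  by case: (u1 i).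
by case: ut.
Qed.

Lemma cb_comp_time f t : cb f -> cb (fun q : 'rV[R]_n * R => f (q.1, t)).
Proof.
move=> [cf [M fM]]; split; last by exists M.
move=> p; apply: (@continuous_comp _ _ _ (fun q : 'rV[R]_n * R => (q.1, t)) f);
  last exact: cf.
by apply: (@cvg_nbhs_pair _ _ _ (nbhs p) (nbhs_filter p));
  [exact: cvg_fst|exact: cvg_cst].
Qed.

Lemma is_derive_ip u t : C21 T u -> 0 < t < T ->
  is_derive t 1 (ip u u) (2 * ip u (dt T u) t).
Proof.
move=> hu tT; have [cu _ ct] := C21_cb hu.
apply: is_derive_difference.
(* The difference of the squares at times [t + h] and [t] is [P] at time [t + h] times the increment
   of [u]. *)
pose P q := ext u q + ext u (q.1, t).
have bP : cb P by apply: cbD => //; exact: cb_comp_time.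
have := avg_difference_quotient bP cu ct tT
  (fun x s cx sT => is_derive_ext_time hu cx sT).
have -> : 2 * ip u (dt T u) t = avg (fun x => P (x, t) * ext (dt T u) (x, t)).
  rewrite /ip -avgZ; last by apply: bmfM; exact: cb_bmf.
  by apply: eq_avg => x _; rewrite /P /=; ring.
apply: cvg_trans; apply: near_eq_cvg; apply: nearW => h.
congr (_ * _); rewrite /ip -avgB; try by apply: bmfM; exact: cb_bmf.
by apply: eq_avg => x _; rewrite /P /=; ring.
Qed.

Section elliptic_energy.
Variables (a : 'I_n -> 'I_n -> 'rV[R]_n -> R) (u : 'rV[R]_n * R -> R).
Hypotheses (ha : forall i j, C1_cube (a i j)) (hu : C21 T u).
Hypothesis sa : forall i j x, closure (cube n) x -> a i j x = a j i x.
Hypothesis u0 : forall x t, Gamma0 n x -> 0 < t < T -> u (x, t) = 0.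
Hypothesis u1 : forall i x t, Gamma1 n x -> side i x -> 0 < t < T ->
  conormal T a i u (x, t) = 0.

Definition energy t : R := avg (fun x => \sum_i \sum_j
  ext (fun q => a i j q.1) (x, t) * ext (dx T j u) (x, t) * ext (dx T i u) (x, t)).

Lemma cb_coef i j : cb (ext (fun q => a i j q.1)).
Proof.
by apply: cb_cyl_clamp => //; apply: continuous_within_fst => //; case: (ha i j).
Qed.

Lemma cb_Lop : cb (ext (Lop T a u)).
Proof. by apply: cb_cyl_clamp => //; exact: continuous_Lop. Qed.

Lemma cb_flux i : cb (ext (flux T a u i)) /\ cb (ext (div_flux T a u i)).
Proof.
by have [? ?] := continuous_flux T0 ha i hu; split; exact: cb_cyl_clamp.
Qed.

Lemma cb_energy : cb (fun p => \sum_i \sum_j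
  ext (fun q => a i j q.1) p * ext (dx T j u) p * ext (dx T i u) p).
Proof.
have [_ cd _] := C21_cb hu.
apply: cb_sum => i; apply: cb_sum => j; apply: cbM => //; apply: cbM => //.
exact: cb_coef.
Qed.

Lemma continuous_energy : continuous energy.
Proof. exact: avg_continuous cb_energy. Qed.

Lemma subst_coor_add (x : 'rV[R]_n) i r h :
  subst_coor x i (h + r) = h *: evec i + subst_coor x i r.
Proof.
apply/rowP => j; rewrite !mxE eqxx /=; case: eqP => _.
  by rewrite mulr1.
by rewrite mulr0 add0r.
Qed.

Lemma subst_coor_cube (x : 'rV[R]_n) i r : cube n x -> 0 < r < 1 ->
  cube n (subst_coor x i r).
Proof. by move=> cx r01 j; rewrite mxE; case: ifP. Qed.

Lemma is_derive_ext_line f d i x t r : cube n x -> 0 < t < T -> 0 < r < 1 ->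
  is_derive (subst_coor x i r, t) ((evec i, 0) : 'rV[R]_n * R) f d ->
  is_derive r 1 (fun s => ext f (subst_coor x i s, t)) d.
Proof.
move=> cx tT r01 df.
have d1 : is_derive r 1 (fun s => f (subst_coor x i s, t)) d.
  apply: is_derive_quotient df => h; congr (f _ - _).
  have -> : h *: (1 : R) = h by exact: mulr1.
  by rewrite subst_coor_add; congr pair; rewrite /= scaler0 add0r.
apply: is_derive_near_eq d1.
have rI : r \in `]0, 1[ by rewrite in_itv.
apply: filterS (near_in_itvoo rI) => s; rewrite in_itv => sI.
by rewrite ext_cyl//; exact: subst_coor_cube.
Qed.

(** A coordinate line through an interior point leaves the cube through the relative interior of two
    sides, away from the edges. At one end the flux vanishes; at the other, [u] vanishes if that end
    is in [Gamma0], and the flux otherwise. As either factor may be the vanishing one, the two may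
    be taken at different times. *)
Lemma flux_boundary i x t : cube n x -> 0 < t < T ->
  (forall s, 0 < s < T -> u (subst_coor x i 1, s) * flux T a u i (subst_coor x i 1, t) = 0) /\
  flux T a u i (subst_coor x i 0, t) = 0.
Proof.
move=> cx tT.
have cl c : 0 <= c <= 1 -> closure (cube n) (subst_coor x i c).
  rewrite closure_cube => c01 j; rewrite mxE; case: ifP => // _.
  by have /andP[/ltW -> /ltW ->] := cx j.
have Sd c : c = 0 \/ c = 1 -> side i (subst_coor x i c).
  move=> hc; split; first by rewrite mxE eqxx.
  by move=> j ji; rewrite mxE (negbTE ji).
have nint c : c = 0 \/ c = 1 -> ~ (interior (cube n)) (subst_coor x i c).
  move=> hc /interior_subset /(_ i); rewrite mxE eqxx.
  by case: hc => ->; rewrite ltxx ?andbF.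
have fl c : c = 0 \/ c = 1 -> Gamma1 n (subst_coor x i c) ->
    flux T a u i (subst_coor x i c, t) = 0.
  move=> hc G1; have := u1 G1 (Sd c hc) tT.
  rewrite /conormal /flux /= -mulr_suml => /eqP; rewrite mulf_eq0 => /orP[/eqP //|].
  by rewrite /cos_normal; case: ifP; rewrite ?oppr_eq0 oner_eq0.
have G10 : Gamma1 n (subst_coor x i 0).
  split; first by split; [apply: cl; rewrite lexx ler01|apply: nint; left].
  move=> /(_ i); rewrite mxE eqxx; case: ifP => _; last by rewrite ltxx.
  by move=> /eqP; rewrite eq_sym oner_eq0.
split; last by apply: fl => //; left.
move=> s sT; have [i0|i0] := eqVneq (i : nat) 0%N.
  rewrite u0 ?mul0r// => j; rewrite mxE -(inj_eq val_inj) /= i0.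
  by case: (eqVneq (j : nat) 0%N) => // _; exact: (cx j).
rewrite fl ?mulr0//; first by right.
split; first by split; [apply: cl; rewrite lexx ler01|apply: nint; right].
by move=> /(_ i); rewrite mxE eqxx (negbTE i0) ltxx andbF.
Qed.

(** The divergence theorem, one direction at a time: averaging along the axis [i] does not change
    the cube average, and on each line the integrand is the derivative of [u] at time [s] times the
    flux at time [t], whose end values vanish. The two separate times are what [ip_Lop_sym]
    needs. *)
Lemma avg_div_flux i s t : 0 < s < T -> 0 < t < T ->
  avg (fun x => ext u (x, s) * ext (div_flux T a u i) (x, t)
              + ext (flux T a u i) (x, t) * ext (dx T i u) (x, s)) = 0.
Proof.
move=> sT tT; have [cu cd _] := C21_cb hu; have [cfl cdf] := cb_flux i.
set h : 'rV[R]_n -> R := fun x => _.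
have ch : cb (fun q : 'rV[R]_n * R => h q.1).
  by apply: cbD; apply: cbM; exact: cb_comp_time.
have [cch [M hM]] := ch.
have mh : measurable_fun setT h.
  exact: (measurableT_comp (continuous_measurable_rV cch)
    (measurable_fun_pair (@measurable_id _ _ _) (measurable_cst (0 : measurableTypeR R)))).
have [_ <-] := avg_integral_subst_coor i mh (ex_intro _ M (fun x => hM (x, 0))).
rewrite -[RHS](@avg_cst R n 0); apply: eq_avg => x cx.
have cs f r : cb (ext f) -> continuous (fun s => ext f (subst_coor x i s, r)).
  move=> [cf _] q.
  apply: (@continuous_comp _ _ _ (fun s => subst_coor x i s) (fun y => ext f (y, r))).
    exact: continuous_subst_coor.
  exact: continuous_slice.
apply: (etrans (@integral01_FTC R (fun r => ext u (subst_coor x i r, s) *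
    ext (flux T a u i) (subst_coor x i r, t)) (fun r => h (subst_coor x i r)) _ _ _)).
- by move=> r; apply: cvgM; exact: cs.
- by move=> r; apply: cvgD; apply: cvgM; exact: cs.
- move=> r r01; have cr := subst_coor_cube i cx r01.
  have [_ d1 _ _] := hu.
  have e1 := is_derive_ext_line cx sT r01 (has_pd_is_derive (d1 i) (cyl_in cr sT)).
  have e2 := is_derive_ext_line cx tT r01 (is_derive_flux T0 ha i hu (cyl_in cr tT)).
  apply: (is_derive_eq (is_deriveM e1 e2)); rewrite /GRing.scale /= /h.
  by rewrite !ext_cyl.
- have [b1 b0] := flux_boundary i cx tT.
  have cc c r : 0 <= c <= 1 -> 0 < r < T -> ccyl T (subst_coor x i c, r).
    move=> c01 rT; split; last by rewrite /= in_itv /=; case/andP: rT => /ltW -> /ltW ->.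
    move=> j; rewrite mxE; case: ifP => // _.
    by have /andP[/ltW -> /ltW ->] := cx j.
  rewrite !ext_id; try (by apply: cc => //; rewrite lexx ler01).
  by rewrite b1// b0 mulr0 subr0.
Qed.

Lemma ip_Lop s t : 0 < s < T -> 0 < t < T ->
  avg (fun x => ext u (x, s) * ext (Lop T a u) (x, t)) =
  - avg (fun x => \sum_i ext (flux T a u i) (x, t) * ext (dx T i u) (x, s)).
Proof.
move=> sT tT; have [cu cd _] := C21_cb hu.
have b1 i : bmf (fun x => ext u (x, s) * ext (div_flux T a u i) (x, t)).
  by apply: bmfM; apply: cb_bmf => //; case: (cb_flux i).
have b2 i : bmf (fun x => ext (flux T a u i) (x, t) * ext (dx T i u) (x, s)).
  by apply: bmfM; apply: cb_bmf => //; case: (cb_flux i).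
rewrite (@eq_avg _ _ _ (fun x => \sum_i ext u (x, s) * ext (div_flux T a u i) (x, t)));
  last first.
  by move=> x _; rewrite -mulr_sumr.
rewrite !avg_sum// -sumrN; apply: eq_bigr => i _.
by apply/eqP; rewrite -subr_eq0 opprK -avgD//; apply/eqP; exact: avg_div_flux.
Qed.

Lemma flux_sym p q : p.1 = q.1 ->
  \sum_i ext (flux T a u i) p * ext (dx T i u) q =
  \sum_i ext (flux T a u i) q * ext (dx T i u) p.
Proof.
move=> pq.
have E (r r' : 'rV[R]_n * R) : \sum_i ext (flux T a u i) r * ext (dx T i u) r' =
    \sum_i \sum_j ext (fun q => a i j q.1) r * ext (dx T j u) r * ext (dx T i u) r'.
  by apply: eq_bigr => i _; rewrite mulr_suml.
have X (A : 'I_n -> 'I_n -> R) (d e : 'I_n -> R) :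
    \sum_i \sum_j A i j * d j * e i = \sum_i \sum_j A j i * d i * e j.
  exact: exchange_big.
apply: (etrans (E p q)); apply: (etrans _ (esym (E q p))).
apply: (etrans (X (fun i j => ext (fun q => a i j q.1) p)
  (fun j => ext (dx T j u) p) (fun i => ext (dx T i u) q))).
apply: eq_bigr => i _; apply: eq_bigr => j _.
have -> : ext (fun q => a j i q.1) p = ext (fun q => a i j q.1) q.
  rewrite /ext /= pq; apply: sa; rewrite closure_cube => k.
  by rewrite mxE; exact: clamp_itv.
exact: mulrAC.
Qed.

Lemma ip_Lop_sym s t : 0 < s < T -> 0 < t < T ->
  avg (fun x => ext u (x, s) * ext (Lop T a u) (x, t)) =
  avg (fun x => ext u (x, t) * ext (Lop T a u) (x, s)).
Proof.
move=> sT tT; apply: (etrans (ip_Lop sT tT)); apply: (etrans _ (esym (ip_Lop tT sT))).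
apply: (congr1 -%R); apply: eq_avg => x _.
exact: (@flux_sym (x, t) (x, s) erefl).
Qed.

Lemma energyE t : 0 < t < T -> energy t = - ip u (Lop T a u) t.
Proof.
move=> tT; apply: (etrans _ (congr1 -%R (esym (ip_Lop tT tT)))); rewrite opprK.
apply: eq_avg => x _.
by apply: eq_bigr => i _; rewrite mulr_suml.
Qed.

(* Symmetry of L gives E(t) - E(s) = - (u(t) - u(s), Lu(t) + Lu(s)), so the mixed
   derivatives u_{xt}, which need not exist, do not enter. *)
Lemma is_derive_energy t : 0 < t < T ->
  is_derive t 1 energy (- 2 * ip (Lop T a u) (dt T u) t).
Proof.
move=> tT; have [cu _ ct] := C21_cb hu; have cL := cb_Lop.
apply: is_derive_difference.
pose P q := - (ext (Lop T a u) q + ext (Lop T a u) (q.1, t)).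
have bP : cb P := cbN (cbD cL (cb_comp_time t cL)).
have := avg_difference_quotient bP cu ct tT
  (fun x s cx sT => is_derive_ext_time hu cx sT).
have -> : - 2 * ip (Lop T a u) (dt T u) t =
    avg (fun x => P (x, t) * ext (dt T u) (x, t)).
  rewrite /ip -avgZ; last by apply: bmfM; exact: cb_bmf.
  by apply: eq_avg => x _; rewrite /P /=; ring.
apply: cvg_trans; apply: near_eq_cvg.
(* [energyE] and [ip_Lop_sym] are available only at times inside (0, T). *)
have : \forall h \near 0^', 0 < t + h < T.
  have tI : t \in `]0, T[ by rewrite in_itv.
  have /nbhs_ballP[e /= e0 eI] := near_in_itvoo tI.
  apply/nbhs_dnbhs; exists e => //= h /=; rewrite sub0r normrN => he.
  have := eI (t + h); rewrite /ball /= opprD addNKr normrN => /(_ he).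
  by rewrite in_itv.
apply: filterS => h hT; congr (_ * _).
have S := ip_Lop_sym hT tT.
rewrite (energyE hT) (energyE tT) /ip opprK.
have bm s r : bmf (fun x => ext u (x, s) * ext (Lop T a u) (x, r)).
  by apply: bmfM; exact: cb_bmf.
transitivity (- (avg (fun x => ext u (x, t + h) * ext (Lop T a u) (x, t + h))
   + avg (fun x => ext u (x, t + h) * ext (Lop T a u) (x, t))
   - avg (fun x => ext u (x, t) * ext (Lop T a u) (x, t + h))
   - avg (fun x => ext u (x, t) * ext (Lop T a u) (x, t)))).
  have bA := bm (t + h) (t + h); have bB := bm (t + h) t.
  have bC := bm t (t + h); have bE := bm t t.
  rewrite -(avgD bA bB) -(avgB (bmfD bA bB) bC) -(avgB (bmfB (bmfD bA bB) bC) bE).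
  rewrite -(avgN (bmfB (bmfB (bmfD bA bB) bC) bE)).
  apply: eq_avg => x _; rewrite /P /=.
  move: (ext u (x, t + h)) (ext u (x, t)) (ext (Lop T a u) (x, t + h))
    (ext (Lop T a u) (x, t)) => *; ring.
have H (A B C E : R) : B = C -> - (A + B - C - E) = - A + E by move=> ->; ring.
exact: H.
Qed.

End elliptic_energy.
End energy.

(** * Lipschitz bounds for the nonlinearities *)

Section directional_derivatives.
Context {R : realType}.

Lemma is_derive_epsP (V : normedModType R) (f : V -> R) x v d :
  is_derive x v f d <->
  (forall e, 0 < e -> exists2 r, 0 < r &
     forall h, `|h| < r -> `|f (h *: v + x) - f x - h * d| <= e * `|h|).
Proof.
split=> [[df dv] e e0|H]; last first.
  apply: is_derive_cvg => e e0; have [r r0 hr] := H e e0.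
  by apply/nbhs_dnbhs; exists r => //= h /=; rewrite sub0r normrN; exact: hr.
have : (fun h : R => h^-1 *: ((f \o shift x) (h *: v) - f x)) @ 0^' --> d.
  by rewrite -dv; exact: df.
move/cvgrPdist_le => /(_ e e0)[r /= r0 hr]; exists r => // h hlt.
have [->|h0] := eqVneq h 0.
  by rewrite scale0r add0r subrr mul0r subr0 normr0 mulr0.
have := hr h; rewrite /= sub0r normrN => /(_ hlt h0).
rewrite distrC -(ler_pM2r (_ : 0 < `|h|)) ?normr_gt0// -normrM mulrBl.
by rewrite /= /GRing.scale /= mulrAC mulVf// mul1r [d * h]mulrC.
Qed.

Lemma is_derive_dirZ (V : normedModType R) (f : V -> R) x v d c :
  is_derive x v f d -> is_derive x (c *: v) f (c * d).
Proof.
move=> /is_derive_epsP H; apply/is_derive_epsP => e e0.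
have c0 : 0 < `|c| + 1 by rewrite ltr_wpDl.
have [r r0 hr] := H (e / (`|c| + 1)) (divr_gt0 e0 c0).
exists (r / (`|c| + 1)) => [|h hh]; first exact: divr_gt0.
have hc : `|h * c| <= `|h| * (`|c| + 1) by rewrite normrM ler_wpM2l// lerDl.
have := hr (h * c); rewrite -scalerA mulrA => /(_ _)/le_trans; apply.
  by rewrite (le_lt_trans hc)// -ltr_pdivlMr.
by rewrite mulrAC ler_pdivrMr// -mulrA ler_wpM2l// ltW.
Qed.

(** Directional derivatives need not add up in general. Here the second leg, along [w], is handled
    by the mean value theorem, and continuity of [dw] lets its value at [x] replace that at the
    intermediate point. *)
Lemma is_derive_dirD (V : normedModType R) (f : V -> R) x v w dv (dw : V -> R) :
  is_derive x v f dv -> (forall y, is_derive y w f (dw y)) -> continuous dw ->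
  is_derive x (v + w) f (dv + dw x).
Proof.
move=> /is_derive_epsP Hv Hw cw; apply/is_derive_epsP => e e0.
have e20 : 0 < e / 2 by rewrite divr_gt0.
have [r1 r10 h1] := Hv _ e20.
have [r2 /= r20 h2] : nbhs_ball x (fun y => `|dw x - dw y| < e / 2).
  by apply/nbhs_ballP; move/cvgrPdist_lt : (cw x); exact.
have N0 : 0 < `|v| + `|w| + 1 by rewrite ltr_wpDl// addr_ge0.
(* The second entry ensures that [h *: v + x + s *: w] stays within [r2] of [x] as long as [|h|] and
   [|s|] are below it. *)
pose r := Num.min r1 (r2 / (`|v| + `|w| + 1)).
exists r => [|h]; first by rewrite lt_min r10 divr_gt0.
rewrite lt_min => /andP[hr1 hr2].
have close s : `|s| < r2 / (`|v| + `|w| + 1) ->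
    `|dw (h *: v + x + s *: w) - dw x| <= e / 2.
  move=> hs; rewrite distrC ltW//; apply: h2.
  rewrite -ball_normE /ball_ /= [h *: v + x]addrC -addrA opprD addNKr normrN.
  rewrite (le_lt_trans (ler_normD _ _))// !normrZ.
  have a1 : `|h| * `|v| <= r2 / (`|v| + `|w| + 1) * `|v|.
    by apply: ler_wpM2r => //; exact: ltW.
  have a2 : `|s| * `|w| <= r2 / (`|v| + `|w| + 1) * `|w|.
    by apply: ler_wpM2r => //; exact: ltW.
  have a3 : 0 < r2 / (`|v| + `|w| + 1) by exact: divr_gt0.
  have a4 : r2 / (`|v| + `|w| + 1) * (`|v| + `|w| + 1) = r2.
    by rewrite mulfVK// gt_eqF.
  by rewrite !mulrDr mulr1 in a4; lra.
pose q := r2 / (`|v| + `|w| + 1).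
pose F s := f (h *: v + x + s *: w) - s * dw x.
have qr s : - q < s < q -> `|s| < q by rewrite ltr_norml.
have L : `|F h - F 0| <= e / 2 * `|h - 0|.
  apply: (@derive_bound_lipschitz R F (fun s => dw (h *: v + x + s *: w) - dw x) (- q) q).
  - move=> s _; have dl : is_derive s 1 (fun s : R => s * dw x) (dw x).
      by apply: is_derive_eq; rewrite /GRing.scale /= mulr0 mulr1 add0r.
    exact: (is_deriveB (is_derive_line (Hw _)) dl).
  - by move=> s /qr; exact: close.
  - by rewrite oppr_lt0 divr_gt0.
  - by rewrite -ltr_norml.
rewrite subr0 /F scale0r addr0 mul0r subr0 in L.
have -> : h *: (v + w) + x = h *: v + x + h *: w.
  by rewrite scalerDr addrAC.
have -> : f (h *: v + x + h *: w) - f x - h * (dv + dw x) =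
  (f (h *: v + x + h *: w) - h * dw x - f (h *: v + x)) +
  (f (h *: v + x) - f x - h * dv) by ring.
rewrite (le_trans (ler_normD _ _))//.
have -> : e * `|h| = e / 2 * `|h| + e / 2 * `|h| by field.
by apply: lerD L _; exact: h1.
Qed.

Lemma C1_whole_derive N (F : 'rV[R]_N -> R) z d : C1_whole F ->
  is_derive z d F (\sum_i d ord0 i * 'D_(evec i) F z).
Proof.
move=> CF.
have DF i y : is_derive y (evec i) F ('D_(evec i) F y).
  by have [dF _] := CF i; split; [exact: dF|].
have cF (r : seq 'I_N) : continuous (fun y => \sum_(i <- r) d ord0 i * 'D_(evec i) F y).
  elim: r => [|i r IH].
    rewrite (_ : (fun _ => _) = cst 0); first exact: cst_continuous.
    by apply/funext => y; rewrite big_nil.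
  rewrite (_ : (fun _ => _) = (fun y => d ord0 i * 'D_(evec i) F y +
      \sum_(j <- r) d ord0 j * 'D_(evec j) F y)); last first.
    by apply/funext => y; rewrite big_cons.
  move=> y; apply: (@cvgD _ _ _ (nbhs y) _ _ _ _ _ _ (IH y)).
  exact: (@cvgM _ _ (nbhs y) _ (cst (d ord0 i)) _ _ _ (cvg_cst _) (proj2 (CF i) y)).
have H (r : seq 'I_N) y : is_derive y (\sum_(i <- r) d ord0 i *: evec i) F
    (\sum_(i <- r) d ord0 i * 'D_(evec i) F y).
  elim: r y => [|i r IH] y.
    rewrite !big_nil; apply/is_derive_epsP => e e0; exists 1 => // h _.
    by rewrite scaler0 add0r subrr mulr0 subr0 normr0 mulr_ge0// ltW.
  rewrite !big_cons; apply: (is_derive_dirD _ IH); last exact: cF.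
  exact: is_derive_dirZ.
by have := H (index_enum 'I_N) z; rewrite -row_sum_delta.
Qed.

Lemma hat_grad_le k l (F : 'rV[R]_(k + l) -> R) z i :
  `|'D_(evec (lshift l i)) F z| <= enorm (hat_grad F z).
Proof.
rewrite -sqrtr_sqr; apply: ler_wsqrtr.
rewrite (bigD1 i)//= /hat_grad !mxE lerDl.
by apply: sumr_ge0 => j _; exact: sqr_ge0.
Qed.

(** The mean value theorem produces a real parameter while the gradient is bounded at rational ones;
    continuity of the partial derivatives bridges the gap. The last [l] components agree, so only
    the derivatives collected in [hat_grad] remain. *)
Lemma C1_whole_diff_le k l (F : 'rV[R]_(k + l) -> R)
    (z1 z2 : 'rV[R]_(k + l)) (M : R) : C1_whole F ->
  (forall j, z1 ord0 (rshift k j) = z2 ord0 (rshift k j)) ->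
  (forall q : rat, 0 <= (ratr q : R) <= 1 ->
     enorm (hat_grad F (ratr q *: z1 + (1 - ratr q) *: z2)) <= M) ->
  `|F z1 - F z2| <= M * \sum_i `|z1 ord0 (lshift l i) - z2 ord0 (lshift l i)|.
Proof.
move=> CF zr hM.
pose g s := F (z2 + s *: (z1 - z2)).
pose dg s := \sum_i (z1 - z2) ord0 i * 'D_(evec i) F (z2 + s *: (z1 - z2)).
have dgE (s : R) : is_derive s 1 g (dg s).
  by apply: is_derive_line; exact: C1_whole_derive.
have cg : {within `[0 : R, 1], continuous g}.
  by apply: derivable_within_continuous => s _; case: (dgE s).
have [c] := @MVT R g dg 0 1 ltr01 (fun s _ => dgE s) cg.
rewrite in_itv /= => /andP[c0 c1].
rewrite subr0 mulr1 /g scale1r scale0r addr0 => E.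
have -> : F z1 - F z2 = dg c by rewrite -E; congr (F _ - _); rewrite addrC subrK.
rewrite /dg big_split_ord /= [X in _ + X]big1 ?addr0; last first.
  by move=> j _; rewrite !mxE zr subrr mul0r.
rewrite (le_trans (ler_norm_sum _ _ _))// mulr_sumr; apply: ler_sum => i _.
rewrite !mxE normrM mulrC; apply: ler_wpM2r => //.
(* A violation at [c] is strict, so it persists at a rational parameter slightly above [c]. *)
rewrite leNgt; apply/negP => Mlt.
have [_ cD] := CF (lshift l i).
have cl : continuous (fun s : R => `|'D_(evec (lshift l i)) F (z2 + s *: (z1 - z2))|).
  move=> s; apply: cvg_norm.
  apply: (@continuous_comp _ _ _ (fun s : R => z2 + s *: (z1 - z2))
    ('D_(evec (lshift l i)) F)); last exact: cD.
  exact: (@cvgD _ _ _ (nbhs s) _ (cst z2) (fun s : R => s *: (z1 - z2)) _ _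
    (cvg_cst _) (@cvgZr_tmp _ _ _ (nbhs s) _ id s (z1 - z2) (@cvg_id _ (nbhs s)))).
have [e /= e0 eM] : nbhs_ball c
    (fun s : R => M < `|'D_(evec (lshift l i)) F (z2 + s *: (z1 - z2))|).
  apply/nbhs_ballP; exact: (cvgr_gt _ (cl c) _ Mlt).
have : c < Num.min 1 (c + e) by rewrite lt_min c1 ltrDl.
move=> /rat_in_itvoo[q]; rewrite in_itv /= lt_min => /and3P[cq q1 qe].
have := eM (ratr q); rewrite /ball /= distrC ger0_norm ?subr_ge0 1?ltW//.
rewrite ltrBlDl => /(_ qe); apply/negP; rewrite -leNgt.
apply: (le_trans (hat_grad_le _ _ _)).
have -> : z2 + ratr q *: (z1 - z2) = ratr q *: z1 + (1 - ratr q) *: z2.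
  by rewrite scalerBr scalerBl scale1r addrCA.
by apply: hM; rewrite !ltW// (lt_trans c0).
Qed.

End directional_derivatives.

(** * Null sets and their slices *)

Section almost_everywhere.
Context {R : realType}.

Lemma ge0_integral_eq0_ae d (T : measurableType d) (mu : {measure set T -> \bar R})
    (D : set T) (f : T -> \bar R) : measurable D -> measurable_fun D f ->
  (forall x, 0 <= f x)%E -> (\int[mu]_(x in D) f x = 0)%E ->
  {ae mu, forall x, D x -> f x = 0%E}.
Proof.
move=> mD mf f0 If; apply: (iffLR (ae_eq_integral_abs mu mD mf)).
by rewrite -[RHS]If; apply: eq_integral => x _; rewrite gee0_abs.
Qed.

(** Tonelli for the indicator of a null set: the measures of its time slices integrate to zero,
    hence vanish for almost every [t]. *)
Lemma ae_time_slice n (P : 'rV[R]_n * R -> Prop) : ae_cyl P ->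
  {ae lebesgue_measure, forall t : measurableTypeR R,
     {ae lebesgue_rV R n, forall x, P (x, t)}}.
Proof.
move=> [N [mN N0 PN]].
pose f : 'rV[R]_n * measurableTypeR R -> \bar R := EFin \o \1_N.
have mf : measurable_fun setT f by apply/measurable_EFinP; exact: measurable_indic.
have f0 x : (0 <= f x)%E by rewrite lee_fin.
have I0 : (\int[lebesgue_measure]_y
    fubini_G (lebesgue_rV R n) f y = 0)%E.
  rewrite -(fubini_tonelli2 (m1 := lebesgue_rV R n) f mf f0).
  by rewrite /f integral_indic// setIT.
have mG := measurable_fun_fubini_tonelli_G (m1 := lebesgue_rV R n) f mf f0.
have G0 y : (0 <= fubini_G (lebesgue_rV R n) f y)%E by exact: integral_ge0.
have := ge0_integral_eq0_ae measurableT mG G0 I0.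
apply: filterS => t /(_ I) Gt.
have mft : measurable_fun setT (fun x : 'rV[R]_n => f (x, t)).
  exact: (measurableT_comp mf
    (measurable_fun_pair (@measurable_id _ _ _) (measurable_cst (t : measurableTypeR R)))).
have := ge0_integral_eq0_ae measurableT mft (fun x => f0 (x, t)) Gt.
apply: filterS => x /(_ I) /eqP; rewrite /f /= eqe indicE => h.
apply: contrapT => nP; move: h; rewrite mem_set ?oner_eq0//.
exact: (PN (x, t)).
Qed.

(** By [ge0_integral_subst_coor] the lengths of the traces of a null set on the lines in direction
    [i] have average zero over the cube, so almost all of them vanish. *)
Lemma ae_line n (P : 'rV[R]_n -> Prop) : {ae lebesgue_rV R n, forall x, P x} ->
  {ae lebesgue_rV R n, forall x, cube n x -> forall i,
     {ae lebesgue_measure, forall s : measurableTypeR R, s \in `]0, 1[ ->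
        P (subst_coor x i s)}}.
Proof.
move=> [N [mN N0 PN]].
have H i : {ae lebesgue_rV R n, forall x, cube n x ->
     {ae lebesgue_measure, forall s : measurableTypeR R, s \in `]0, 1[ ->
        P (subst_coor x i s)}}.
  pose f : 'rV[R]_n -> \bar R := EFin \o \1_N.
  have mf : measurable_fun setT f by apply/measurable_EFinP; exact: measurable_indic.
  have f0 x : (0 <= f x)%E by rewrite lee_fin.
  have mg := measurable_integral_subst_coor i mf f0.
  have E := ge0_integral_subst_coor i mf f0.
  have I0 : (\int[lebesgue_rV R n]_(x in cube n) f x = 0)%E.
    rewrite /f integral_indic//; last exact: measurable_cube.
    by apply/eqP; rewrite -measure_le0 -N0 le_measure// inE//;
      apply: measurableI => //; exact: measurable_cube.
  have g0 (x : 'rV[R]_n) : (0 <= \int[lebesgue_measure]_(s in `]0%R, 1%R[)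
    f (subst_coor x i s))%E by exact: integral_ge0.
  have := ge0_integral_eq0_ae (@measurable_cube _ n) (measurable_funTS mg) g0
    (etrans E I0).
  apply: filterS => x H cx; have {}H := H cx.
  have mfx : measurable_fun (`]0, 1[ : set (measurableTypeR R))
      (fun s => f (subst_coor x i s)).
    have mN1 : measurable_fun setT (\1_N : 'rV[R]_n -> R) by exact: measurable_indic.
    suff : measurable_fun (`]0, 1[ : set (measurableTypeR R))
        (EFin \o (fun s => \1_N (subst_coor x i s) : R)) by [].
    apply/measurable_EFinP; apply: measurable_funTS.
    exact: (measurable_subst_coor_r x i mN1).
  have mI : measurable (`]0, 1[ : set (measurableTypeR R)) by exact: measurable_itv.
  have := ge0_integral_eq0_ae mI mfx (fun s => f0 _) H.
  apply: filterS => s Hs s01; have := Hs s01; move=> /eqP; rewrite /f /= eqe indicE => h.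
  apply: contrapT => nP; move: h; rewrite mem_set ?oner_eq0//.
  exact: (PN (subst_coor x i s)).
have G : {ae lebesgue_rV R n, forall x, forall i, cube n x ->
     {ae lebesgue_measure, forall s : measurableTypeR R, s \in `]0, 1[ ->
        P (subst_coor x i s)}} by exact: filter_forall.
by apply: filterS G => x Hx cx i; exact: Hx.
Qed.

Lemma ae_Linfty_norm n (K : 'rV[R]_n -> R) M : (Linfty_norm K <= M%:E)%E ->
  {ae lebesgue_rV R n, forall x, cube n x -> `|K x| <= M}.
Proof.
rewrite /Linfty_norm unlock /=; case: ifPn => [_ /ess_supP|].
  apply: filterS => x; rewrite /= lee_fin => + cx.
  by rewrite indicE mem_set// mulr1.
(* The norm is 0 by convention on a space of measure 0; this case is excluded since the cube has
   measure 1. *)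
move=> /negP[].
apply: (@lt_le_trans _ _ (lebesgue_rV R n (cube n))).
  exact: (eq_ind_r (fun z => 0 < z)%E (@lte01 R) (lebesgue_rV_cube n)).
by apply: le_measure => //; rewrite inE; [exact: measurable_cube|exact: measurableT].
Qed.

Lemma ae_ratr d (T : measurableType d) (mu : {measure set T -> \bar R})
    (D : set rat) (P : rat -> T -> Prop) :
  (forall q, D q -> {ae mu, forall x, P q x}) ->
  {ae mu, forall x, forall q, D q -> P q x}.
Proof.
move=> H.
have := @ae_foralln _ _ R mu (fun k x => forall q, D q -> pickle q = k -> P q x).
move=> /(_ _)/filterS; apply => [x Hx q Dq|k]; first exact: (Hx (pickle q)).
have [[q [Dq qk]]|nq] := pselect (exists q, D q /\ pickle q = k).
  by apply: filterS (H q Dq) => x Px q' Dq' q'k;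
    rewrite (_ : q' = q)//; apply: (pcan_inj pickleK); rewrite q'k.
by apply: aeW => x q Dq qk; exfalso; apply: nq; exists q.
Qed.

End almost_everywhere.

(** * Pointwise inequalities for the difference of two solutions *)

Section system_inequalities.
Context {R : realType}.

Lemma sum_row_mx_diff p q (A A' : 'rV[R]_p) (B B' : 'rV[R]_q) :
  \sum_i `|row_mx A B ord0 i - row_mx A' B' ord0 i| =
  \sum_i `|A ord0 i - A' ord0 i| + \sum_i `|B ord0 i - B' ord0 i|.
Proof.
rewrite big_split_ord /=; congr (_ + _); apply: eq_bigr => i _.
  by rewrite !row_mxEl.
by rewrite !row_mxEr.
Qed.

Lemma sum_scalar_diff (c c' : R) :
  \sum_i `|(c%:M : 'rV[R]_1) ord0 i - (c'%:M : 'rV[R]_1) ord0 i| = `|c - c'|.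
Proof. by rewrite big_ord1 !mxE eqxx !mulr1n. Qed.

Lemma lin_row_mx p q (A A' : 'rV[R]_p) (B B' : 'rV[R]_q) (s r : R) :
  s *: row_mx A B + r *: row_mx A' B' =
  row_mx (s *: A + r *: A') (s *: B + r *: B').
Proof. by rewrite !scale_row_mx add_row_mx. Qed.

Lemma lin_scalar (s r c c' : R) :
  s *: (c%:M : 'rV[R]_1) + r *: (c'%:M : 'rV[R]_1) = (s * c + r * c')%:M.
Proof. by rewrite !scale_scalar_mx -raddfD. Qed.

Lemma sqr_sum5 (a b c d e : R) :
  (a + b + c + d + e) ^+ 2 <= 5 * (a ^+ 2 + b ^+ 2 + c ^+ 2 + d ^+ 2 + e ^+ 2).
Proof.
have := sqr_ge0 (a - b); have := sqr_ge0 (a - c); have := sqr_ge0 (a - d).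
have := sqr_ge0 (a - e); have := sqr_ge0 (b - c); have := sqr_ge0 (b - d).
have := sqr_ge0 (b - e); have := sqr_ge0 (c - d); have := sqr_ge0 (c - e).
have := sqr_ge0 (d - e); lra.
Qed.

(** Cauchy-Schwarz through Lagrange's identity: expand the double sum of [(f i - f j) ^+ 2], which
    is nonnegative. *)
Lemma sqr_sum_ord n (f : 'I_n -> R) :
  (\sum_i f i) ^+ 2 <= n%:R * \sum_i f i ^+ 2.
Proof.
have H : 0 <= \sum_i \sum_j (f i - f j) ^+ 2.
  by apply: sumr_ge0 => i _; apply: sumr_ge0 => j _; exact: sqr_ge0.
have cst (c : R) : \sum_(i < n) c = n%:R * c by rewrite sumr_const card_ord mulr_natl.
have E : \sum_i \sum_j (f i - f j) ^+ 2 =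
    2 * (n%:R * \sum_i f i ^+ 2 - (\sum_i f i) ^+ 2).
  transitivity (\sum_i (n%:R * f i ^+ 2 + (- 2 * \sum_j f j) * f i + \sum_j f j ^+ 2)).
    apply: eq_bigr => i _.
    transitivity (\sum_j (f i ^+ 2 + (- 2 * f i) * f j + f j ^+ 2)).
      by apply: eq_bigr => j _; ring.
    rewrite !big_split /= (cst (f i ^+ 2)).
    rewrite (_ : \sum_j _ * f j = (- 2 * f i) * \sum_j f j); last by rewrite mulr_sumr.
    ring.
  rewrite !big_split /= (cst (\sum_i f i ^+ 2)).
  rewrite (_ : \sum_i _ * f i ^+ 2 = n%:R * \sum_i f i ^+ 2); last by rewrite mulr_sumr.
  rewrite (_ : \sum_i (- 2 * \sum_j f j) * f i = (- 2 * \sum_j f j) * \sum_j f j); last by rewrite -mulr_sumr.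
  ring.
by rewrite E in H; lra.
Qed.

Lemma congr_add5 (a b c d e a' b' c' d' e' : R) :
  a = a' -> b = b' -> c = c' -> d = d' -> e = e' ->
  a + b + c + d + e = a' + b' + c' + d' + e'.
Proof. by move=> -> -> -> -> ->. Qed.

Lemma lin_rowE k (A B : 'rV[R]_k) (s r : R) i :
  (s *: A + r *: B) ord0 i = s * A ord0 i + r * B ord0 i.
Proof. by rewrite !mxE. Qed.

Lemma congr_add4 (a b c d a' b' c' d' : R) :
  a = a' -> b = b' -> c = c' -> d = d' -> a + b + c + d = a' + b' + c' + d'.
Proof. by move=> -> -> -> ->. Qed.

Lemma eq_add_equations (A B C D f g : R) :
  A + B + f = 0 -> C + D + g = 0 -> A - C + (B - D) = g - f.
Proof. lra. Qed.

Lemma eq_sub_equations (A B C D f g : R) :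
  A - B + f = 0 -> C - D + g = 0 -> A - C - (B - D) = g - f.
Proof. lra. Qed.

Lemma C1_whole_row_diff_le k l (F : 'rV[R]_(k + l) -> R) (A B : 'rV[R]_k)
    (C : 'rV[R]_l) (M : R) : C1_whole F ->
  (forall q : rat, 0 <= (ratr q : R) <= 1 ->
     enorm (hat_grad F (row_mx (ratr q *: A + (1 - ratr q) *: B) C)) <= M) ->
  `|F (row_mx A C) - F (row_mx B C)| <= M * \sum_i `|A ord0 i - B ord0 i|.
Proof.
move=> CF hM; have := @C1_whole_diff_le R k l F (row_mx A C) (row_mx B C) M CF.
have E i : row_mx A C ord0 (lshift l i) - row_mx B C ord0 (lshift l i) =
    A ord0 i - B ord0 i by rewrite !row_mxEl.
under eq_bigr do rewrite E.
apply => [j|q q01]; first by rewrite !row_mxEr.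
have q1 : ratr q + (1 - ratr q) = 1 :> R by ring.
by rewrite lin_row_mx -scalerDl q1 scale1r; exact: hM.
Qed.

Section blocks.
Variables (p1 p2 p3 p4 p5 : nat).
Variables (A1 B1 : 'rV[R]_p1) (A2 B2 : 'rV[R]_p2) (A3 B3 : 'rV[R]_p3).
Variables (A4 B4 : 'rV[R]_p4) (A5 B5 : 'rV[R]_p5).

Lemma sum_row_mx_diff5 :
  \sum_i `|row_mx (row_mx (row_mx (row_mx A1 A2) A3) A4) A5 ord0 i
          - row_mx (row_mx (row_mx (row_mx B1 B2) B3) B4) B5 ord0 i| =
  \sum_i `|A1 ord0 i - B1 ord0 i| + \sum_i `|A2 ord0 i - B2 ord0 i| +
  \sum_i `|A3 ord0 i - B3 ord0 i| + \sum_i `|A4 ord0 i - B4 ord0 i| +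
  \sum_i `|A5 ord0 i - B5 ord0 i|.
Proof. by rewrite !sum_row_mx_diff. Qed.

Lemma lin_row_mx5 (s r : R) :
  s *: row_mx (row_mx (row_mx (row_mx A1 A2) A3) A4) A5 +
  r *: row_mx (row_mx (row_mx (row_mx B1 B2) B3) B4) B5 =
  row_mx (row_mx (row_mx (row_mx (s *: A1 + r *: B1) (s *: A2 + r *: B2))
    (s *: A3 + r *: B3)) (s *: A4 + r *: B4)) (s *: A5 + r *: B5).
Proof. by rewrite !lin_row_mx. Qed.

End blocks.

Lemma congr_row_mx5 p1 p2 p3 p4 p5 (A1 B1 : 'rV[R]_p1) (A2 B2 : 'rV[R]_p2)
    (A3 B3 : 'rV[R]_p3) (A4 B4 : 'rV[R]_p4) (A5 B5 : 'rV[R]_p5) :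
  A1 = B1 -> A2 = B2 -> A3 = B3 -> A4 = B4 -> A5 = B5 ->
  row_mx (row_mx (row_mx (row_mx A1 A2) A3) A4) A5 =
  row_mx (row_mx (row_mx (row_mx B1 B2) B3) B4) B5.
Proof. by move=> -> -> -> -> ->. Qed.

Section difference.
Variables (n : nat) (T : R).
Hypothesis T0 : 0 < T.

Let Q := cylinder n 0 T : set ('rV[R]_n * R).

Lemma C21_sub (u v : 'rV[R]_n * R -> R) : C21 T u -> C21 T v ->
  let w := fun p => u p - v p in
  [/\ C21 T w,
      forall i p, closure Q p -> dx T i w p = dx T i u p - dx T i v p
    & forall p, closure Q p -> dt T w p = dt T u p - dt T v p].
Proof.
move=> hu hv w; have [h1 h2 _ h3] := C21_lin 1 (- 1) hu hv.
have E : (fun p => 1 * u p + -1 * v p) = w.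
  by apply/funext => p; rewrite mul1r mulN1r.
rewrite E in h1 h2 h3; split => //.
  by move=> i p cp; rewrite h2// mul1r mulN1r.
by move=> p cp; rewrite h3// mul1r mulN1r.
Qed.

Lemma Lop_sub a (u v : 'rV[R]_n * R -> R) p : (forall i j, C1_cube (a i j)) ->
  C21 T u -> C21 T v -> closure Q p ->
  Lop T a (fun p => u p - v p) p = Lop T a u p - Lop T a v p.
Proof.
move=> ha hu hv cp; have := Lop_lin T0 ha 1 (- 1) hu hv cp.
rewrite mul1r mulN1r => <-; congr (Lop T a _ p).
by apply/funext => q; rewrite mul1r mulN1r.
Qed.

Variables (a : 'I_n -> 'I_n -> 'rV[R]_n -> R) (K : 'I_n -> 'rV[R]_n -> R).
Variables (F1 : 'rV[R]_(dim1 n + (n + 1)) -> R) (F2 : 'rV[R]_(dim2 n + (n + 1)) -> R).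
Variables (fu fm u1 m1 u2 m2 : 'rV[R]_n * R -> R) (M1 M : R).
Hypotheses (M1_gt0 : 0 < M1) (M_gt0 : 0 < M).
Hypothesis ha : forall i j, C1_cube (a i j).
Hypothesis hK : kernels K M1.
Hypothesis hN : nonlinearities T a K F1 F2 M1 M.
Hypotheses (hB1 : in_B T M1 u1 m1) (hB2 : in_B T M1 u2 m2).
Hypotheses (hS1 : solution T a K F1 F2 fu fm u1 m1)
           (hS2 : solution T a K F1 F2 fu fm u2 m2).

Let u p := u1 p - u2 p.
Let m p := m1 p - m2 p.

Lemma gradE (w : 'rV[R]_n * R -> R) p i : grad T w p ord0 i = dx T i w p.
Proof. exact: mxE. Qed.

Lemma grad_diff (f g : 'rV[R]_n * R -> R) p i :
  `|grad T f p ord0 i - grad T g p ord0 i| = `|dx T i f p - dx T i g p|.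
Proof. by rewrite (gradE f) (gradE g). Qed.

Lemma grad_lin (f g w : 'rV[R]_n * R -> R) (s r : R) p :
  (forall i, dx T i w p = s * dx T i f p + r * dx T i g p) ->
  grad T w p = s *: grad T f p + r *: grad T g p.
Proof.
move=> H; apply/rowP => i; apply: (etrans (gradE _ _ _)); apply: (etrans (H i)).
apply: (etrans _ (esym (lin_rowE _ _ _ _ _))).
by rewrite -!gradE.
Qed.

(** The part of [arg2] that is differentiated. It is linear in pairs (v, k) of regular functions, so
    a segment of pairs goes to a segment of arguments. *)
Let block2 v k p : 'rV[R]_(dim2 n) :=
  row_mx (row_mx (row_mx (row_mx (grad T k p) (k p)%:M) (v p)%:M) (grad T v p))
    (Lop T a v p)%:M.

(** Subtracting the two equations leaves an increment of F2, and by [in_B_convex] the gradient bound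
    holds along the segment that joins its arguments. *)
Lemma parabolic_m_le p : Q p ->
  `|dt T m p - Lop T a m p| <= M * (\sum_i `|dx T i m p| + `|m p| + `|u p| +
     \sum_i `|dx T i u p| + `|Lop T a u p|).
Proof.
move=> Qp; have cp : closure Q p by exact: subset_closure.
have [_ CF2 _ hat2] := hN.
have [hu1 hm1 _ _] := hB1; have [hu2 hm2 _ _] := hB2.
have [_ e1 _ _] := hS1; have [_ e2 _ _] := hS2.
have [_ du _] := C21_sub hu1 hu2; have [_ dm tm] := C21_sub hm1 hm2.
have E : dt T m p - Lop T a m p = F2 (arg2 T a u2 m2 p) - F2 (arg2 T a u1 m1 p).
  rewrite (tm p cp) (Lop_sub ha hm1 hm2 cp).
  exact: (eq_sub_equations (e1 p Qp) (e2 p Qp)).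
rewrite E.
have A2 (q : rat) : 0 <= (ratr q : R) <= 1 -> enorm (hat_grad F2 (row_mx
    (ratr q *: block2 u2 m2 p + (1 - ratr q) *: block2 u1 m1 p)
    (row_mx p.1 p.2%:M))) <= M.
  move=> q01; have [_ dus _ _] := C21_lin (ratr q) (1 - ratr q) hu2 hu1.
  have [_ dms _ _] := C21_lin (ratr q) (1 - ratr q) hm2 hm1.
  apply: le_trans (hat2 _ _ (in_B_convex T0 M1_gt0 q01 hB2 hB1) p cp).
  rewrite le_eqVlt; apply/orP; left; apply/eqP.
  apply: (congr1 (fun X => enorm (hat_grad F2 (row_mx X _)))).
  apply: (etrans (lin_row_mx5 _ _ _ _ _ _ _ _ _ _ _ _)).
  apply: congr_row_mx5; [|exact: lin_scalar|exact: lin_scalar| |].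
  - exact: (esym (grad_lin (fun i => dms i p cp))).
  - exact: (esym (grad_lin (fun i => dus i p cp))).
  - apply: (etrans (lin_scalar _ _ _ _)); apply: (congr1 (fun c => c%:M)).
    exact: (esym (Lop_lin T0 ha _ _ hu2 hu1 cp)).
apply: (le_trans (C1_whole_row_diff_le CF2 A2)).
apply: ler_wpM2l; first exact: ltW.
rewrite le_eqVlt; apply/orP; left; apply/eqP.
apply: (etrans (sum_row_mx_diff5 _ _ _ _ _ _ _ _ _ _)).
apply: congr_add5.
- apply: eq_bigr => i _; apply: (etrans (grad_diff _ _ _ _)).
  exact: (etrans (distrC _ _) (congr1 Num.norm (esym (dm i p cp)))).
- exact: (etrans (sum_scalar_diff _ _) (distrC _ _)).
- exact: (etrans (sum_scalar_diff _ _) (distrC _ _)).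
- apply: eq_bigr => i _; apply: (etrans (grad_diff _ _ _ _)).
  exact: (etrans (distrC _ _) (congr1 Num.norm (esym (du i p cp)))).
- apply: (etrans (sum_scalar_diff _ _)).
  exact: (etrans (distrC _ _) (congr1 Num.norm (esym (Lop_sub ha hu1 hu2 cp)))).
Qed.

(** Points through which the kernels may be truncated on every coordinate line; by [ae_good_line]
    almost every point of the cube is one. *)
Definition good_line (x : 'rV[R]_n) := forall i,
  {ae lebesgue_measure, forall s : measurableTypeR R, s \in `]0, 1[ ->
     `|K i (subst_coor x i s)| <= M1}.

Let M1N : - M1 <= M1. Proof. by rewrite ge0_cp // ltW. Qed.

(* K_i is bounded by M1 only almost everywhere, its truncation everywhere. *)
Let trK i x (s : R) := clamp (- M1) M1 (K i (subst_coor x i s)).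

Lemma trK_le i x s : `|trK i x s| <= M1.
Proof. by rewrite ler_norml; exact: (clamp_itv _ M1N). Qed.

Lemma measurable_K_line i x : cube n x ->
  measurable_fun (`]0, 1[ : set (measurableTypeR R)) (fun s => K i (subst_coor x i s)).
Proof.
move=> cx; have [mK _] := hK i.
apply: (@measurable_comp _ _ _ _ _ _ (cube n : set 'rV[R]_n)) mK _.
- exact: measurable_cube.
- by move=> _ [s /= s01 <-]; apply: subst_coor_cube => //; rewrite in_itv in s01.
- apply: measurable_funTS.
  exact: (measurableT_comp (measurable_subst_coor i)
    (measurable_fun_pair (measurable_cst x) (@measurable_id _ _ _))).
Qed.

Lemma measurable_trK i x : cube n x ->
  measurable_fun (`]0, 1[ : set (measurableTypeR R)) (trK i x).
Proof.
move=> cx; apply: (measurableT_comp (f := clamp (- M1) M1)).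
  by apply: continuous_measurable_fun; exact: continuous_clamp.
exact: measurable_K_line.
Qed.

Lemma measurable_ext_line (f : 'rV[R]_n * R -> R) i x t : cb (ext T f) ->
  measurable_fun (`]0, 1[ : set (measurableTypeR R))
    (fun s => ext T f (subst_coor x i s, t)).
Proof.
move=> [cf _]; apply: measurable_funTS.
apply: (@measurable_subst_coor_r R n (fun y => ext T f (y, t)) x i).
exact: (measurableT_comp (continuous_measurable_rV cf)
  (measurable_fun_pair (@measurable_id _ _ _) (measurable_cst (t : measurableTypeR R)))).
Qed.

Lemma integrable_trK (f : 'rV[R]_n * R -> R) i x t : cube n x -> cb (ext T f) ->
  lebesgue_measure.-integrable (`]0, 1[ : set (measurableTypeR R))
    (EFin \o (fun s => trK i x s * ext T f (subst_coor x i s, t))).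
Proof.
move=> cx cf; apply: integrable01.
  by apply: measurable_funM; [exact: measurable_trK|exact: measurable_ext_line].
have [_ [B hB]] := cf; exists (M1 * B) => s _.
by rewrite normrM ler_pM// trK_le.
Qed.

(** On a good line [K i] agrees with its truncation almost everywhere. The integral is unchanged,
    and the bounded integrand makes it linear in [f]. *)
Lemma nonlocalE (f : 'rV[R]_n * R -> R) i x t : cube n x -> 0 < t < T ->
  good_line x -> cb (ext T f) ->
  nonlocal K f (x, t) ord0 i =
  \int[lebesgue_measure]_(s in `]0, 1[) (trK i x s * ext T f (subst_coor x i s, t)).
Proof.
move=> cx tT gx cf; rewrite /nonlocal mxE /=; congr fine.
have E s : s \in `]0, 1[ -> f (subst_coor x i s, t) = ext T f (subst_coor x i s, t).
  by rewrite in_itv => s01; rewrite ext_cyl//; exact: subst_coor_cube.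
transitivity (\int[lebesgue_measure]_(s in (`]0%R, 1%R[ : set (measurableTypeR R)))
    (K i (subst_coor x i s) * ext T f (subst_coor x i s, t))%:E)%E.
  by apply: eq_integral => s /set_mem /= s01; rewrite E.
apply: ae_eq_integral.
- exact: measurable_itv.
- apply/measurable_EFinP/measurable_funM; first exact: measurable_K_line.
  exact: measurable_ext_line.
- apply/measurable_EFinP/measurable_funM; first exact: measurable_trK.
  exact: measurable_ext_line.
- apply: filterS (gx i) => s Ks s01; congr (_ * _)%:E.
  by rewrite /trK clamp_id// -ler_norml; exact: Ks.
Qed.

Lemma nonlocal_lin (f g : 'rV[R]_n * R -> R) (c d : R) x t : cube n x -> 0 < t < T ->
  good_line x -> cb (ext T f) -> cb (ext T g) ->
  nonlocal K (fun p => c * f p + d * g p) (x, t) =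
  c *: nonlocal K f (x, t) + d *: nonlocal K g (x, t).
Proof.
move=> cx tT gx cf cg; apply/rowP => i.
have ch : cb (ext T (fun p => c * f p + d * g p)).
  exact: (cbD (cbM (cb_cst n c) cf) (cbM (cb_cst n d) cg)).
rewrite lin_rowE (nonlocalE i cx tT gx ch) (nonlocalE i cx tT gx cf).
rewrite (nonlocalE i cx tT gx cg).
have i1 := integrable_trK i t cx cf; have i2 := integrable_trK i t cx cg.
have mI : measurable (`]0, 1[ : set (measurableTypeR R)) by exact: measurable_itv.
rewrite -(RintegralZl _ mI i1) -(RintegralZl _ mI i2) -RintegralD//.
- by apply: eq_Rintegral => s _; rewrite /ext /=; ring.
- exact: (integrableZl mI c i1).
- exact: (integrableZl mI d i2).
Qed.

Lemma nonlocal_diff (f g : 'rV[R]_n * R -> R) i x t : cube n x -> 0 < t < T ->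
  good_line x -> cb (ext T f) -> cb (ext T g) ->
  `|nonlocal K f (x, t) ord0 i - nonlocal K g (x, t) ord0 i| <=
  M1 * \int[lebesgue_measure]_(s in `]0, 1[)
     `|ext T (fun p => f p - g p) (subst_coor x i s, t)|.
Proof.
move=> cx tT gx cf cg.
have ch : cb (ext T (fun p => f p - g p)) by exact: (cbB cf cg).
rewrite (nonlocalE i cx tT gx cf) (nonlocalE i cx tT gx cg).
have i1 := integrable_trK i t cx cf; have i2 := integrable_trK i t cx cg.
have mI : measurable (`]0, 1[ : set (measurableTypeR R)) by exact: measurable_itv.
rewrite -(RintegralB mI i1 i2).
have [_ [B hB]] := ch.
have i3 : lebesgue_measure.-integrable (`]0, 1[ : set (measurableTypeR R))
    (EFin \o (fun s => `|ext T (fun p => f p - g p) (subst_coor x i s, t)|)).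
  apply: integrable01; last by exists B => s _; rewrite normr_id.
  by apply: measurableT_comp => //; exact: measurable_ext_line.
rewrite -(RintegralZl _ mI i3).
apply: (le_trans (le_normr_Rintegral mI (integrableB mI i1 i2))).
apply: le_Rintegral => //.
- by have := integrable_abse (integrableB mI i1 i2); exact.
- exact: (integrableZl mI M1 i3).
- move=> s _; rewrite -mulrBr normrM; apply: ler_wpM2r => //.
  exact: trK_le.
Qed.

Let block1 v k p : 'rV[R]_(dim1 n) :=
  row_mx (row_mx (row_mx (row_mx (v p)%:M (grad T v p)) (k p)%:M) (grad T k p))
    (nonlocal K k p).

(* The bound on the gradient of F1 holds off a null set depending on the point of the
   segment between the two solutions; restricting to rational parameters keeps the
   exceptional set null, and continuity of the gradient covers the others. *)
Lemma parabolic_u_le x t : cube n x -> 0 < t < T -> good_line x ->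
  dt T u1 (x, t) + Lop T a u1 (x, t) + F1 (arg1 T K u1 m1 (x, t)) = 0 ->
  dt T u2 (x, t) + Lop T a u2 (x, t) + F1 (arg1 T K u2 m2 (x, t)) = 0 ->
  (forall q : rat, 0 <= (ratr q : R) <= 1 ->
     enorm (hat_grad F1 (arg1 T K (fun p => ratr q * u2 p + (1 - ratr q) * u1 p)
       (fun p => ratr q * m2 p + (1 - ratr q) * m1 p) (x, t))) <= M) ->
  `|dt T u (x, t) + Lop T a u (x, t)| <=
  M * (`|u (x, t)| + \sum_i `|dx T i u (x, t)| + `|m (x, t)| +
       \sum_i `|dx T i m (x, t)| +
       \sum_i (M1 * \int[lebesgue_measure]_(s in `]0, 1[)
          `|ext T m (subst_coor x i s, t)|)).
Proof.
move=> cx tT gx e1 e2 hat.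
have Qp : Q (x, t) by exact: cyl_in.
have cp : closure Q (x, t) by exact: subset_closure.
have [CF1 _ _ _] := hN.
have [hu1 hm1 _ _] := hB1; have [hu2 hm2 _ _] := hB2.
have [cm1 _ _] := C21_cb T0 hm1; have [cm2 _ _] := C21_cb T0 hm2.
have [_ du tu] := C21_sub hu1 hu2; have [_ dm _] := C21_sub hm1 hm2.
have E : dt T u (x, t) + Lop T a u (x, t) =
    F1 (arg1 T K u2 m2 (x, t)) - F1 (arg1 T K u1 m1 (x, t)).
  rewrite (tu _ cp) (Lop_sub ha hu1 hu2 cp).
  exact: (eq_add_equations e1 e2).
rewrite E.
have A2 (q : rat) : 0 <= (ratr q : R) <= 1 -> enorm (hat_grad F1 (row_mx
    (ratr q *: block1 u2 m2 (x, t) + (1 - ratr q) *: block1 u1 m1 (x, t))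
    (row_mx x t%:M))) <= M.
  move=> q01; have [_ dus _ _] := C21_lin (ratr q) (1 - ratr q) hu2 hu1.
  have [_ dms _ _] := C21_lin (ratr q) (1 - ratr q) hm2 hm1.
  apply: le_trans (hat q q01).
  rewrite le_eqVlt; apply/orP; left; apply/eqP.
  apply: (congr1 (fun X => enorm (hat_grad F1 (row_mx X _)))).
  apply: (etrans (lin_row_mx5 _ _ _ _ _ _ _ _ _ _ _ _)).
  apply: congr_row_mx5; [exact: lin_scalar| |exact: lin_scalar| |].
  - exact: (esym (grad_lin (fun i => dus i _ cp))).
  - exact: (esym (grad_lin (fun i => dms i _ cp))).
  - exact: (esym (nonlocal_lin _ _ cx tT gx cm2 cm1)).
apply: (le_trans (C1_whole_row_diff_le CF1 A2)).
apply: ler_wpM2l; first exact: ltW.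
rewrite (sum_row_mx_diff5 _ _ _ _ _ _ _ _ _ _).
apply: lerD; last first.
  apply: ler_sum => i _; rewrite distrC.
  exact: (nonlocal_diff i cx tT gx cm1 cm2).
rewrite le_eqVlt; apply/orP; left; apply/eqP.
apply: congr_add4.
- exact: (etrans (sum_scalar_diff _ _) (distrC _ _)).
- apply: eq_bigr => i _; apply: (etrans (grad_diff _ _ _ _)).
  exact: (etrans (distrC _ _) (congr1 Num.norm (esym (du i _ cp)))).
- exact: (etrans (sum_scalar_diff _ _) (distrC _ _)).
- apply: eq_bigr => i _; apply: (etrans (grad_diff _ _ _ _)).
  exact: (etrans (distrC _ _) (congr1 Num.norm (esym (dm i _ cp)))).
Qed.

End difference.
End system_inequalities.

(** * From pointwise to averaged inequalities *)

Section averaged_inequalities.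
Context {R : realType}.

Lemma sqr_bound5 (M X a b c d e : R) : 0 <= M ->
  `|X| <= M * (a + b + c + d + e) ->
  X ^+ 2 <= 5 * M ^+ 2 * (a ^+ 2 + b ^+ 2 + c ^+ 2 + d ^+ 2 + e ^+ 2).
Proof.
move=> M0 h.
have h1 : X ^+ 2 <= (M * (a + b + c + d + e)) ^+ 2.
  rewrite -[X ^+ 2]real_normK ?num_real// lerXn2r// nnegrE//.
  exact: le_trans h.
apply: (le_trans h1); rewrite exprMn -mulrA [leRHS]mulrCA.
by apply: ler_wpM2l; [exact: sqr_ge0|exact: sqr_sum5].
Qed.

Lemma sqr_sum_norm n (f : 'I_n -> R) :
  (\sum_i `|f i|) ^+ 2 <= n%:R * \sum_i f i ^+ 2.
Proof.
apply: (le_trans (sqr_sum_ord _)); rewrite le_eqVlt; apply/orP; left; apply/eqP.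
by congr (_ * _); apply: eq_bigr => i _; rewrite real_normK ?num_real.
Qed.

(** A strict violation at one time persists on an interval, which has positive length. This upgrades
    to every [t] what slicing gives for almost every [t]. *)
Lemma ae_continuous_le (f g : R -> R) (a b : R) : continuous f -> continuous g ->
  {ae lebesgue_measure, forall t : measurableTypeR R, a < t < b -> f t <= g t} ->
  forall t, a < t < b -> f t <= g t.
Proof.
move=> cf cg [N [mN N0 PN]] t tab; rewrite leNgt; apply/negP => fg.
have tI : t \in `]a, b[ by rewrite in_itv.
have c : continuous (fun s => f s - g s).
  by move=> s; apply: cvgB; [exact: cf|exact: cg].
have fg0 : 0 < f t - g t by rewrite subr_gt0.
have H : \forall s \near t, (s \in `]a, b[) /\ 0 < f s - g s.
  near=> s; split; first by near: s; exact: near_in_itvoo.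
  by near: s; exact: (cvgr_gt _ (c t)).
have [e /= e0 eH] := iffLR (nbhs_ballP _ _) H.
have sub : (`]t - e, t + e[ : set (measurableTypeR R)) `<=` N.
  move=> s /=; rewrite in_itv /= => /andP[s1 s2].
  have [sab fgs] : (s \in `]a, b[) /\ 0 < f s - g s.
    by apply: eH; rewrite /ball /= ltr_norml; apply/andP; split; lra.
  apply: PN => /= h; rewrite in_itv in sab; have := h sab; lra.
have : (lebesgue_measure (`](t - e)%R, (t + e)%R[ : set (measurableTypeR R)) <= 0)%E.
  by rewrite -N0; apply: le_measure; rewrite ?inE//; exact: measurable_itv.
rewrite lebesgue_measure_itv /= lte_fin ifT; last by lra.
by rewrite -EFinB lee_fin; lra.
Unshelve. all: by end_near. Qed.

Lemma weighted_sum_le (k c gm gu l2 m2 u2 sm su : R) : 0 <= k -> 0 <= c ->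
  0 <= gm -> 0 <= gu -> 0 <= l2 -> 0 <= m2 -> 0 <= u2 ->
  sm <= k * gm -> su <= k * gu ->
  sm + m2 + u2 + su + l2 <= (1 + k + c) * (u2 + gu + l2 + m2 + gm).
Proof.
move=> k0 c0 gm0 gu0 l0 m0 u0 h1 h2.
have a1 : 0 <= k * (u2 + l2 + m2) by rewrite mulr_ge0// !addr_ge0.
have a2 : 0 <= c * (u2 + gu + l2 + m2 + gm) by rewrite mulr_ge0// !addr_ge0.
lra.
Qed.

Lemma nonlocal_sum_le (k c yu gu ym gm : R) : 0 <= k ->
  0 <= yu -> 0 <= gu -> 0 <= ym -> 0 <= gm ->
  yu + k * gu + ym + k * gm + k * c ^+ 2 * (k * ym) <=
  (1 + k + k ^+ 2 * c ^+ 2) * (yu + gu + ym + gm).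
Proof.
move=> k0 yu0 gu0 ym0 gm0.
have a1 : 0 <= k * (yu + ym) by rewrite mulr_ge0// addr_ge0.
have a2 : 0 <= k ^+ 2 * c ^+ 2 * (yu + gu + gm).
  by rewrite mulr_ge0 ?addr_ge0// mulr_ge0// sqr_ge0.
nra.
Qed.

Lemma eq_le_R (x y : R) : x = y -> x <= y.
Proof. by move=> ->. Qed.

Section averages.
Variables (n : nat) (T M M1 : R).
Hypotheses (T0 : 0 < T) (M_ge0 : 0 <= M).
Implicit Types f u m : 'rV[R]_n * R -> R.

Definition grad_sq u t : R := avg (fun x => \sum_i ext T (dx T i u) (x, t) ^+ 2).

(** The factor 5 comes from squaring five groups of terms, [n] from the sums of partial derivatives,
    and [n ^ 2 * M1 ^ 2] from the nonlocal terms: one [n] for squaring their sum, one for adding [n]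
    averages that are all equal. *)
Definition lip_const : R := 5 * M ^+ 2 * (1 + n%:R + n%:R ^+ 2 * M1 ^+ 2).

Lemma avg_sqr_ge0 f t : 0 <= ip T f f t.
Proof. by apply: avg_ge0 => x _; rewrite -expr2; exact: sqr_ge0. Qed.

Lemma grad_sq_ge0 u t : 0 <= grad_sq u t.
Proof. by apply: avg_ge0 => x _; apply: sumr_ge0 => i _; exact: sqr_ge0. Qed.

Lemma cb_grad_sq u : C21 T u -> cb (fun p => \sum_i ext T (dx T i u) p ^+ 2).
Proof. by move=> /(C21_cb T0)[_ cd _]; apply: cb_sum => i; exact: cbX2. Qed.

Lemma ipX2 f t : ip T f f t = avg (fun x => ext T f (x, t) ^+ 2).
Proof. by apply: eq_avg => x _; rewrite expr2. Qed.

Lemma avg_m_le (L u m : 'rV[R]_n * R -> R) (X : 'rV[R]_n -> R) t :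
  C21 T u -> C21 T m -> cb (ext T L) -> bmf X ->
  (forall x, cube n x -> `|X x| <= M * (\sum_i `|ext T (dx T i m) (x, t)| +
     `|ext T m (x, t)| + `|ext T u (x, t)| + \sum_i `|ext T (dx T i u) (x, t)| +
     `|ext T L (x, t)|)) ->
  avg (fun x => X x ^+ 2) <= lip_const *
    (ip T u u t + grad_sq u t + ip T L L t + ip T m m t + grad_sq m t).
Proof.
move=> hu hm cL bX H; have [cu _ _] := C21_cb T0 hu; have [cm _ _] := C21_cb T0 hm.
have b1 := cb_bmf t (cbX2 cu); have b2 := cb_bmf t (cbX2 cm).
have b3 := cb_bmf t (cbX2 cL).
have b4 := cb_bmf t (cb_grad_sq hu); have b5 := cb_bmf t (cb_grad_sq hm).
have n0 : 0 <= n%:R :> R by exact: ler0n.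
have nM : 0 <= n%:R ^+ 2 * M1 ^+ 2 by rewrite mulr_ge0// sqr_ge0.
have M5 : 0 <= 5 * M ^+ 2 by rewrite mulr_ge0// sqr_ge0.
rewrite !ipX2 /grad_sq -(avgD b1 b4) -(avgD (bmfD b1 b4) b3).
rewrite -(avgD (bmfD (bmfD b1 b4) b3) b2) -(avgD (bmfD (bmfD (bmfD b1 b4) b3) b2) b5).
rewrite -(avgZ _ (bmfD (bmfD (bmfD (bmfD b1 b4) b3) b2) b5)).
apply: le_avg; first exact: bmfX2.
  exact/bmfZ/(bmfD (bmfD (bmfD (bmfD b1 b4) b3) b2) b5).
move=> x cx; apply: (le_trans (sqr_bound5 M_ge0 (H x cx))).
rewrite /lip_const -[leRHS]mulrA; apply: ler_wpM2l => //.
rewrite !real_normK ?num_real//.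
have := sqr_sum_norm (fun i => ext T (dx T i u) (x, t)).
have := sqr_sum_norm (fun i => ext T (dx T i m) (x, t)).
have := sqr_ge0 (ext T u (x, t)); have := sqr_ge0 (ext T m (x, t)).
have := sqr_ge0 (ext T L (x, t)).
have : 0 <= \sum_i ext T (dx T i u) (x, t) ^+ 2.
  by apply: sumr_ge0 => i _; exact: sqr_ge0.
have : 0 <= \sum_i ext T (dx T i m) (x, t) ^+ 2.
  by apply: sumr_ge0 => i _; exact: sqr_ge0.
move=> gm0 gu0 l0 m0 u0 h1 h2.
exact: (weighted_sum_le n0 nM gm0 gu0 l0 m0 u0 h1 h2).
Qed.

(** Averaging over the cube undoes the integration along lines, so with Jensen the square of a
    nonlocal term costs no more than the squared norm of [f]. *)
Lemma line_average_sqr (f : 'rV[R]_n * R -> R) i t : cb (ext T f) ->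
  let L x := \int[lebesgue_measure]_(s in `]0, 1[)
    (ext T f (subst_coor x i s, t) ^+ 2) in
  [/\ bmf L, avg L = ip T f f t &
   forall x, (\int[lebesgue_measure]_(s in `]0, 1[)
     `|ext T f (subst_coor x i s, t)|) ^+ 2 <= L x].
Proof.
move=> cf L; have [cc [B hB]] := cf.
have mf : measurable_fun setT (fun x => ext T f (x, t)).
  exact: (measurableT_comp (continuous_measurable_rV cc)
    (measurable_fun_pair (@measurable_id _ _ _) (measurable_cst (t : measurableTypeR R)))).
have bd : exists M, forall x, `|ext T f (x, t) ^+ 2| <= M.
  by have [_ [C hC]] := cbX2 cf; exists C.
have [bL aL] := avg_integral_subst_coor i (measurable_funX 2 mf) bd.
split; [exact: bL|exact: (etrans aL (esym (ipX2 _ _)))|move=> x].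
have mn : measurable_fun (`]0, 1[ : set (measurableTypeR R))
    (fun s => `|ext T f (subst_coor x i s, t)|).
  by apply: measurableT_comp => //; exact: measurable_ext_line.
apply: (le_trans (sqr_integral01_le mn _)); first by exists B => s _; rewrite normr_id.
rewrite le_eqVlt; apply/orP; left; apply/eqP.
by apply: eq_Rintegral => s _; rewrite real_normK ?num_real.
Qed.

Lemma sqr_sum_scaled_le (f g : 'I_n -> R) : (forall i, f i ^+ 2 <= g i) ->
  (\sum_i (M1 * f i)) ^+ 2 <= n%:R * M1 ^+ 2 * \sum_i g i.
Proof.
move=> H; apply: (le_trans (sqr_sum_ord _)).
rewrite -mulrA; apply: ler_wpM2l => //; rewrite mulr_sumr; apply: ler_sum => i _.
by rewrite exprMn; apply: ler_wpM2l; [exact: sqr_ge0|exact: H].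
Qed.

Lemma avg_u_le (u m : 'rV[R]_n * R -> R) (X : 'rV[R]_n -> R) t :
  C21 T u -> C21 T m -> bmf X ->
  {ae lebesgue_rV R n, forall x, cube n x ->
     `|X x| <= M * (`|ext T u (x, t)| + \sum_i `|ext T (dx T i u) (x, t)| +
     `|ext T m (x, t)| + \sum_i `|ext T (dx T i m) (x, t)| +
     \sum_i (M1 * \int[lebesgue_measure]_(s in `]0, 1[)
          `|ext T m (subst_coor x i s, t)|))} ->
  avg (fun x => X x ^+ 2) <= lip_const *
    (ip T u u t + grad_sq u t + ip T m m t + grad_sq m t).
Proof.
move=> hu hm bX H; have [cu _ _] := C21_cb T0 hu; have [cm _ _] := C21_cb T0 hm.
pose L i x := \int[lebesgue_measure]_(s in `]0, 1[)
  (ext T m (subst_coor x i s, t) ^+ 2).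
have bL i : bmf (L i) by have [] := line_average_sqr i t cm.
have aL i : avg (L i) = ip T m m t by have [] := line_average_sqr i t cm.
have hL i x := (let: And3 _ _ h := line_average_sqr i t cm in h) x.
have b1 := cb_bmf t (cbX2 cu); have b2 := cb_bmf t (cbX2 cm).
have b4 := cb_bmf t (cb_grad_sq hu); have b5 := cb_bmf t (cb_grad_sq hm).
have b6 := bmf_sum (index_enum 'I_n) bL.
have n0 : 0 <= n%:R :> R by exact: ler0n.
have M5 : 0 <= 5 * M ^+ 2 by rewrite mulr_ge0// sqr_ge0.
have c4 := bmfZ n%:R b4; have c5 := bmfZ n%:R b5.
have c6 := bmfZ (n%:R * M1 ^+ 2) b6.
have bG := bmfD (bmfD (bmfD (bmfD b1 c4) b2) c5) c6.
apply: (@le_trans _ _ (5 * M ^+ 2 * (ip T u u t + n%:R * grad_sq u t + ip T m m t +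
  n%:R * grad_sq m t + n%:R * M1 ^+ 2 * (n%:R * ip T m m t)))); last first.
  rewrite /lip_const -[leRHS]mulrA; apply: ler_wpM2l => //.
  have := avg_sqr_ge0 u t; have := avg_sqr_ge0 m t.
  have := grad_sq_ge0 u t; have := grad_sq_ge0 m t.
  move: (ip T u u t) (ip T m m t) (grad_sq u t) (grad_sq m t) => yu ym gu gm.
  move=> gm0 gu0 ym0 yu0; exact: nonlocal_sum_le.
have Y (f : 'rV[R]_n * R -> R) := ipX2 f t.
have E : avg (fun x => \sum_i L i x) = n%:R * ip T m m t.
  rewrite avg_sum// (eq_bigr (fun=> ip T m m t)); last by move=> i _; exact: aL.
  by rewrite sumr_const card_ord mulr_natl.
have d1 := bmfD b1 c4; have d2 := bmfD d1 b2; have d3 := bmfD d2 c5.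
have EG := etrans (avgD d3 c6) (congr2 +%R (etrans (avgD d2 c5) (congr2 +%R
  (etrans (avgD d1 b2) (congr2 +%R (etrans (avgD b1 c4)
    (congr2 +%R (esym (Y u)) (avgZ n%:R b4))) (esym (Y m)))) (avgZ n%:R b5)))
  (etrans (avgZ (n%:R * M1 ^+ 2) b6) (congr1 ( *%R (n%:R * M1 ^+ 2)) E))).
have EZ := etrans (avgZ (5 * M ^+ 2) bG) (congr1 ( *%R (5 * M ^+ 2)) EG).
apply: (le_trans _ (eq_le_R EZ)).
apply: ae_le_avg; [exact: bmfX2|exact: bmfZ bG|].
apply: filterS H => x Hx cx; apply: (le_trans (sqr_bound5 M_ge0 (Hx cx))).
apply: ler_wpM2l => //; rewrite !real_normK ?num_real//.
apply: lerD; last exact: (sqr_sum_scaled_le (fun i => hL i x)).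
apply: lerD; last exact: sqr_sum_norm.
by apply: lerD => //; apply: lerD => //; exact: sqr_sum_norm.
Qed.

End averages.
End averaged_inequalities.

(** * The averaged system *)

Section averaged_system.
Context {R : realType} (n : nat) (T : R).
Hypothesis T0 : 0 < T.
Variables (a : 'I_n -> 'I_n -> 'rV[R]_n -> R) (mu1 mu2 : R).
Hypotheses (mu1_gt0 : 0 < mu1) (ha : coefficients a mu1 mu2).

Let Q := cylinder n 0 T : set ('rV[R]_n * R).

Let caa i j : C1_cube (a i j). Proof. by have [H _ _] := ha; exact: H. Qed.

Let sa i j x : closure (cube n) x -> a i j x = a j i x.
Proof. by have [_ H _] := ha; exact: H. Qed.

(** Used through the sign of its left side: the nonnegative squares in the Carleman inequality
    become inequalities between the averaged products. *)
Lemma avg_quadratic_ge0 (f g h : 'rV[R]_n * R -> R) (b c d t : R) :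
  cb (ext T f) -> cb (ext T g) -> cb (ext T h) ->
  avg (fun x => (b * ext T f (x, t) + c * ext T g (x, t) + d * ext T h (x, t)) ^+ 2) =
  b ^+ 2 * ip T f f t + c ^+ 2 * ip T g g t + d ^+ 2 * ip T h h t +
  2 * b * c * ip T f g t + 2 * b * d * ip T h f t + 2 * c * d * ip T h g t.
Proof.
move=> cf cg ch.
have B (k l : 'rV[R]_n * R -> R) : cb (ext T k) -> cb (ext T l) ->
    bmf (fun x => ext T k (x, t) * ext T l (x, t)).
  by move=> ck cl; exact: (cb_bmf t (cbM ck cl)).
have e1 := B _ _ cf cf; have e2 := B _ _ cg cg; have e3 := B _ _ ch ch.
have e4 := B _ _ cf cg; have e5 := B _ _ ch cf; have e6 := B _ _ ch cg.
rewrite /ip -(avgZ (b ^+ 2) e1) -(avgZ (c ^+ 2) e2) -(avgZ (d ^+ 2) e3).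
rewrite -(avgZ (2 * b * c) e4) -(avgZ (2 * b * d) e5) -(avgZ (2 * c * d) e6).
have z1 := bmfD (bmfZ (b ^+ 2) e1) (bmfZ (c ^+ 2) e2).
have z2 := bmfD z1 (bmfZ (d ^+ 2) e3).
have z3 := bmfD z2 (bmfZ (2 * b * c) e4).
have z4 := bmfD z3 (bmfZ (2 * b * d) e5).
rewrite -(avgD (bmfZ (b ^+ 2) e1) (bmfZ (c ^+ 2) e2)) -(avgD z1 (bmfZ (d ^+ 2) e3)).
rewrite -(avgD z2 (bmfZ (2 * b * c) e4)) -(avgD z3 (bmfZ (2 * b * d) e5)).
rewrite -(avgD z4 (bmfZ (2 * c * d) e6)).
apply: eq_avg => x _.
by move: (ext T f (x, t)) (ext T g (x, t)) (ext T h (x, t)) => *; ring.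
Qed.

Lemma energy_bounds (u : 'rV[R]_n * R -> R) t : C21 T u ->
  mu1 * grad_sq T u t <= energy T a u t <= mu2 * grad_sq T u t.
Proof.
move=> hu; have [_ _ hell] := ha.
have bE := cb_bmf t (cb_energy T0 caa hu).
have bG := cb_bmf t (cb_grad_sq T0 hu).
have key x : mu1 * (\sum_i ext T (dx T i u) (x, t) ^+ 2) <=
    \sum_i \sum_j ext T (fun q => a i j q.1) (x, t) * ext T (dx T j u) (x, t) *
      ext T (dx T i u) (x, t) <= mu2 * (\sum_i ext T (dx T i u) (x, t) ^+ 2).
  have cl : closure (cube n) (@cyl_clamp R n T (x, t)).1.
    by rewrite closure_cube => i; rewrite mxE; exact: clamp_itv.
  have := hell _ (\row_i ext T (dx T i u) (x, t)) cl.
  rewrite /enorm sqr_sqrtr; last by apply: sumr_ge0 => i _; exact: sqr_ge0.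
  under eq_bigr do rewrite mxE.
  under [X in _ <= X <= _]eq_bigr => i _.
    under eq_bigr do rewrite !mxE mulrAC.
    over.
  done.
rewrite /grad_sq -(avgZ mu1 bG) -(avgZ mu2 bG); apply/andP; split.
  by apply: le_avg; [exact: bmfZ|exact: bE|move=> x _; have /andP[] := key x].
by apply: le_avg; [exact: bE|exact: bmfZ|move=> x _; have /andP[] := key x].
Qed.

Lemma avg_sqr_add (f g : 'rV[R]_n * R -> R) (c t : R) :
  cb (ext T f) -> cb (ext T g) ->
  avg (fun x => (ext T f (x, t) + c * ext T g (x, t)) ^+ 2) =
  ip T f f t + 2 * c * ip T g f t + c ^+ 2 * ip T g g t.
Proof.
move=> cf cg; have := avg_quadratic_ge0 1 0 c t cf cf cg => E.
have -> : avg (fun x => (ext T f (x, t) + c * ext T g (x, t)) ^+ 2) =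
   avg (fun x => (1 * ext T f (x, t) + 0 * ext T f (x, t) + c * ext T g (x, t)) ^+ 2).
  by apply: eq_avg => x _; rewrite mul1r mul0r addr0.
by rewrite E; move: (ip T f f t) (ip T g g t) (ip T g f t) => *; ring.
Qed.

Variables (K : 'I_n -> 'rV[R]_n -> R).
Variables (F1 : 'rV[R]_(dim1 n + (n + 1)) -> R) (F2 : 'rV[R]_(dim2 n + (n + 1)) -> R).
Variables (fu fm u1 m1 u2 m2 : 'rV[R]_n * R -> R) (M1 M : R).
Hypotheses (M1_gt0 : 0 < M1) (M_gt0 : 0 < M).
Hypothesis hK : kernels K M1.
Hypothesis hN : nonlinearities T a K F1 F2 M1 M.
Hypotheses (hB1 : in_B T M1 u1 m1) (hB2 : in_B T M1 u2 m2).
Hypotheses (hS1 : solution T a K F1 F2 fu fm u1 m1)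
           (hS2 : solution T a K F1 F2 fu fm u2 m2).

Let u p := u1 p - u2 p.
Let m p := m1 p - m2 p.

Lemma C21_diff : C21 T u /\ C21 T m.
Proof.
have [hu1 hm1 _ _] := hB1; have [hu2 hm2 _ _] := hB2.
by split; [case: (C21_sub hu1 hu2)|case: (C21_sub hm1 hm2)].
Qed.

Let hu : C21 T u. Proof. by case: C21_diff. Qed.
Let hm : C21 T m. Proof. by case: C21_diff. Qed.

Lemma system_m_avg t : 0 < t < T ->
  ip T (dt T m) (dt T m) t - 2 * ip T (Lop T a m) (dt T m) t +
  ip T (Lop T a m) (Lop T a m) t <=
  lip_const n M M1 * (ip T u u t + grad_sq T u t + ip T (Lop T a u) (Lop T a u) t +
    ip T m m t + grad_sq T m t).
Proof.
move=> tT; have cL := cb_Lop T0 caa hm; have cLu := cb_Lop T0 caa hu.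
have [_ _ ct] := C21_cb T0 hm.
have E := avg_sqr_add (- 1) t ct cL.
have bX : bmf (fun x => ext T (dt T m) (x, t) + -1 * ext T (Lop T a m) (x, t)).
  exact: (bmfD (cb_bmf t ct) (bmfZ (- 1) (cb_bmf t cL))).
have := @avg_m_le R n T M M1 T0 (ltW M_gt0) (Lop T a u) u m _ t hu hm cLu bX.
rewrite E => H; apply: le_trans (H _).
  by apply: eq_le_R; move: (ip _ _ _ _) (ip _ _ _ _) (ip _ _ _ _) => *; ring.
move=> x cx.
have par := parabolic_m_le T0 M1_gt0 M_gt0 caa hN hB1 hB2 hS1 hS2 (cyl_in cx tT).
have Ee f : `|f (x, t)| = `|ext T f (x, t)|.
  exact: (congr1 Num.norm (esym (ext_cyl T0 f cx tT))).
have Xe : ext T (dt T m) (x, t) + -1 * ext T (Lop T a m) (x, t) =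
    dt T m (x, t) - Lop T a m (x, t).
  by rewrite mulN1r (ext_cyl T0 (dt T m) cx tT) (ext_cyl T0 (Lop T a m) cx tT).
apply: (le_trans (eq_le_R (congr1 Num.norm Xe))); apply: (le_trans par).
apply: eq_le_R; apply: (congr1 ( *%R M)); apply: congr_add5.
- by apply: eq_bigr => i _; exact: (Ee (dx T i m)).
- exact: Ee.
- exact: Ee.
- by apply: eq_bigr => i _; exact: (Ee (dx T i u)).
- exact: (Ee (Lop T a u)).
Qed.

Lemma ae_good_line : {ae lebesgue_rV R n, forall x, cube n x -> good_line K M1 x}.
Proof.
have H i := ae_line (ae_Linfty_norm (proj2 (hK i))).
have G : {ae lebesgue_rV R n, forall x, forall i, cube n x -> forall j,
     {ae lebesgue_measure, forall s : measurableTypeR R, s \in `]0, 1[ ->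
       cube n (subst_coor x j s) -> `|K i (subst_coor x j s)| <= M1}}.
  exact: filter_forall.
apply: filterS G => x Hx cx i; apply: filterS (Hx i cx i) => s Hs s01.
by apply: Hs => //; apply: subst_coor_cube => //; rewrite in_itv in s01.
Qed.

(** The equation and the gradient bound are sliced at almost every time and then averaged; since
    both sides are continuous in [t], the inequality extends to every time. *)
Lemma system_u_avg t : 0 < t < T ->
  ip T (dt T u) (dt T u) t + 2 * ip T (Lop T a u) (dt T u) t +
  ip T (Lop T a u) (Lop T a u) t <=
  lip_const n M M1 * (ip T u u t + grad_sq T u t + ip T m m t + grad_sq T m t).
Proof.
have cL := cb_Lop T0 caa hu.
have [cu _ ct] := C21_cb T0 hu; have [cm _ _] := C21_cb T0 hm.
move: t; apply: ae_continuous_le.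
- move=> t; apply: cvgD; last exact: (continuous_ip cL cL).
  apply: cvgD; first exact: (continuous_ip ct ct).
  by apply: cvgM; [exact: cvg_cst|exact: (continuous_ip cL ct)].
- move=> t; apply: cvgM; first exact: cvg_cst.
  apply: cvgD; last exact: (avg_continuous (cb_grad_sq T0 hm)).
  apply: cvgD; last exact: (continuous_ip cm cm).
  apply: cvgD; last exact: (avg_continuous (cb_grad_sq T0 hu)).
  exact: (continuous_ip cu cu).
have [_ _ hat1 _] := hN.
have [e1 _ _ _] := hS1; have [e2 _ _ _] := hS2.
(* Each parameter [q] has its own exceptional set; the rationals being countable, a single null set
   serves them all. *)
have hatq : ae_cyl (fun p : 'rV[R]_n * R => forall q : rat, 0 <= (ratr q : R) <= 1 ->
    closure Q p ->
     enorm (hat_grad F1 (arg1 T K (fun p => ratr q * u2 p + (1 - ratr q) * u1 p)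
       (fun p => ratr q * m2 p + (1 - ratr q) * m1 p) p)) <= M).
  apply: (@ae_ratr R _ _ _ (fun q : rat => is_true (0 <= (ratr q : R) <= 1))) => q q01.
  exact: hat1 (in_B_convex T0 M1_gt0 q01 hB2 hB1).
have := ae_time_slice hatq; have := ae_time_slice e1; have := ae_time_slice e2.
apply: filterS3 => t a2 a1 a3 tT.
have bX : bmf (fun x => ext T (dt T u) (x, t) + 1 * ext T (Lop T a u) (x, t)).
  exact: (bmfD (cb_bmf t ct) (bmfZ 1 (cb_bmf t cL))).
have E := avg_sqr_add 1 t ct cL.
have := @avg_u_le R n T M M1 T0 (ltW M_gt0) u m _ t hu hm bX.
rewrite E => H; apply: le_trans (H _).
  by apply: eq_le_R; move: (ip _ _ _ _) (ip _ _ _ _) (ip _ _ _ _) => *; ring.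

have : {ae lebesgue_rV R n, forall x, (forall q : rat, 0 <= (ratr q : R) <= 1 ->
    closure Q (x, t) -> enorm (hat_grad F1 (arg1 T K
       (fun p => ratr q * u2 p + (1 - ratr q) * u1 p)
       (fun p => ratr q * m2 p + (1 - ratr q) * m1 p) (x, t))) <= M) /\
    (cube n x -> good_line K M1 x)}.
  by apply: filterS2 a3 ae_good_line => x.
apply: filterS3 a1 a2 => x b1 b2 [b3 b4] cx.
have Qp : Q (x, t) by exact: cyl_in.
have Ee f : `|f (x, t)| = `|ext T f (x, t)|.
  exact: (congr1 Num.norm (esym (ext_cyl T0 f cx tT))).
have par := parabolic_u_le T0 M1_gt0 M_gt0 caa hK hN hB1 hB2 cx tT (b4 cx)
  (b1 Qp) (b2 Qp) (fun q q01 => b3 q q01 (@subset_closure _ Q (x, t) Qp)).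
have Xe : ext T (dt T u) (x, t) + 1 * ext T (Lop T a u) (x, t) =
    dt T u (x, t) + Lop T a u (x, t).
  by rewrite mul1r (ext_cyl T0 (dt T u) cx tT) (ext_cyl T0 (Lop T a u) cx tT).
apply: (le_trans (eq_le_R (congr1 Num.norm Xe))); apply: (le_trans par).
apply: eq_le_R; apply: (congr1 ( *%R M)); apply: congr_add5.
- exact: Ee.
- by apply: eq_bigr => i _; exact: (Ee (dx T i u)).
- exact: Ee.
- by apply: eq_bigr => i _; exact: (Ee (dx T i m)).
- by [].
Qed.

End averaged_system.

(** * Hoelder stability *)

Section holder_estimate.
Context {R : realType} (n : nat) (T : R).
Hypothesis T0 : 0 < T.
Variables (a : 'I_n -> 'I_n -> 'rV[R]_n -> R) (mu1 mu2 : R).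
Hypotheses (mu1_gt0 : 0 < mu1) (mu2_gt0 : 0 < mu2) (ha : coefficients a mu1 mu2).
Variables (M1 M : R).
Hypotheses (M1_gt0 : 0 < M1) (M_gt0 : 0 < M).

Let caa i j : C1_cube (a i j). Proof. by have [H _ _] := ha; exact: H. Qed.

Let sa i j x : closure (cube n) x -> a i j x = a j i x.
Proof. by have [_ H _] := ha; exact: H. Qed.

(** What the Carleman inequality retains on its smaller side. The squares of [m_t] and [Lm] are not
    among these terms: they are spent on absorbing the cross terms. *)
Definition density (u m : 'rV[R]_n * R -> R) t : R :=
  ip T (dt T u) (dt T u) t + ip T (Lop T a u) (Lop T a u) t + energy T a u t +
  ip T u u t + energy T a m t + ip T m m t.

Lemma energy_ge0 u t : C21 T u -> 0 <= energy T a u t.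
Proof.
move=> hu; have /andP[h _] := energy_bounds T0 ha t hu.
by apply: le_trans h; rewrite mulr_ge0 ?grad_sq_ge0// ltW.
Qed.

Lemma lip_const_ge0 : 0 <= lip_const n M M1.
Proof.
rewrite /lip_const; apply: mulr_ge0; first by rewrite mulr_ge0// sqr_ge0.
by rewrite addr_ge0 ?addr_ge0 ?ler0n//; apply: mulr_ge0; exact: sqr_ge0.
Qed.

Lemma grad_sq_le u t : C21 T u -> grad_sq T u t <= mu1^-1 * energy T a u t.
Proof.
move=> hu; have /andP[h _] := energy_bounds T0 ha t hu.
by rewrite ler_pdivlMl.
Qed.

Lemma continuous_density u m : C21 T u -> C21 T m -> continuous (density u m).
Proof.
move=> hu hm t.
have [cu _ cut] := C21_cb T0 hu; have [cm _ _] := C21_cb T0 hm.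
have cLu := cb_Lop T0 caa hu.
apply: cvgD; last exact: (continuous_ip cm cm).
apply: cvgD; last exact: (continuous_energy T0 caa hm).
apply: cvgD; last exact: (continuous_ip cu cu).
apply: cvgD; last exact: (continuous_energy T0 caa hu).
by apply: cvgD; [exact: (continuous_ip cut cut)|exact: (continuous_ip cLu cLu)].
Qed.

Section two_solutions.
Variables (K : 'I_n -> 'rV[R]_n -> R).
Variables (F1 : 'rV[R]_(dim1 n + (n + 1)) -> R) (F2 : 'rV[R]_(dim2 n + (n + 1)) -> R).
Variables (fu fm u1 m1 u2 m2 : 'rV[R]_n * R -> R).
Hypothesis hK : kernels K M1.
Hypothesis hN : nonlinearities T a K F1 F2 M1 M.
Hypotheses (hB1 : in_B T M1 u1 m1) (hB2 : in_B T M1 u2 m2).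
Hypotheses (hS1 : solution T a K F1 F2 fu fm u1 m1)
           (hS2 : solution T a K F1 F2 fu fm u2 m2).

Let u p := u1 p - u2 p.
Let m p := m1 p - m2 p.

Lemma difference_boundary (f v w : 'rV[R]_n * R -> R) : C21 T v -> C21 T w ->
  boundary_conditions T a f v -> boundary_conditions T a f w ->
  (forall x t, Gamma0 n x -> 0 < t < T -> v (x, t) - w (x, t) = 0) /\
  (forall i x t, Gamma1 n x -> side i x -> 0 < t < T ->
     conormal T a i (fun p => v p - w p) (x, t) = 0).
Proof.
move=> hv hw [v0 v1] [w0 w1]; split=> [x t gx tT|i x t gx sx tT].
  by rewrite v0// w0// subrr.
have [_ d _] := C21_sub hv hw.
have cp : closure (cylinder n 0 T) (x, t).
  rewrite closure_cylinder//; have [[cx _] _] := gx; rewrite closure_cube in cx.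
  by split => //=; rewrite in_itv /=; case/andP: tT => /ltW -> /ltW ->.
have E : conormal T a i (fun p => v p - w p) (x, t) =
    conormal T a i v (x, t) - conormal T a i w (x, t).
  rewrite /conormal -sumrB; apply: eq_bigr => j _.
  rewrite (d j _ cp) -mulrBl; congr (_ * _).
  by move: (dx T j v (x, t)) (dx T j w (x, t)) => A B; rewrite mulrBr.
by rewrite E (v1 i x t gx sx tT) (w1 i x t gx sx tT) subrr.
Qed.

Lemma carleman_estimate C k s l g tau :
  C = lip_const n M M1 * (1 + mu1^-1) -> k = 2 * C + 2 ->
  s = k * C + 2 * C + 1 -> s + s ^+ 2 + k * C + 3 * C + 4 <= l ->
  0 < g < T -> 1 <= tau ->
  \int[lebesgue_measure]_(t in `]g, T[) density u m t <=
  expR (2 * tau * expR (l * T)) * ((k + tau * l * expR (l * T)) *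
    (energy T a u T + ip T u u T + ip T m m T)) +
  expR (- (2 * tau * (expR (l * g) - 1))) *
    (energy T a m 0 + s / 2 * ip T m m 0).
Proof.
move=> CE kE sE lE gT tau1.
have [hu hm] := C21_diff hB1 hB2; rewrite -/u -/m in hu hm.
have [hu1 hm1 _ _] := hB1; have [hu2 hm2 _ _] := hB2.
have [_ _ bu1 bm1] := hS1; have [_ _ bu2 bm2] := hS2.
have [u0 uN] := difference_boundary hu1 hu2 bu1 bu2.
have [m0 mN] := difference_boundary hm1 hm2 bm1 bm2.
have [cu _ cut] := C21_cb T0 hu; have [cm _ cmt] := C21_cb T0 hm.
have cLu := cb_Lop T0 caa hu; have cLm := cb_Lop T0 caa hm.
have l0 := lip_const_ge0.
have mi0 : 0 <= mu1^-1 by rewrite invr_ge0 ltW.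
have C0 : 0 <= C by rewrite CE mulr_ge0// addr_ge0.
(* The averaged system contains squared gradients; ellipticity replaces them by Dirichlet energies
   at the price of the factor [1 + mu1^-1]. *)
have LC (yu gu ym gm Eu Em L2 : R) : 0 <= yu -> 0 <= ym -> 0 <= L2 ->
    0 <= Eu -> 0 <= Em -> gu <= mu1^-1 * Eu -> gm <= mu1^-1 * Em ->
    lip_const n M M1 * (yu + gu + L2 + ym + gm) <= C * (yu + Eu + L2 + ym + Em).
  move=> yu0 ym0 L20 Eu0 Em0 h1 h2; rewrite CE -[leRHS]mulrA; apply: ler_wpM2l => //.
  have : 0 <= mu1^-1 * (yu + L2 + ym) by rewrite mulr_ge0// !addr_ge0.
  by move: (mu1^-1) h1 h2 => q h1 h2; lra.
apply: (@carleman_integral R T g tau C k s l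
  (ip T (dt T u) (dt T u)) (ip T (Lop T a u) (Lop T a u)) (ip T (Lop T a u) (dt T u))
  (ip T u (dt T u)) (energy T a u) (ip T u u)
  (ip T (dt T m) (dt T m)) (ip T (Lop T a m) (Lop T a m)) (ip T (Lop T a m) (dt T m))
  (ip T m (dt T m)) (energy T a m) (ip T m m)) => //.
- by split; apply: continuous_ip.
- by split; [exact: (continuous_energy T0 caa hu)|exact: continuous_ip..].
- by split; [exact: (continuous_energy T0 caa hm)|exact: continuous_ip].
- move=> t; split; first split; try exact: avg_sqr_ge0.
    exact: energy_ge0.
  by split; [exact: energy_ge0|exact: avg_sqr_ge0].
- move=> t tT; split.
  + exact: is_derive_ip.
  + exact: (is_derive_energy T0 caa hu sa u0 uN tT).
  + exact: is_derive_ip.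
  + exact: (is_derive_energy T0 caa hm sa m0 mN tT).
- move=> t tT.
  have yu0 := avg_sqr_ge0 T u t; have ym0 := avg_sqr_ge0 T m t.
  have L0 := avg_sqr_ge0 T (Lop T a u) t.
  have Eu0 := energy_ge0 t hu; have Em0 := energy_ge0 t hm.
  have gu := grad_sq_le t hu; have gm := grad_sq_le t hm.
  split.
  + apply: (le_trans (system_u_avg T0 ha M1_gt0 M_gt0 hK hN hB1 hB2 hS1 hS2 tT)).
    have := LC _ _ _ _ _ _ 0 yu0 ym0 (lexx 0) Eu0 Em0 gu gm.
    by rewrite !addr0.
  + apply: (le_trans (system_m_avg T0 ha M1_gt0 M_gt0 hN hB1 hB2 hS1 hS2 tT)).
    exact: (LC _ _ _ _ _ _ _ yu0 ym0 L0 Eu0 Em0 gu gm).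
  + have H : 0 <= avg (fun x => (ext T (dt T u) (x, t) + 2 * ext T u (x, t)) ^+ 2).
      by apply: avg_ge0 => x _; exact: sqr_ge0.
    apply: (le_trans (le_trans H (eq_le_R (avg_sqr_add 2 t cut cu)))); apply: eq_le_R.
    move: (ip T (dt T u) (dt T u) t) (ip T u (dt T u) t) (ip T u u t) => A B D; ring.
- move=> t p r tT.
  have Ee := energyE T0 caa hm m0 mN tT.
  (* Signs of the three squares in [m], from their expansions; [energyE] then turns (Lm, m) into
     minus the energy. *)
  have pos (f h q : 'rV[R]_n * R -> R) (b c d : R) cf ch cq :=
    le_trans (avg_ge0 (fun x _ => sqr_ge0 (b * ext T f (x, t) + c * ext T h (x, t) +
      d * ext T q (x, t)))) (eq_le_R (@avg_quadratic_ge0 R n T f h q b c d t cf ch cq)).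
  have H1 := pos _ _ _ 1 0 p cmt cmt cm; have H2 := pos _ _ _ 1 0 p cLm cLm cm.
  have H3 := pos _ _ _ 1 (- 1) (- (r / 2)) cmt cLm cm.
  have sym : ip T (dt T m) (Lop T a m) t = ip T (Lop T a m) (dt T m) t.
    by apply: eq_avg => x _; exact: mulrC.
  split.
  + apply: (le_trans H1); apply: eq_le_R.
    move: (ip T (dt T m) (dt T m) t) (ip T m (dt T m) t) (ip T m m t) => A B D; ring.
  + apply: (le_trans H2); apply: eq_le_R; rewrite Ee.
    move: (ip T (Lop T a m) (Lop T a m) t) (ip T m (Lop T a m) t) (ip T m m t).
    by move=> A B D; ring.
  + apply: (le_trans H3); apply: eq_le_R; rewrite Ee sym.
    move: (ip T (Lop T a m) (Lop T a m) t) (ip T m (Lop T a m) t) (ip T m m t)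
      (ip T (dt T m) (dt T m) t) (ip T m (dt T m) t) (ip T (Lop T a m) (dt T m) t).
    by move=> A B D E F G; field.
Qed.

(** Nothing is known at time 0 beyond membership in the ball: the C^1 bounds control the difference
    and each of its [n] derivatives by [2 * M1]. Smallness has to come from the exponential factor
    in front. *)
Lemma initial_le s : 0 <= s ->
  energy T a m 0 + s / 2 * ip T m m 0 <= (mu2 * n%:R + s / 2) * (2 * M1) ^+ 2.
Proof.
move=> s0; have [hu hm] := C21_diff hB1 hB2; rewrite -/u -/m in hu hm.
have [_ hm1 _ b1] := hB1; have [_ hm2 _ b2] := hB2.
have [cm cdm _] := C21_cb T0 hm.
have t0 : (0 : R) <= 0 <= T by rewrite lexx ltW.
have [c1 d1 _ _] := hm1; have [c2 d2 _ _] := hm2.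
have N1 := iffLR (norm_C1_le T0 (ltW M1_gt0) t0 c1 d1) (b1 0 t0).
have N2 := iffLR (norm_C1_le T0 (ltW M1_gt0) t0 c2 d2) (b2 0 t0).
have [_ dm _] := C21_sub hm1 hm2.
have bound (A B : R) : `|A| <= M1 -> `|B| <= M1 -> (A - B) ^+ 2 <= (2 * M1) ^+ 2.
  move=> hA hB; rewrite -[(A - B) ^+ 2]real_normK ?num_real// lerXn2r// ?nnegrE//.
    by rewrite mulr_ge0// ltW.
  by rewrite (le_trans (ler_normB _ _))// mulr_natl mulr2n lerD.
have cl (x : 'rV[R]_n) : cube n x -> closure (cube n) x by exact: subset_closure.
have ex f x : cube n x -> ext T f (x, 0) = f (x, 0).
  move=> cx; apply: ext_id; have := closure_slice T0 (cl x cx) t0.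
  by rewrite closure_cylinder.
have h1 : ip T m m 0 <= (2 * M1) ^+ 2.
  rewrite ipX2 -[leRHS](@avg_cst R n); apply: le_avg.
  - exact: (cb_bmf 0 (cbX2 cm)).
  - exact: bmf_cst.
  - move=> x cx; rewrite (ex m x cx); have [a1 _] := N1 x (cl x cx).
    have [a2 _] := N2 x (cl x cx); exact: bound.
have h2 : grad_sq T m 0 <= n%:R * (2 * M1) ^+ 2.
  rewrite -[leRHS](@avg_cst R n); apply: le_avg.
  - exact: (cb_bmf 0 (cb_grad_sq T0 hm)).
  - exact: bmf_cst.
  - move=> x cx; rewrite -[n in n%:R]card_ord -sum1_card natr_sum mulr_suml.
    apply: ler_sum => i _; rewrite mul1r (ex (dx T i m) x cx).
    rewrite (dm i _ (closure_slice T0 (cl x cx) t0)).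
    have [_ a1] := N1 x (cl x cx); have [_ a2] := N2 x (cl x cx).
    exact: bound.
have /andP[_ h3] := energy_bounds T0 ha 0 hm.
have h4 := ler_wpM2l (ltW mu2_gt0) h2.
have s2 : 0 <= s / 2 by rewrite divr_ge0.
have h5 := ler_wpM2l s2 h1.
rewrite mulrDl; apply: lerD; last exact: h5.
by rewrite -mulrA; exact: le_trans h3 h4.
Qed.

End two_solutions.

Lemma holder_density g : 0 < g < T ->
  exists kappa delta0 C : R,
  [/\ 0 < kappa < 1 / 2, 0 < delta0 < 1, 0 < C &
  forall (K : 'I_n -> 'rV[R]_n -> R)
     (F1 : 'rV[R]_(dim1 n + (n + 1)) -> R)
     (F2 : 'rV[R]_(dim2 n + (n + 1)) -> R)
     (fu fm u1 m1 u2 m2 : 'rV[R]_n * R -> R),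
   kernels K M1 -> nonlinearities T a K F1 F2 M1 M ->
   in_B T M1 u1 m1 -> in_B T M1 u2 m2 ->
   solution T a K F1 F2 fu fm u1 m1 -> solution T a K F1 F2 fu fm u2 m2 ->
   let u := fun p => u1 p - u2 p in
   let m := fun p => m1 p - m2 p in
   forall delta, 0 < delta < delta0 ->
   ip T u u T + grad_sq T u T <= delta ^+ 2 ->
   ip T m m T + grad_sq T m T <= delta ^+ 2 ->
   \int[lebesgue_measure]_(t in `]g, T[) density u m t <= C * delta `^ kappa].
Proof.
move=> gT.
pose C := lip_const n M M1 * (1 + mu1^-1); pose k := 2 * C + 2.
pose s := k * C + 2 * C + 1; pose l := s + s ^+ 2 + k * C + 3 * C + 4.
have C0 : 0 <= C by rewrite mulr_ge0 ?lip_const_ge0// addr_ge0// invr_ge0 ltW.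
have k0 : 0 <= k by rewrite /k addr_ge0// mulr_ge0.
have s0 : 0 <= s.
  by rewrite /s; apply: addr_ge0 => //; apply: addr_ge0; apply: mulr_ge0.
have l1 : 1 <= l.
  have h1 := sqr_ge0 s; have h2 : 0 <= k * C by rewrite mulr_ge0.
  by rewrite /l; move: s0 h1 h2 C0; move: (k * C) (s ^+ 2) (C) (s) => *; lra.
have A0 : 0 <= mu2 + 2 by rewrite addr_ge0// ltW.
have B0 : 0 <= (mu2 * n%:R + s / 2) * (2 * M1) ^+ 2.
  rewrite mulr_ge0 ?sqr_ge0// addr_ge0//; first by rewrite mulr_ge0 ?ler0n// ltW.
  by rewrite divr_ge0.
(* The coefficient [A = mu2 + 2] collects the terminal data: [mu2] for the energy of [u], and 1 for
   each of the squared norms of [u] and [m]. [B] is the bound of [initial_le]. *)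
have [kappa [delta0 [C1 [hk hd hC H]]]] := holder_choice gT l1 k0 A0 B0.
exists kappa, delta0, C1; split => // K F1 F2 fu fm u1 m1 u2 m2.
move=> hK hN hB1 hB2 hS1 hS2 u m delta hdelta hu hm.
have [tau tau1 Htau] := H delta hdelta.
apply: (le_trans (carleman_estimate hK hN hB1 hB2 hS1 hS2 erefl erefl erefl
  (lexx l) gT tau1)).
apply: le_trans Htau; apply: lerD; last first.
  apply: ler_wpM2l; first exact: expR_ge0.
  exact: (initial_le hB1 hB2).
apply: ler_wpM2l; first exact: expR_ge0.
have l0 : 0 <= l by exact: le_trans l1.
have tau0 : 0 <= tau by exact: le_trans tau1.
apply: ler_wpM2l.
  by rewrite addr_ge0// mulr_ge0 ?expR_ge0// mulr_ge0.
have [cu cm] := C21_diff hB1 hB2; rewrite -/u -/m in cu cm.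
have /andP[_ h3] := energy_bounds T0 ha T cu.
have g1 := grad_sq_ge0 T u T; have g2 := grad_sq_ge0 T m T.
have y1 := avg_sqr_ge0 T u T.
have h4 : grad_sq T u T <= delta ^+ 2 := le_trans (ler_wpDl y1 (lexx _)) hu.
have h5 : ip T u u T <= delta ^+ 2 := le_trans (ler_wpDr g1 (lexx _)) hu.
have h6 : ip T m m T <= delta ^+ 2 := le_trans (ler_wpDr g2 (lexx _)) hm.
have h7 := le_trans h3 (ler_wpM2l (ltW mu2_gt0) h4).
have -> : (mu2 + 2) * delta ^+ 2 = mu2 * delta ^+ 2 + delta ^+ 2 + delta ^+ 2 by ring.
exact: lerD (lerD h7 h5) h6.
Qed.

End holder_estimate.

(** * L_2 norms and averages that vanish *)

Section norms.
Context {R : realType}.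

Lemma eq_le_ereal (x y : \bar R) : x = y -> (x <= y)%E.
Proof. by move=> ->. Qed.

Lemma L2_normE d (X : measurableType d) (mu : {measure set X -> \bar R})
    (D : set X) (f h : X -> R) : measurable D ->
  (forall x, D x -> f x ^+ 2 = h x) ->
  L2_norm mu D f = ((\int[mu]_(x in D) (h x)%:E) `^ 2^-1)%E.
Proof.
move=> mD fh; rewrite /L2_norm unlock /=; congr (_ `^ _)%E.
rewrite [RHS]integral_mkcond; apply: eq_integral => x _.
rewrite patchE -?poweR_EFin /=; case: ifPn => [/set_mem Dx|Dx].
  rewrite indicE mem_set// mulr1 powR_mulrn// real_normK ?num_real//.
  by rewrite fh.
by rewrite indicE (negbTE Dx) mulr0 normr0 powR0// pnatr_eq0.
Qed.

Lemma L2_norm_le d (X : measurableType d) (mu : {measure set X -> \bar R})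
    (D : set X) (f h : X -> R) B : measurable D ->
  (forall x, D x -> f x ^+ 2 = h x) -> 0 <= B ->
  (\int[mu]_(x in D) (h x)%:E <= B%:E)%E ->
  (L2_norm mu D f <= (Num.sqrt B)%:E)%E.
Proof.
move=> mD fh B0 hB; rewrite (L2_normE _ mD fh) -powR12_sqrt//.
have I0 : (0 <= \int[mu]_(x in D) (h x)%:E)%E.
  by apply: integral_ge0 => x Dx; rewrite lee_fin -fh//; exact: sqr_ge0.
move: hB I0; case: (integral _ _ _) => [r| |]//; rewrite !lee_fin => rB r0.
by rewrite ge0_ler_powR// nnegrE.
Qed.

Lemma L2_norm_inv d (X : measurableType d) (mu : {measure set X -> \bar R})
    (D : set X) (f h : X -> R) B : measurable D ->
  (forall x, D x -> f x ^+ 2 = h x) -> 0 <= B ->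
  (L2_norm mu D f <= B%:E)%E ->
  (\int[mu]_(x in D) (h x)%:E <= (B ^+ 2)%:E)%E.
Proof.
move=> mD fh B0; rewrite (L2_normE _ mD fh).
have I0 : (0 <= \int[mu]_(x in D) (h x)%:E)%E.
  by apply: integral_ge0 => x Dx; rewrite lee_fin -fh//; exact: sqr_ge0.
move: I0; case: (integral _ _ _) => [r| |]//.
  rewrite !lee_fin => r0; rewrite powR12_sqrt// => h1.
  by rewrite -(sqr_sqrtr r0) lerXn2r// nnegrE// sqrtr_ge0.
by rewrite poweRyr ?invr_eq0.
Qed.

Lemma continuous_integrable_oo (f : R -> R) (b c : R) : continuous f ->
  lebesgue_measure.-integrable (`]b, c[ : set (measurableTypeR R)) (EFin \o f).
Proof.
move=> cf.
have i : lebesgue_measure.-integrable (`[b, c] : set (measurableTypeR R)) (EFin \o f).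
  apply: continuous_compact_integrable; first exact: segment_compact.
  exact: continuous_subspaceT.
by apply: integrableS i => //; exact: subset_itv_oo_cc.
Qed.

Lemma L2_cyl_le n (f h : 'rV[R]_n * R -> R) (g T B : R) : cb h ->
  (forall p, 0 <= h p) ->
  (forall x t, cube n x -> g < t < T -> f (x, t) ^+ 2 = h (x, t)) -> 0 <= B ->
  \int[lebesgue_measure]_(t in `]g, T[) avg (fun x => h (x, t)) <= B ->
  (L2_cyl g T f <= (Num.sqrt B)%:E)%E.
Proof.
move=> ch h0 fh B0 hB.
have mI : measurable (`]g, T[ : set (measurableTypeR R)) by exact: measurable_itv.
have mcyl : measurable (cylinder n g T : set ('rV[R]_n * measurableTypeR R)).
  by apply: (@measurableX _ _ 'rV[R]_n (measurableTypeR R)) mI; exact: measurable_cube.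
apply: (@L2_norm_le _ ('rV[R]_n * measurableTypeR R)%type _ _ f h B mcyl) => //.
  by move=> [x t] [/= cx ct]; apply: fh => //; rewrite in_itv in ct.
have mh : measurable_fun (cube n `*` (`]g, T[ : set (measurableTypeR R)))
    (EFin \o h : 'rV[R]_n * measurableTypeR R -> \bar R).
  apply/measurable_EFinP; apply: measurable_funTS.
  exact: (continuous_measurable_rV (proj1 ch)).
have [_ E] := @ge0_integral_setX _ _ 'rV[R]_n (measurableTypeR R) R
  (lebesgue_rV R n) (@lebesgue_measure R) (cube n) `]g, T[ (EFin \o h)
  (@measurable_cube _ n) mI mh (fun z _ => h0 z).
apply: (le_trans (y := (\int[lebesgue_measure]_(t in `]g, T[)
    avg (fun x => h (x, t)))%:E)); last by rewrite lee_fin.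
have ia := continuous_integrable_oo g T (avg_continuous ch).
rewrite /Rintegral fineK; last exact: (integrable_fin_num mI ia).
apply: eq_le_ereal; apply: (etrans E); apply: eq_integral => t _.
exact: (EFin_avg (cb_bmf t ch)).
Qed.

Lemma measurable_rV_box n (z : 'rV[R]_n) e :
  measurable [set y : 'rV[R]_n | forall i, `|z ord0 i - y ord0 i| < e].
Proof.
have -> : [set y : 'rV[R]_n | forall i, `|z ord0 i - y ord0 i| < e] =
    \bigcap_(i in [set: 'I_n]) ((fun y : 'rV[R]_n => y ord0 i : measurableTypeR R) @^-1`
      `](z ord0 i - e), (z ord0 i + e)[).
  apply/seteqP; split => y /= H i; first move=> _ /=.
    by rewrite in_itv /=; have := H i; rewrite ltr_norml => /andP[? ?];
      apply/andP; split; lra.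
  by have := H i I; rewrite /= in_itv /= ltr_norml => /andP[? ?];
    apply/andP; split; lra.
apply: fin_bigcap_measurable => // i _.
rewrite -[X in measurable X]setTI; exact: measurable_coor.
Qed.

Lemma lebesgue_rV_box_gt0 n (x : 'rV[R]_n) e : 0 < e ->
  (0 < lebesgue_rV R n [set y : 'rV[R]_n | forall i, (`|x ord0 i - y ord0 i| < e)%R])%E.
Proof.
move=> e0.
elim: n => [|n IH] in x *.
  by rewrite /= diracE mem_set// => -[].
pose x' : 'rV[R]_n := \row_i x ord0 (lift ord0 i).
have E : @cons_rV R n @^-1` [set y : 'rV[R]_n.+1 | forall i, (`|x ord0 i - y ord0 i| < e)%R] =
    (`](x ord0 ord0 - e), (x ord0 ord0 + e)[ : set (measurableTypeR R)) `*`
    [set y : 'rV[R]_n | forall i, `|x' ord0 i - y ord0 i| < e].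
  apply/seteqP; split => -[s y] /=.
    move=> H; split.
      have := H ord0; rewrite mxE unlift_none in_itv /= ltr_norml => /andP[? ?].
      by apply/andP; split; lra.
    by move=> i; have := H (lift ord0 i); rewrite !mxE liftK.
  move=> [+ H] i; rewrite in_itv /= mxE => /andP[h1 h2].
  case: (unliftP ord0 i) => [j ->|->] /=.
    by have := H j; rewrite mxE.
  by rewrite ltr_norml; apply/andP; split; lra.
have mI : measurable (`](x ord0 ord0 - e), (x ord0 ord0 + e)[ : set (measurableTypeR R)).
  exact: measurable_itv.
have V : (lebesgue_rV R n.+1 [set y : 'rV[R]_n.+1 | forall i, (`|x ord0 i - y ord0 i| < e)%R] =
    lebesgue_measure (`](x ord0 ord0 - e)%R, (x ord0 ord0 + e)%R[ : set (measurableTypeR R)) *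
    lebesgue_rV R n [set y : 'rV[R]_n | forall i, (`|x' ord0 i - y ord0 i| < e)%R])%E.
  apply: (etrans (congr1 (lebesgue_measure \x lebesgue_rV R n)%E E)).
  exact: product_measure1E mI (measurable_rV_box x' e).
rewrite V; apply: mule_gt0; last exact: IH.
rewrite lebesgue_measure_itv /= lte_fin ifT; last by lra.
by rewrite -EFinB lte_fin; lra.
Qed.

(** A positive value would persist on a small box around the point, and boxes have positive measure
    by [lebesgue_rV_box_gt0]. *)
Lemma avg_eq0 n (f : 'rV[R]_n * R -> R) t : cb f -> (forall p, 0 <= f p) ->
  avg (fun x => f (x, t)) = 0 -> forall x, cube n x -> f (x, t) = 0.
Proof.
move=> cf f0 I0 x cx; apply/eqP; rewrite eq_le f0 andbT leNgt; apply/negP => fx.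
have bf := cb_bmf t cf.
have E := EFin_avg bf; rewrite I0 in E.
have [mf _] := bf.
have mEf : measurable_fun (cube n) (EFin \o (fun x => f (x, t))) by exact/measurable_EFinP.
have [N [mN N0 PN]] := ge0_integral_eq0_ae (@measurable_cube _ n) mEf
  (fun y => f0 (y, t)) E.
have cs := continuous_slice (t := t) (proj1 cf).
have [e1 /= e10 H1] : nbhs_ball x (fun y => 0 < f (y, t)).
  by apply/nbhs_ballP; exact: (cvgr_gt _ (cs x)).
have [e2 /= e20 H2] : nbhs_ball x (cube n).
  by apply/nbhs_ballP; exact/open_nbhs_nbhs/(conj (open_cube (n := n))).
pose e := Num.min e1 e2; have e0 : 0 < e by rewrite lt_min e10.
have sub : [set y : 'rV[R]_n | forall i, `|x ord0 i - y ord0 i| < e] `<=` N.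
  move=> y xy; apply: PN => /= h.
  have bxy r : e <= r -> ball x r y.
    move=> er; split; first exact: lt_le_trans er.
    by move=> i j; rewrite ord1; exact: lt_le_trans (xy j) er.
  have cy : cube n y by apply: H2; apply: bxy; rewrite ge_min lexx orbT.
  have fy : 0 < f (y, t) by apply: H1; apply: bxy; rewrite ge_min lexx.
  by have := h cy => -[fy0]; rewrite fy0 ltxx in fy.
have := lebesgue_rV_box_gt0 x e0; rewrite ltNge => /negP; apply.
have -> : (0 = lebesgue_rV R n N)%E by rewrite N0.
apply: le_measure => //; rewrite inE//; exact: measurable_rV_box.
Qed.

End norms.

(** * Terminal data and norms in terms of the density *)

Section norm_bounds.
Context {R : realType} (n : nat) (T : R).
Hypothesis T0 : 0 < T.
Variables (a : 'I_n -> 'I_n -> 'rV[R]_n -> R) (mu1 mu2 : R).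
Hypotheses (mu1_gt0 : 0 < mu1) (ha : coefficients a mu1 mu2).
Implicit Types u m w : 'rV[R]_n * R -> R.

Let caa i j : C1_cube (a i j). Proof. by have [H _ _] := ha; exact: H. Qed.

Let ext_slice f x t : cube n x -> 0 <= t <= T -> ext T f (x, t) = f (x, t).
Proof.
move=> cx tT; apply: ext_id; rewrite -closure_cylinder//.
by apply: closure_slice => //; exact: subset_closure.
Qed.

Let TT : 0 <= T <= T. Proof. by rewrite lexx ltW. Qed.

Let pd_terminal w i x : C21 T w -> cube n x ->
  pd (cube n) (evec i) (fun y => w (y, T)) x = ext T (dx T i w) (x, T).
Proof.
move=> [cw dw _ _] cx; have [_ H] := has_pd_slice T0 cw (dw i) TT.
apply: (etrans (H x (subset_closure cx))).
exact: (esym (ext_slice (dx T i w) cx TT)).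
Qed.

Lemma H1_norm_terminal w delta : C21 T w -> 0 <= delta ->
  (H1_norm (fun x => w (x, T)) <= delta%:E)%E ->
  ip T w w T + grad_sq T w T <= delta ^+ 2.
Proof.
move=> hw d0 Hw; have [cw _ _] := C21_cb T0 hw.
pose h (x : 'rV[R]_n) := ext T w (x, T) ^+ 2 + \sum_i ext T (dx T i w) (x, T) ^+ 2.
have b1 := cb_bmf T (cbX2 cw); have b2 := cb_bmf T (cb_grad_sq T0 hw).
have E : avg h = ip T w w T + grad_sq T w T.
  by rewrite ipX2; exact: (avgD b1 b2).
rewrite -E -lee_fin -(EFin_avg (bmfD b1 b2)).
apply: (L2_norm_inv (@measurable_cube _ n) _ d0 Hw) => x cx.
rewrite sqr_sqrtr; last by rewrite addr_ge0 ?sqr_ge0// sumr_ge0// => i _; exact: sqr_ge0.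
rewrite /h (ext_slice w cx TT); congr (_ + _); apply: eq_bigr => i _.
exact: (congr1 (fun r => r ^+ 2) (pd_terminal i hw cx)).
Qed.

(** The gradient vanishes too, because [pd] of the terminal slice is determined by the values in the
    open cube. *)
Lemma terminal_eq0 w : C21 T w -> (forall x, cube n x -> w (x, T) = 0) ->
  ip T w w T + grad_sq T w T = 0.
Proof.
move=> hw w0.
have d0 i x : cube n x -> ext T (dx T i w) (x, T) = 0.
  move=> cx; apply: (etrans (esym (pd_terminal i hw cx))).
  have -> := @pd_ext _ _ (cube n) (evec i) _ (fun=> 0) (@open_cube _ n) w0.
  have [_ H] : has_pd (cube n) (evec i) (fun=> 0 : R) /\
      forall y, closure (cube n) y -> pd (cube n) (evec i) (fun=> 0 : R) y = 0.
    apply: (has_pdI (fun y _ => is_derive_cst (0 : R) y (evec i))).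
    by apply: continuous_subspaceT => z; exact: cst_continuous.
  exact: (H x (subset_closure cx)).
have -> : ip T w w T = 0.
  rewrite -[RHS](@avg_cst R n 0); apply: eq_avg => x cx.
  by rewrite (ext_slice w cx TT) w0// mul0r.
rewrite add0r -[RHS](@avg_cst R n 0); apply: eq_avg => x cx.
by apply: big1 => i _; rewrite d0// expr0n.
Qed.

Lemma density_ge u m t : C21 T u -> C21 T m ->
  let D := (1 + mu1^-1) * density T a u m t in
  [/\ ip T (dt T u) (dt T u) t <= D, ip T (Lop T a u) (Lop T a u) t <= D &
      [/\ grad_sq T u t <= D, ip T u u t <= D, grad_sq T m t <= D & ip T m m t <= D]].
Proof.
move=> hu hm /=.
have q0 : 0 <= mu1^-1 by rewrite invr_ge0 ltW.
have := energy_ge0 T0 mu1_gt0 ha t hu; have := energy_ge0 T0 mu1_gt0 ha t hm.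
have := grad_sq_le T0 mu1_gt0 ha t hu; have := grad_sq_le T0 mu1_gt0 ha t hm.
have := avg_sqr_ge0 T (dt T u) t; have := avg_sqr_ge0 T (Lop T a u) t.
have := avg_sqr_ge0 T u t; have := avg_sqr_ge0 T m t.
rewrite /density.
move: (ip T (dt T u) (dt T u) t) (ip T (Lop T a u) (Lop T a u) t) (energy T a u t)
  (ip T u u t) (energy T a m t) (ip T m m t) (grad_sq T u t) (grad_sq T m t)
  (mu1^-1) q0 => A B C D E F G H q q0 F0 D0 B0 A0 HE GC E0 C0.
have := mulr_ge0 q0 A0; have := mulr_ge0 q0 B0; have := mulr_ge0 q0 C0.
have := mulr_ge0 q0 D0; have := mulr_ge0 q0 E0; have := mulr_ge0 q0 F0.
by move=> *; split; last split; lra.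
Qed.

Lemma ip_le_density u m t : C21 T u -> C21 T m ->
  ip T u u t <= density T a u m t /\ ip T m m t <= density T a u m t.
Proof.
move=> hu hm.
have := energy_ge0 T0 mu1_gt0 ha t hu; have := energy_ge0 T0 mu1_gt0 ha t hm.
have := avg_sqr_ge0 T (dt T u) t; have := avg_sqr_ge0 T (Lop T a u) t.
have := avg_sqr_ge0 T u t; have := avg_sqr_ge0 T m t.
rewrite /density.
move: (ip T (dt T u) (dt T u) t) (ip T (Lop T a u) (Lop T a u) t) (energy T a u t)
  (ip T u u t) (energy T a m t) (ip T m m t) => A B C D E F F0 D0 B0 A0 E0 C0.
by split; lra.
Qed.

Lemma L2_sum_le u m g I : C21 T u -> C21 T m -> 0 < g < T -> 0 <= I ->
  \int[lebesgue_measure]_(t in `]g, T[) density T a u m t <= I ->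
  (L2_cyl g T (dt T u) + L2_cyl g T (Lop T a u)
   + L2_cyl g T (fun p => enorm (grad T u p)) + L2_cyl g T u
   + L2_cyl g T (fun p => enorm (grad T m p)) + L2_cyl g T m
   <= (6 * Num.sqrt ((1 + mu1^-1) * I))%:E)%E.
Proof.
move=> hu hm /andP[g0 gT] I0 hI.
have [cu cdu cut] := C21_cb T0 hu; have [cm cdm _] := C21_cb T0 hm.
have cLu := cb_Lop T0 caa hu.
have q0 : 0 <= 1 + mu1^-1 by rewrite addr_ge0// invr_ge0 ltW.
have B0 : 0 <= (1 + mu1^-1) * I by rewrite mulr_ge0.
have cD := continuous_density T0 ha hu hm.
have iI (f : R -> R) : continuous f ->
  (forall t, f t <= (1 + mu1^-1) * density T a u m t) ->
  \int[lebesgue_measure]_(t in `]g, T[) f t <= (1 + mu1^-1) * I.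
  move=> cf fD; apply: le_trans (ler_wpM2l q0 hI).
  have mI : measurable (`]g, T[ : set (measurableTypeR R)) by exact: measurable_itv.
  have iD := continuous_integrable_oo g T cD.
  rewrite -RintegralZl//; apply: (le_Rintegral mI).
  - exact: continuous_integrable_oo.
  - exact: (integrableZl mI _ iD).
  - by move=> t _; exact: fD.
have eC (f : 'rV[R]_n * R -> R) x t : cube n x -> g < t < T -> ext T f (x, t) = f (x, t).
  by move=> cx /andP[gt tT]; apply: ext_cyl => //; rewrite (lt_trans g0 gt).
have S (f : 'rV[R]_n * R -> R) : cb (ext T f) ->
    (forall t, ip T f f t <= (1 + mu1^-1) * density T a u m t) ->
    (L2_cyl g T f <= (Num.sqrt ((1 + mu1^-1) * I))%:E)%E.
  move=> cf fD; apply: (@L2_cyl_le _ _ f (fun p => ext T f p ^+ 2)) => //.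
  - exact: cbX2.
  - by move=> p; exact: sqr_ge0.
  - by move=> x t cx tI; exact: (congr1 (fun r => r ^+ 2) (esym (eC f x t cx tI))).
  - apply: iI => [|t]; first exact: (avg_continuous (cbX2 cf)).
    by rewrite -ipX2.
have G w : C21 T w ->
    (forall t, grad_sq T w t <= (1 + mu1^-1) * density T a u m t) ->
    (L2_cyl g T (fun p => enorm (grad T w p)) <= (Num.sqrt ((1 + mu1^-1) * I))%:E)%E.
  move=> hw wD.
  apply: (@L2_cyl_le _ _ _ (fun p => \sum_i ext T (dx T i w) p ^+ 2)) => //.
  - exact: cb_grad_sq.
  - by move=> p; apply: sumr_ge0 => i _; exact: sqr_ge0.
  - move=> x t cx tI; rewrite /enorm sqr_sqrtr; last by apply: sumr_ge0 => i _; exact: sqr_ge0.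
    apply: eq_bigr => i _; apply: (etrans (congr1 (fun r => r ^+ 2) (gradE T w (x, t) i))).
    exact: (congr1 (fun r => r ^+ 2) (esym (eC (dx T i w) x t cx tI))).
  - by apply: iI => //; exact: (avg_continuous (cb_grad_sq T0 hw)).
have -> : (6 * Num.sqrt ((1 + mu1^-1) * I))%:E =
  ((Num.sqrt ((1 + mu1^-1) * I))%:E + (Num.sqrt ((1 + mu1^-1) * I))%:E
  + (Num.sqrt ((1 + mu1^-1) * I))%:E + (Num.sqrt ((1 + mu1^-1) * I))%:E
  + (Num.sqrt ((1 + mu1^-1) * I))%:E + (Num.sqrt ((1 + mu1^-1) * I))%:E)%E.
  by rewrite -!EFinD; congr EFin; ring.
have H t := density_ge t hu hm.
by do 5?apply: leeD; [apply: S|apply: S|apply: G|apply: S|apply: G|apply: S] => // t;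
  have [? ? [? ? ? ?]] := H t.
Qed.

Lemma density_eq0 u m g : C21 T u -> C21 T m -> 0 < g < T ->
  \int[lebesgue_measure]_(t in `]g, T[) density T a u m t <= 0 ->
  forall t, g < t < T -> density T a u m t <= 0.
Proof.
move=> hu hm gT hI; have cD := continuous_density T0 ha hu hm.
have mI : measurable (`]g, T[ : set (measurableTypeR R)) by exact: measurable_itv.
have D0 t : 0 <= density T a u m t.
  rewrite /density !addr_ge0 ?avg_sqr_ge0//; exact: (energy_ge0 T0 mu1_gt0 ha).
have E : (\int[lebesgue_measure]_(t in (`]g, T[ : set (measurableTypeR R)))
    (density T a u m t)%:E = 0)%E.
  rewrite -[LHS]fineK; last exact: (integrable_fin_num mI (continuous_integrable_oo g T cD)).
  congr EFin; apply/eqP; rewrite eq_le hI /=.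
  by apply: Rintegral_ge0 => t _; exact: D0.
have mD : measurable_fun (`]g, T[ : set (measurableTypeR R))
    (fun t => (density T a u m t)%:E).
  by apply/measurable_EFinP/measurable_funTS; exact: continuous_measurable_fun.
have ae := ge0_integral_eq0_ae mI mD (fun t => D0 t) E.
apply: (ae_continuous_le cD (@cst_continuous _ _ (0 : R))).
apply: filterS ae => t H tI.
have : (density T a u m t)%:E = 0%E by apply: H; rewrite /= in_itv.
by case=> ->.
Qed.

Lemma ip_eq0 u t : C21 T u -> 0 < t < T -> ip T u u t <= 0 ->
  forall x, cube n x -> u (x, t) = 0.
Proof.
move=> hu tT h x cx; have [cu _ _] := C21_cb T0 hu.
have E : avg (fun x => ext T u (x, t) ^+ 2) = 0.
  by apply/eqP; rewrite -ipX2 eq_le h avg_sqr_ge0.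
have := avg_eq0 (cbX2 cu) (fun p => sqr_ge0 _) E cx.
by move/eqP; rewrite sqrf_eq0 (ext_cyl T0 u cx tT) => /eqP.
Qed.

Lemma closure_cylinder_eq0 u : C21 T u -> (forall p, cylinder n 0 T p -> u p = 0) ->
  forall p, closure (cylinder n 0 T) p -> u p = 0.
Proof.
move=> hu u0 p cp; have [[cu _] _ _] := C21_cb T0 hu.
have cp' := cp; rewrite closure_cylinder// in cp'.
rewrite -(ext_id u cp'); apply/eqP; apply/negPn/negP => up.
(* A nonzero value persists on a neighbourhood by continuity, and this meets the cylinder. *)
have [q [Qq /=]] := cp _ (cvgr_neq0 _ (cu p) up).
by rewrite (ext_id u (cyl_ccyl T0 Qq)) u0// eqxx.
Qed.

End norm_bounds.

(** * Powers of delta and the conclusion *)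

Section powers.
Context {R : realType}.

(** The square root gives the exponent [kappa / 2], which for [kappa < 1/2] is only known to be
    below 1/4. Halving it once more, harmless for [delta < 1], brings it below 1/8 and thus below
    1/6. *)
Lemma sqrt_powR_le (c kappa delta : R) : 0 <= c -> 0 < kappa -> 0 < delta < 1 ->
  Num.sqrt (c * delta `^ kappa) <= (c + 1) * delta `^ (kappa / 4).
Proof.
move=> c0 k0 /andP[d0 d1]; rewrite sqrtrM//; apply: ler_pM; rewrite ?sqrtr_ge0//.
  have := sqr_sqrtr c0; have := sqrtr_ge0 c; move: (Num.sqrt c) => s s0 <-; nra.
rewrite -powR12_sqrt ?powR_ge0// -powRrM; apply: ger_powR; last lra.
by rewrite d0 ltW.
Qed.

Lemma le0_powR (x C kappa delta0 : R) : 0 < C -> 0 < kappa -> 0 < delta0 ->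
  (forall delta, 0 < delta < delta0 -> x <= C * delta `^ kappa) -> x <= 0.
Proof.
move=> C0 k0 d0 H; rewrite leNgt; apply/negP => x0.
(* Chosen so that [delta ^ kappa <= e] gives [x <= C * e = x / 2], which is absurd for positive
   [x]. *)
pose e := x / (2 * C); have e0 : 0 < e by rewrite divr_gt0// mulr_gt0.
pose delta := Num.min (delta0 / 2) (e `^ kappa^-1).
have dd : 0 < delta < delta0.
  by rewrite lt_min gt_min powR_gt0// divr_gt0//=; apply/orP; left; lra.
have h : delta `^ kappa <= e.
  rewrite -[leRHS](powRr1 (ltW e0)) -(mulVf (lt0r_neq0 k0)) powRrM.
  have /andP[dp _] := dd.
  apply: ge0_ler_powR; [exact: ltW|by rewrite nnegrE ltW|by rewrite nnegrE powR_ge0|].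
  by rewrite ge_min lexx orbT.
have := le_trans (H _ dd) (ler_wpM2l (ltW C0) h).
have -> : C * e = x / 2 by rewrite /e; field; rewrite gt_eqF.
by lra.
Qed.

End powers.

Theorem theorem6p1 (R : realType) (n : nat) (hn : (0 < n)%N)
    (a : 'I_n -> 'I_n -> 'rV[R]_n -> R) (mu1 mu2 : R)
    (hmu1 : 0 < mu1) (hmu2 : 0 < mu2) (ha : coefficients a mu1 mu2)
    (T M1 M gamma : R) (hT : 1 < T) (hM1 : 0 < M1) (hM : 0 < M)
    (hgamma : 1 < gamma < T) :
  (exists delta0 beta C1 : R,
     [/\ 0 < delta0 < 1, 0 < beta < 1 / 6, 0 < C1 &
     forall (K : 'I_n -> 'rV[R]_n -> R)
       (F1 : 'rV[R]_(dim1 n + (n + 1)) -> R)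
       (F2 : 'rV[R]_(dim2 n + (n + 1)) -> R)
       (fu fm u1 m1 u2 m2 : 'rV[R]_n * R -> R),
     kernels K M1 -> nonlinearities T a K F1 F2 M1 M ->
     in_B T M1 u1 m1 -> in_B T M1 u2 m2 ->
     solution T a K F1 F2 fu fm u1 m1 -> solution T a K F1 F2 fu fm u2 m2 ->
     let u := fun p => u1 p - u2 p in
     let m := fun p => m1 p - m2 p in
     forall delta : R, 0 < delta < delta0 ->
     (H1_norm (fun x => u (x, T)) <= delta%:E)%E ->
     (H1_norm (fun x => m (x, T)) <= delta%:E)%E ->
     (L2_cyl gamma T (dt T u) + L2_cyl gamma T (Lop T a u)
      + L2_cyl gamma T (fun p => enorm (grad T u p)) + L2_cyl gamma T u
      + L2_cyl gamma T (fun p => enorm (grad T m p)) + L2_cyl gamma T m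
      <= (C1 * delta `^ beta)%:E)%E]) /\
  (forall (K : 'I_n -> 'rV[R]_n -> R)
     (F1 : 'rV[R]_(dim1 n + (n + 1)) -> R)
     (F2 : 'rV[R]_(dim2 n + (n + 1)) -> R)
     (fu fm u1 m1 u2 m2 : 'rV[R]_n * R -> R),
   kernels K M1 -> nonlinearities T a K F1 F2 M1 M ->
   in_B T M1 u1 m1 -> in_B T M1 u2 m2 ->
   solution T a K F1 F2 fu fm u1 m1 -> solution T a K F1 F2 fu fm u2 m2 ->
   (forall x, cube n x -> u1 (x, T) = u2 (x, T)) ->
   (forall x, cube n x -> m1 (x, T) = m2 (x, T)) ->
   forall p, closure (cylinder n 0 T) p -> u1 p = u2 p /\ m1 p = m2 p).

Proof.
have T0 : 0 < T by lra.
have half (t : R) : 0 < t < T -> 0 < t / 2 < T /\ t / 2 < t < T.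
  by move=> /andP[t0 tT]; split; apply/andP; split; lra.
have /andP[g1 gT] := hgamma.
have q0 : 0 < 1 + mu1^-1 by rewrite addr_gt0// invr_gt0.
split.
  have g0 : 0 < gamma < T by rewrite gT andbT; lra.
  have [kappa [delta0 [C [/andP[k0 k2] /andP[d0 d1] C0 H]]]] :=
    holder_density T0 hmu1 hmu2 ha hM1 hM g0.
  have c0 : 0 <= (1 + mu1^-1) * C by rewrite mulr_ge0// ltW.
  (* There are six norms, each at most the square root of [(1 + mu1^-1) * C * delta ^ kappa]. *)
  exists delta0, (kappa / 4), (6 * ((1 + mu1^-1) * C + 1)).
  split; [by rewrite d0|by apply/andP; split; lra|by lra|].
  move=> K F1 F2 fu fm u1 m1 u2 m2 hK hN hB1 hB2 hS1 hS2 u m delta /andP[dp dd] hu hm.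
  have [cu cm] := C21_diff hB1 hB2; rewrite -/u -/m in cu cm.
  have dl : 0 < delta < delta0 by rewrite dp.
  have I := H K F1 F2 fu fm u1 m1 u2 m2 hK hN hB1 hB2 hS1 hS2 delta dl
    (H1_norm_terminal T0 cu (ltW dp) hu) (H1_norm_terminal T0 cm (ltW dp) hm).
  have I0 : 0 <= C * delta `^ kappa by rewrite mulr_ge0 ?powR_ge0// ltW.
  apply: (le_trans (L2_sum_le T0 hmu1 ha cu cm g0 I0 I)).
  rewrite lee_fin -mulrA; apply: ler_wpM2l => //; rewrite mulrA.
  by apply: sqrt_powR_le => //; rewrite dp (lt_trans dd).
move=> K F1 F2 fu fm u1 m1 u2 m2 hK hN hB1 hB2 hS1 hS2 uT mT.
have [cu cm] := C21_diff hB1 hB2.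
pose u p := u1 p - u2 p; pose m p := m1 p - m2 p.
rewrite -/u -/m in cu cm.
have uT0 : ip T u u T + grad_sq T u T = 0.
  by apply: terminal_eq0 => // x cx; rewrite /u uT// subrr.
have mT0 : ip T m m T + grad_sq T m T = 0.
  by apply: terminal_eq0 => // x cx; rewrite /m mT// subrr.
(* Equal terminal values meet the smallness condition for every [delta], so [delta] may tend to 0.
   The constants depend on the left end point, but each [t] needs only one estimate, here with left
   end point [t / 2]. *)
have D0 t : 0 < t < T -> density T a u m t <= 0.
  move=> /half[g0 gt].
  have [kappa [delta0 [C [/andP[k0 _] /andP[d0 _] C0 H]]]] :=
    holder_density T0 hmu1 hmu2 ha hM1 hM g0.
  apply: (density_eq0 T0 hmu1 ha cu cm g0) gt.
  apply: (le0_powR C0 k0 d0) => delta dl.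
  apply: (H K F1 F2 fu fm u1 m1 u2 m2 hK hN hB1 hB2 hS1 hS2 delta dl).
    by rewrite (uT0 : _ + _ = 0) sqr_ge0.
  by rewrite (mT0 : _ + _ = 0) sqr_ge0.
(* The density dominates the squared norms of [u] and [m] at each time, so both vanish inside the
   cylinder, and by continuity on its closure. *)
have z (w : 'rV[R]_n * R -> R) : C21 T w -> (forall t, ip T w w t <= density T a u m t) ->
    forall p, closure (cylinder n 0 T) p -> w p = 0.
  move=> cw wD; apply: (closure_cylinder_eq0 T0 cw) => -[x t] [/= cx].
  rewrite in_itv /= => tT; exact: (ip_eq0 T0 cw tT (le_trans (wD t) (D0 t tT)) cx).
move=> p cp; split; apply/eqP; rewrite -subr_eq0; apply/eqP.
  exact: (z u cu (fun t => proj1 (ip_le_density T0 hmu1 ha t cu cm)) p cp).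
exact: (z m cm (fun t => proj2 (ip_le_density T0 hmu1 ha t cu cm)) p cp).
Qed.
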